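(* Let $X=[0,1]$, let $f:X\to X$ be defined by $f(x)=2x \bmod 1$, let $a\in(0,1)$, and let $\varphi:X\to\mathbb{S}^1$ be defined by $\varphi(x)=\operatorname{dist}(x,1)^a$. Then the skew-product $f_\varphi:X\times\mathbb{S}^1\to X\times\mathbb{S}^1$, $f_\varphi(x,u)=(fx,u+\varphi(x))$, mixes exponentially for observables supported on the complement of a neighbourhood of $\{1\}\times\mathbb{S}^1$. That is: for every neighbourhood $U$ of $\{1\}\times\mathbb{S}^1$ in $X\times\mathbb{S}^1$ and every $\alpha>0$ there exist $\theta\in(0,1)$ and $C>0$ such that, for all bounded functions $g,h:X\times\mathbb{S}^1\to\mathbb{C}$ which are H\''older continuous with exponent $\alpha$ and supported on the complement of $U$, and for all $n\in\mathbb{N}$, $$\left|\int g\circ f_\varphi^n\cdot h\,d\nu-\left(\int g\,d\nu\right)\left(\int h\,d\nu\right)\right|\le C\,\theta^n\,\|g\|_{L^\infty}\,\|h\|_{\mathcal{C}^\alpha}.$$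
   Context: $\mathbb{S}^1=\mathbb{R}/\mathbb{Z}$, and real numbers are regarded as elements of $\mathbb{S}^1$ via the quotient map. The distance is that of the interval, $\operatorname{dist}(x,1)=1-x$ for $x\in[0,1]$. $\nu$ is the product of Lebesgue measure on $[0,1]$ (the absolutely continuous $f$-invariant probability measure) and Lebesgue probability measure on $\mathbb{S}^1$. $\|h\|_{\mathcal{C}^\alpha}$ is the usual H\''older norm (sup norm plus $\alpha$-H\''older seminorm). *)

(* Defs.v *)
From HB Require Import structures.
From mathcomp Require Import all_boot all_order all_algebra.
From mathcomp Require Import generic_quotient ring_quotient complex.
From mathcomp Require Import ring lra.
From mathcomp Require Import all_classical all_reals all_analysis.
From mathcomp Require Import measurable_realfun.

Set Implicit Arguments.
Unset Strict Implicit.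
Unset Printing Implicit Defensive.

Import Order.TTheory GRing.Theory Num.Theory.
Import numFieldNormedType.Exports.

Local Open Scope classical_set_scope.
Local Open Scope ring_scope.
Local Open Scope quotient_scope.

Section Circle.
Variable R : realType.

Definition integer_pred : {pred R} := fun x => x \is a Num.int.

Fact integer_pred_zmod_closed : zmod_closed integer_pred.
Proof.
split=> [|x y]; rewrite /integer_pred !unfold_in; first exact: Num.Theory.int_num0.
exact: rpredB.
Qed.

HB.instance Definition _ :=
  GRing.isZmodClosed.Build R integer_pred integer_pred_zmod_closed.

(* R / Z, as the quotient of the additive group R by its integers. *)
Definition circle : Type := Quotient.quot integer_pred.

HB.instance Definition _ := GRing.Zmodule.on circle.
HB.instance Definition _ : EqQuotient R (Quotient.equiv integer_pred) circle :=
  EqQuotient.on circle.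
HB.instance Definition _ := Pointed.copy circle (circle : zmodType).

Definition to_circle (x : R) : circle := \pi_circle x.

Lemma to_circle_eq (x y : R) :
  (to_circle x == to_circle y) = (x - y \is a Num.int).
Proof. by rewrite /to_circle -Quotient.idealrBE. Qed.

Lemma to_circleD (x y : R) : to_circle (x + y) = to_circle x + to_circle y.
Proof. exact: (@Quotient.pi_add R integer_pred). Qed.

(* Quotient metric: the infimum of |x - y| over all real lifts x, y. *)
Definition lift_distances (u v : circle) : set R := [set r | exists x y,
    [/\ to_circle x = u, to_circle y = v & r = `|x - y|]].

Definition circle_dist (u v : circle) : R := inf (lift_distances u v).

Let to_circle_repr (u : circle) : to_circle (repr u) = u.
Proof. exact: reprK. Qed.

Let lift_gaps_lb u v : lbound (lift_distances u v) 0.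
Proof. by move=> _ [x [y [_ _ ->]]]. Qed.

Let lift_gaps_neq0 u v : lift_distances u v !=set0.
Proof. by exists `|repr u - repr v|, (repr u), (repr v); split. Qed.

Let lift_gaps_has_inf u v : has_inf (lift_distances u v).
Proof. by split=> //; exists 0; exact: lift_gaps_lb. Qed.

Let circle_dist_le x y :
  circle_dist (to_circle x) (to_circle y) <= `|x - y|.
Proof.
by apply: ge_inf; [exists 0; exact: (@lift_gaps_lb (to_circle x) (to_circle y)) | exists x, y; split].
Qed.

Let circle_dist_approx u v e : 0 < e -> exists x y,
  [/\ to_circle x = u, to_circle y = v & `|x - y| < circle_dist u v + e].
Proof.
move=> e0; have [_ [x [y [xu yv ->]]] lt_e] :=
  inf_adherent e0 (lift_gaps_has_inf u v).
by exists x, y; split.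
Qed.

Let circle_dist_ge0 u v : 0 <= circle_dist u v.
Proof. by apply: lb_le_inf => //; exact: lift_gaps_lb. Qed.

Let circle_distxx u : circle_dist u u = 0.
Proof.
apply/eqP; rewrite eq_le circle_dist_ge0 andbT -(to_circle_repr u).
by rewrite (le_trans (circle_dist_le _ _))// subrr normr0.
Qed.

Let circle_dist_sym u v : circle_dist u v = circle_dist v u.
Proof.
congr inf; apply/seteqP.
by split=> _ [x [y [xu yv ->]]]; exists y, x; split=> //; rewrite distrC.
Qed.

Let circle_dist_triangle v u w :
  circle_dist u w <= circle_dist u v + circle_dist v w.
Proof.
apply/ler_addgt0Pl => e e0; have e20 : 0 < e / 2 by rewrite divr_gt0.
have [x [y [xu yv xy]]] := circle_dist_approx u v e20.
have [y' [z [yv' zw yz]]] := circle_dist_approx v w e20.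
have yy' : to_circle (y - y') = 0.
  apply/eqP; rewrite -[0](_ : to_circle 0 = 0); last first.
    by apply: (addrI (to_circle 0)); rewrite -to_circleD !addr0.
  by rewrite to_circle_eq subr0 -to_circle_eq yv yv'.
have zw' : to_circle (z + (y - y')) = w by rewrite to_circleD yy' addr0.
have := circle_dist_le x (z + (y - y')); rewrite xu zw' => /le_trans; apply.
have -> : x - (z + (y - y')) = (x - y) + (y' - z).
  by ring.
apply: (le_trans (ler_normD _ _)).
apply: (le_trans (lerD (ltW xy) (ltW yz))).
by rewrite addrACA -splitr addrC.
Qed.

Let circle_dist_positivity u v : circle_dist u v = 0 -> u = v.
Proof.
move=> uv0; rewrite -(to_circle_repr u) -(to_circle_repr v).
set s := repr u; set t := repr v; apply/eqP; rewrite to_circle_eq.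
apply/negPn/negP => st.
have /andP[f1 f2] := floor_itv (s - t); set m := Num.floor _ in f1 f2.
have f3 : m%:~R < s - t.
  rewrite lt_neqAle f1 andbT; apply: contra st => /eqP <-.
  exact: Num.Theory.intr_int.
pose e := Num.min (s - t - m%:~R) ((m + 1)%:~R - (s - t)).
have e0 : 0 < e by rewrite /e lt_min !subr_gt0 f3 f2.
have [x [y [xu yv]]] := circle_dist_approx u v e0.
rewrite uv0 add0r /e lt_min => /andP[h1 h2].
have /intrP[k kE] : x - y - (s - t) \is a Num.int.
  have -> : x - y - (s - t) = (x - s) - (y - t).
    by ring.
  by rewrite rpredB // -to_circle_eq ?xu ?yv to_circle_repr.
have xyE : x - y = s - t + k%:~R by rewrite -kE; ring.
have [n0|n0] := leP 0 (m + k).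
  have : s - t - m%:~R <= x - y.
    have : (0 : R) <= (m + k)%:~R by rewrite ler0z.
    rewrite intrD; lra.
  by move=> /le_lt_trans /(_ (le_lt_trans (ler_norm _) h1)); rewrite ltxx.
have : (m + 1)%:~R - (s - t) <= - (x - y).
  have : (m + k + 1)%:~R <= (0 : R) by rewrite lerz0 lezD1.
  rewrite !intrD; lra.
move=> /le_lt_trans; rewrite -normrN in h2.
by move=> /(_ _ (le_lt_trans (ler_norm _) h2)); rewrite ltxx.
Qed.

HB.instance Definition _ := @isMetric.Build R circle circle_dist
  circle_distxx circle_dist_positivity circle_dist_sym circle_dist_triangle.

Lemma mdist_circleE (u v : circle) : mdist u v = circle_dist u v.
Proof. by []. Qed.

Lemma to_circle_continuous : continuous to_circle.
Proof.
move=> x; apply/cvg_ballP => e e0; near=> y.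
rewrite ballEmdist /= mdist_circleE (le_lt_trans (circle_dist_le _ _))//.
Unshelve. all: by end_near.
Qed.

(* Borel sigma-algebra. *)
HB.instance Definition _ := @isMeasurable.Build
  (sigma_display (@open circle)) circle <<s @open circle >>
  (@sigma_algebra0 _ setT (@open circle)) (@sigma_algebraC _ (@open circle))
  (@sigma_algebra_bigcup _ setT (@open circle)).

Lemma measurable_to_circle : measurable_fun [set: measurableTypeR R] to_circle.
Proof.
apply: (@measurability _ _ _ _ _ _ (@open circle)) => //.
move=> _ [V oV <-]; rewrite setTI; apply: open_measurable.
by move/continuousP : to_circle_continuous; apply.
Qed.

End Circle.

Section Measures.
Variable R : realType.

Definition lebesgue01 : set (measurableTypeR R) -> \bar R :=
  mrestr lebesgue_measure (measurable_itv `[0%R, 1%R]).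

HB.instance Definition _ := Measure.on lebesgue01.

Fact lebesgue01_setT : lebesgue01 setT = 1%E.
Proof.
rewrite /lebesgue01 /mrestr setTI lebesgue_measure_itv /= lte_fin ltr01.
by rewrite -EFinB subr0.
Qed.

HB.instance Definition _ :=
  Measure_isProbability.Build _ _ _ lebesgue01 lebesgue01_setT.

(* The quotient map is injective on [0, 1] up to the null set {0, 1}, so this
   image measure is the Haar probability measure of R / Z. *)
Definition lebesgue_circle : set (circle R) -> \bar R :=
  pushforward lebesgue01 (@to_circle R).

HB.instance Definition _ := Measure.copy lebesgue_circle
  (measure_function_pushforward__canonical__measure_function_Measure
     lebesgue01 (@measurable_to_circle R)).

Fact lebesgue_circle_setT : lebesgue_circle setT = 1%E.
Proof. by rewrite /lebesgue_circle /pushforward preimage_setT lebesgue01_setT. Qed.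

HB.instance Definition _ :=
  Measure_isProbability.Build _ _ _ lebesgue_circle lebesgue_circle_setT.

Definition phase_measure : set (measurableTypeR R * circle R) -> \bar R :=
  (lebesgue01 \x lebesgue_circle)%E.

HB.instance Definition _ := Measure.on phase_measure.

Fact phase_measure_setT : phase_measure setT = 1%E.
Proof.
rewrite -setXTT /phase_measure product_measure1E//.
by rewrite -[LHS]/(lebesgue01 setT * lebesgue_circle setT)%E lebesgue01_setT
  lebesgue_circle_setT mule1.
Qed.

HB.instance Definition _ :=
  Measure_isProbability.Build _ _ _ phase_measure phase_measure_setT.

End Measures.
Arguments phase_measure {R}.

Section System.
Variable R : realType.

(* X x S^1.  Observables are functions on R * circle R of which only the
   values on this set are ever used: every hypothesis, norm and integral below
   is restricted to it, and phase_measure does not charge its complement. *)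
Definition phase_space : set (R * circle R) := `[0, 1] `*` setT.

Definition fibre_over_1 : set (R * circle R) := [set 1] `*` setT.

(* Neighbourhood in the subspace topology of phase_space. *)
Definition phase_neighbourhood (A U : set (R * circle R)) : Prop :=
  exists V, [/\ open V, A `<=` V & V `&` phase_space `<=` U].

Definition phase_dist (z w : R * circle R) : R :=
  Num.max `|z.1 - w.1| (mdist z.2 w.2).

Definition doubling (x : R) : R := 2 * x - (Num.floor (2 * x))%:~R.

Definition skewing (a x : R) : circle R := to_circle (`|x - 1| `^ a).

Definition skew_product (a : R) (z : R * circle R) : R * circle R :=
  (doubling z.1, z.2 + skewing a z.1).

Lemma skew_product_phase_space (a : R) (z : R * circle R) :
  phase_space z -> phase_space (skew_product a z).
Proof.
move=> _; split=> //=; rewrite in_itv /= /doubling.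
have /andP[f1 f2] := floor_itv (2 * z.1).
by rewrite subr_ge0 f1 /= lerBlDr addrC -(intrD _ _ 1) ltW.
Qed.

End System.
Arguments phase_space {R}.
Arguments fibre_over_1 {R}.

Section Observables.
Variable R : realType.
Local Notation normc := ComplexField.Normc.normc.
Implicit Types (alpha : R) (g : R * circle R -> R[i]).

Definition bounded_observable g : Prop :=
  exists M : R, forall z, phase_space z -> normc (g z) <= M.

Definition hoelder_observable alpha g : Prop :=
  exists K : R, forall z w, phase_space z -> phase_space w ->
    normc (g z - g w) <= K * phase_dist z w `^ alpha.

(* Vanishing off A; for open U, supported_on (~` U) also says that the closed
   support avoids U. *)
Definition supported_on (A : set (R * circle R)) g : Prop :=
  forall z, phase_space z -> ~ A z -> g z = 0.

Definition sup_norm g : \bar R :=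
  ereal_sup [set (normc (g z))%:E | z in phase_space].

Definition hoelder_seminorm alpha g : \bar R :=
  ereal_sup [set r | exists z w, [/\ phase_space z, phase_space w, z <> w &
    r = (normc (g z - g w) / phase_dist z w `^ alpha)%:E]].

Definition hoelder_norm alpha g : \bar R :=
  (sup_norm g + hoelder_seminorm alpha g)%E.

Definition Linfty_norm g : \bar R :=
  Lnorm phase_measure +oo%E (fun z => (normc (g z))%:E).

Definition phase_integral g : R[i] :=
  ((\int[phase_measure]_(z in phase_space) complex.Re (g z)) +i*
   (\int[phase_measure]_(z in phase_space) complex.Im (g z)))%C.

End Observables.

(* Main.v *)
(**
Let [phi x = (1 - x) ^ a].  By duality, the correlation of [g] and [h] is
controlled by the oscillation of the averages of
[h (y_w x, u - S_w phi x)] over the words [w] of length [n], where [y_w] are the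
inverse branches of doubling and [S_w phi] the Birkhoff sums along them.  A
discrete Fejer kernel in the fibre reduces this to a supremum bound for the
transfer operators twisted by [exp (i kappa S_w phi)], polynomial in [kappa] and
exponentially small in [n].

That bound is an oscillatory cancellation. Up to sign, the slope of [S_w phi]
at [x] is the sum of [- phi'] along the branch divided by powers of 2, and
since [- phi'] is increasing, replacing a digit 0 by 1 raises it by a definite
amount. Hence the slopes do not concentrate: an interval of length [2 ^- q]
has exponentially small probability in [q]. After Cauchy-Schwarz over the
dyadic preimages of a point, the phase difference of two words is locally
linear with slope [kappa] times the difference of the slopes, and its
exponential sum over these preimages is small except for rare pairs. The
slopes blow up only at 1, where a proportion [2 ^- q] of the preimages is
discarded.
*)
Require Import Defs.
From mathcomp Require Import all_boot all_order all_algebra complex.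
From mathcomp Require Import zify ring lra.
From mathcomp Require Import all_classical all_reals all_analysis.
From mathcomp Require Import measurable_realfun ess_sup_inf.

Set Implicit Arguments.
Unset Strict Implicit.
Unset Printing Implicit Defensive.

Import Order.TTheory GRing.Theory Num.Theory.
Import numFieldNormedType.Exports.

Local Open Scope classical_set_scope.
Local Open Scope ring_scope.

(** * Averages over inverse branches *)

Lemma eq_ler (R : realType) (x y : R) : x = y -> x <= y.
Proof. by move->. Qed.

Section PowerInequalities.
Variable R : realType.
Implicit Types (b s t : R).

Lemma powR_expR t b : 0 < t -> t `^ b = expR (b * ln t).
Proof. by move=> t0; rewrite /powR gt_eqF. Qed.

Lemma ln_leB1 t : 0 < t -> ln t <= t - 1.
Proof.
move=> t0; have {1}-> : t = 1 + (t - 1) by ring.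
by apply: le_ln1Dx; lra.
Qed.

Lemma powR_npow_le b s t : b <= 0 -> 0 < s -> s <= t -> t `^ b <= s `^ b.
Proof.
move=> b0 s0 st; have t0 := lt_le_trans s0 st.
rewrite !powR_expR// ler_expR; apply: ler_wnM2l => //.
by rewrite ler_ln.
Qed.

Lemma powRM_ratio b s t : 0 < s -> 0 < t -> s `^ b = t `^ b * (s / t) `^ b.
Proof.
move=> s0 t0; rewrite -powRM ?divr_ge0 ?ltW//.
by rewrite mulrCA divff ?mulr1// gt_eqF.
Qed.

Lemma powR_sub1 b t : 0 < t -> t `^ (b - 1) = t `^ b / t.
Proof.
move=> t0; rewrite powRB; first by rewrite powRr1// ltW.
by rewrite (gt_eqF t0) implybT.
Qed.

Lemma powR_tangent_ge b s t : b <= 0 -> 0 < s -> 0 < t ->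
  t `^ b + b * t `^ (b - 1) * (s - t) <= s `^ b.
Proof.
move=> b0 s0 t0; rewrite powR_sub1// (powRM_ratio b s0 t0).
have -> : t `^ b + b * (t `^ b / t) * (s - t) = t `^ b * (1 + b * (s / t - 1)).
  by field; rewrite gt_eqF.
rewrite ler_wpM2l ?powR_ge0//.
have st0 : 0 < s / t by rewrite divr_gt0.
rewrite (powR_expR _ st0) (le_trans _ (expR_ge1Dx _))// lerD2l.
by apply: ler_wnM2l => //; exact: ln_leB1.
Qed.

Lemma powR_tangent_le b s t : 0 <= b -> b <= 1 -> 0 < s -> 0 < t ->
  s `^ b <= t `^ b + b * t `^ (b - 1) * (s - t).
Proof.
move=> b0 b1 s0 t0; rewrite powR_sub1// (powRM_ratio b s0 t0).
have -> : t `^ b + b * (t `^ b / t) * (s - t) = t `^ b * (1 + b * (s / t - 1)).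
  by field; rewrite gt_eqF.
rewrite ler_wpM2l ?powR_ge0//.
have := divr_gt0 s0 t0; move: (s / t) => u u0.
have m0 : 0 < 1 + b * (u - 1).
  have : 0 <= b * u by rewrite mulr_ge0// ltW.
  rewrite mulrBr mulr1; case: (ltP b 1) => [|b1' _]; first lra.
  have -> : b = 1 by lra.
  by rewrite mul1r; lra.
have [m mE] : exists m, m = 1 + b * (u - 1) by eexists.
rewrite -mE in m0 *.
rewrite (powR_expR _ u0) -[leRHS]lnK ?posrE// ler_expR.
have h1 := ln_leB1 (divr_gt0 u0 m0).
have h2 : ln m^-1 <= m^-1 - 1 by apply: ln_leB1; rewrite invr_gt0.
rewrite ln_div ?posrE// in h1; rewrite lnV ?posrE// in h2.
have h3 : b * (ln u - ln m) <= b * (u / m - 1) by exact: ler_wpM2l.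
have h4 : (1 - b) * (- ln m) <= (1 - b) * (m^-1 - 1).
  by apply: ler_wpM2l => //; lra.
have h5 : b * (u / m - 1) + (1 - b) * (m^-1 - 1) = 0.
  have -> : b * (u / m - 1) + (1 - b) * (m^-1 - 1) = (1 + b * (u - 1)) / m - 1.
    by field; rewrite gt_eqF.
  by rewrite -mE divff ?subrr// gt_eqF.
nra.
Qed.

Lemma powR_subadd b s t : 0 < b -> b <= 1 -> 0 <= s -> 0 <= t ->
  (s + t) `^ b <= s `^ b + t `^ b.
Proof.
move=> b0 b1 s0 t0; have bn0 : b != 0 by rewrite gt_eqF.
have [->|sn0] := eqVneq s 0; first by rewrite powR0// !add0r.
have [->|tn0] := eqVneq t 0; first by rewrite powR0// !addr0.
have s1 : 0 < s by rewrite lt_neqAle eq_sym sn0.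
have t1 : 0 < t by rewrite lt_neqAle eq_sym tn0.
rewrite -(@mulr_powRB1 _ (s + t) b) ?addr_ge0// -(@mulr_powRB1 _ s b)//.
rewrite -(@mulr_powRB1 _ t b)// mulrDl lerD//; apply: ler_wpM2l => //;
  apply: powR_npow_le => //; lra.
Qed.

Lemma powR_holder a b s t : 0 < b -> b <= a -> a <= 1 -> 0 <= s -> s <= 1 ->
  0 <= t -> t <= 1 -> `|s `^ a - t `^ a| <= `|s - t| `^ b.
Proof.
move=> b0 ba a1; have a0 : 0 < a by exact: lt_le_trans ba.
wlog st : s t / t <= s => [hw s0 s1 t0 t1|s0 s1 t0 t1].
  have [/hw|/ltW/hw] := leP t s; first exact.
  by rewrite distrC [`|s - t|]distrC; apply.
rewrite !ger0_norm ?subr_ge0//; last by apply: ge0_ler_powR => //; exact: ltW.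
apply: (@le_trans _ _ ((s - t) `^ a)).
  rewrite lerBlDr; have {1}-> : s = (s - t) + t by ring.
  by apply: powR_subadd => //; rewrite subr_ge0.
have [->|stn] := eqVneq (s - t) 0; first by rewrite !powR0// gt_eqF.
apply: ger_powR => //; rewrite lt_neqAle eq_sym stn subr_ge0 st /=; lra.
Qed.

End PowerInequalities.

Section WordAverage.
Variable V : numFieldType.
Implicit Types F G : seq bool -> V.

Fixpoint avg n F : V :=
  if n is n'.+1 then
    (avg n' (fun w => F (false :: w)) + avg n' (fun w => F (true :: w))) / 2
  else F [::].

Lemma eq_avg n F G : (forall w, size w = n -> F w = G w) -> avg n F = avg n G.
Proof.
elim: n F G => [|n IH] F G FG /=; first exact: FG.
by congr ((_ + _) / 2); apply: IH => w wn; apply: FG; rewrite /= wn.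
Qed.

Lemma avgD n F G : avg n (fun w => F w + G w) = avg n F + avg n G.
Proof. by elim: n F G => [//|n IH] F G /=; rewrite !IH; field. Qed.

Lemma avgMl n (c : V) F : avg n (fun w => c * F w) = c * avg n F.
Proof. by elim: n F => [//|n IH] F /=; rewrite !IH; field. Qed.

Lemma avgMr n (c : V) F : avg n (fun w => F w * c) = avg n F * c.
Proof. by elim: n F => [//|n IH] F /=; rewrite !IH; field. Qed.

Lemma avg_cst n (c : V) : avg n (fun=> c) = c.
Proof. by elim: n => [//|n IH] /=; rewrite !IH; field. Qed.

Lemma avgN n F : avg n (fun w => - F w) = - avg n F.
Proof.
by rewrite -mulN1r -avgMl; apply: eq_avg => w _; rewrite mulN1r.
Qed.

Lemma avgB n F G : avg n (fun w => F w - G w) = avg n F - avg n G.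
Proof. by rewrite avgD avgN. Qed.

Lemma avg_sum n (I : Type) (r : seq I) (P : pred I) (F : I -> seq bool -> V) :
  avg n (fun w => \sum_(i <- r | P i) F i w) = \sum_(i <- r | P i) avg n (F i).
Proof.
elim: r => [|i r IH].
  rewrite big_nil; under eq_avg do rewrite big_nil.
  exact: avg_cst.
rewrite big_cons; under eq_avg do rewrite big_cons.
by case: (P i) => //; rewrite avgD IH.
Qed.

Lemma avg_cat m n F :
  avg (m + n) F = avg m (fun p => avg n (fun w => F (p ++ w))).
Proof. by elim: m F => [//|m IH] F; rewrite addSn /= !IH. Qed.

Lemma ler_avg n F G : (forall w, size w = n -> F w <= G w) -> avg n F <= avg n G.
Proof.
elim: n F G => [|n IH] F G FG /=; first exact: FG.
rewrite ler_pM2r ?invr_gt0//.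
by rewrite lerD// IH// => w wn; apply: FG; rewrite /= wn.
Qed.

End WordAverage.

Section NormAverage.
Variable R : realType.
Local Notation normc := ComplexField.Normc.normc.
Implicit Types F : seq bool -> R[i].

Lemma ler_normcD (x y : R[i]) : normc (x + y) <= normc x + normc y.
Proof. exact: le_normcD. Qed.

Lemma normcR (x : R) : normc x%:C%C = `|x|.
Proof. by rewrite /= expr0n addr0 sqrtr_sqr. Qed.

Lemma normc_ge0 (x : R[i]) : 0 <= normc x.
Proof. by case: x => x y; exact: sqrtr_ge0. Qed.

Lemma le_normc_avg n F : normc (avg n F) <= avg n (fun w => normc (F w)).
Proof.
elim: n F => [//|n IH] F /=.
rewrite ComplexField.Normc.normcM ComplexField.Normc.normcV.
have -> : normc (2 : R[i]) = 2.
  by rewrite -[2 : R[i]]/(2%:R) -(rmorph_nat (real_complex R)) normcR normr_nat.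
rewrite ler_pM2r ?invr_gt0//.
by rewrite (le_trans (ler_normcD _ _))// lerD.
Qed.

Lemma le_normc_sum (I : Type) (r : seq I) (P : pred I) (F : I -> R[i]) :
  normc (\sum_(i <- r | P i) F i) <= \sum_(i <- r | P i) normc (F i).
Proof.
elim/big_rec2: _ => [|i x y _ xy]; first by rewrite ComplexField.Normc.normc0.
by rewrite (le_trans (ler_normcD _ _))// lerD2l.
Qed.

Lemma le_norm_avg n (F : seq bool -> R) : `|avg n F| <= avg n (fun w => `|F w|).
Proof.
elim: n F => [//|n IH] F /=.
rewrite normrM normfV (ger0_norm (@ler0n _ 2)) ler_pM2r ?invr_gt0//.
by rewrite (le_trans (ler_normD _ _))// lerD.
Qed.

Lemma avg_drop n (F : seq bool -> R) (p : seq bool) (c d : R) : size p = n ->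
  (forall w, size w = n -> F w <= c) -> F p <= d ->
  avg n F <= c - (c - d) / 2 ^+ n.
Proof.
elim: n F p => [|n IH] F p /=; first by move/size0nil => -> _; rewrite expr0; lra.
case: p => [//|i p] /= [pn] Fc Fd.
have := @IH (fun w => F (i :: w)) p pn (fun w wn => Fc (i :: w) (congr1 S wn)) Fd.
have : avg n (fun w => F (~~ i :: w)) <= c.
  rewrite -[leRHS](avg_cst n); apply: ler_avg => w wn.
  by apply: Fc; rewrite /= wn.
rewrite exprS invfM mulrCA.
by case: i Fd => _ /=; set z := (c - d) / _; lra.
Qed.

End NormAverage.

Section InverseBranches.
Variable R : realType.
Implicit Types (x : R) (w : seq bool).

Definition branch (b : bool) x : R := (x + b%:R) / 2.

Fixpoint branches w x : R :=
  if w is b :: w' then branches w' (branch b x) else x.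

Fixpoint birkhoff (phi : R -> R) w x : R :=
  if w is b :: w' then phi (branch b x) + birkhoff phi w' (branch b x) else 0.

(* The chain rule for [x |-> birkhoff phi w x] when [p] is the derivative of
   [phi]. *)
Fixpoint dbirkhoff (p : R -> R) w x : R :=
  if w is b :: w' then (p (branch b x) + dbirkhoff p w' (branch b x)) / 2 else 0.

Lemma natb_itv (b : bool) : 0 <= b%:R :> R /\ b%:R <= 1 :> R.
Proof. by case: b; split. Qed.

Lemma branch_ge0 b x : 0 <= x -> 0 <= branch b x.
Proof. by move=> x0; have [] := natb_itv b; rewrite /branch; lra. Qed.

Lemma branch_le1 b x : x <= 1 -> branch b x <= 1.
Proof. by move=> x1; have [] := natb_itv b; rewrite /branch; lra. Qed.

Lemma branch_lt1 b x : x < 1 -> branch b x < 1.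
Proof. by move=> x1; have [] := natb_itv b; rewrite /branch; lra. Qed.

Lemma branchB b x y : branch b x - branch b y = (x - y) / 2.
Proof. by rewrite /branch; ring. Qed.

Lemma branches_ge0 w x : 0 <= x -> 0 <= branches w x.
Proof. by elim: w x => [//|b w IH] x x0 /=; exact/IH/branch_ge0. Qed.

Lemma branches_le1 w x : x <= 1 -> branches w x <= 1.
Proof. by elim: w x => [//|b w IH] x x1 /=; exact/IH/branch_le1. Qed.

Lemma branches_lt1 w x : x < 1 -> branches w x < 1.
Proof. by elim: w x => [//|b w IH] x x1 /=; exact/IH/branch_lt1. Qed.

Lemma branchesB w x y : branches w x - branches w y = (x - y) / 2 ^+ size w.
Proof.
elim: w x y => [|b w IH] x y /=; first by rewrite expr0 divr1.
by rewrite IH branchB exprS invfM mulrA.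
Qed.

Lemma branches_cat p w x : branches (p ++ w) x = branches w (branches p x).
Proof. by elim: p x => //= b p IH x; rewrite IH. Qed.

Lemma birkhoff_cat phi p w x :
  birkhoff phi (p ++ w) x = birkhoff phi p x + birkhoff phi w (branches p x).
Proof. by elim: p x => [|b p IH] x /=; rewrite ?add0r// IH addrA. Qed.

Lemma dbirkhoff_cat q p w x : dbirkhoff q (p ++ w) x =
  dbirkhoff q p x + dbirkhoff q w (branches p x) / 2 ^+ size p.
Proof.
elim: p x => [|b p IH] x /=; first by rewrite expr0 add0r divr1.
by rewrite IH exprS invfM; ring.
Qed.

End InverseBranches.

(** * Non-concentration of slopes *)

Section NonConcentration.
Variables (R : realType) (a : R).
Hypotheses (a_gt0 : 0 < a) (a_lt1 : a < 1).
Implicit Types (x y b t rho : R) (w u : seq bool) (m n j : nat).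

Definition roof x : R := `|x - 1| `^ a.

(* The opposite of the derivative of [roof] on [[0, 1[]. *)
Definition slope x : R := a * (1 - x) `^ (a - 1).

(* The sum of [2 ^- (b k)] over [k >= 1]. *)
Definition hconst b : R := (2 `^ b - 1)^-1.

Lemma powR2_gt1 b : 0 < b -> 1 < 2 `^ b :> R.
Proof. by move=> b0; rewrite powR_expR// expR_gt1 mulr_gt0// ln_gt0// ltr1n. Qed.

Lemma hconst_gt0 b : 0 < b -> 0 < hconst b.
Proof. by move=> /powR2_gt1 h; rewrite /hconst invr_gt0 subr_gt0. Qed.

Lemma hconst_fix b : 0 < b -> (1 + hconst b) / 2 `^ b = hconst b.
Proof.
move=> /powR2_gt1 h; rewrite /hconst; field.
by rewrite subr_eq0 (gt_eqF h) (gt_eqF (lt_trans ltr01 h)).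
Qed.

Lemma half_powR e x : 0 <= x -> (x / 2) `^ e = x `^ e / 2 `^ e.
Proof.
by move=> x0; rewrite powRM// -(powR_inv1 (ler0n _ 2)) -powRrM mulN1r powRN.
Qed.

Lemma roofE x : x <= 1 -> roof x = (1 - x) `^ a.
Proof. by move=> x1; rewrite /roof distrC ger0_norm// subr_ge0. Qed.

Lemma roof_holder b x y : 0 < b -> b <= a -> 0 <= x -> x <= 1 ->
  0 <= y -> y <= 1 -> `|roof x - roof y| <= `|x - y| `^ b.
Proof.
move=> b0 ba x0 x1 y0 y1; rewrite !roofE//.
apply: (le_trans (powR_holder b0 ba _ _ _ _ _)); rewrite ?subr_ge0 ?gerBl ?(ltW a_lt1)//.
have -> : 1 - x - (1 - y) = - (x - y) by ring.
by rewrite normrN.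
Qed.

Lemma birkhoff_holder b w x y : 0 < b -> b <= a -> 0 <= x -> x <= 1 ->
  0 <= y -> y <= 1 ->
  `|birkhoff roof w x - birkhoff roof w y| <= hconst b * `|x - y| `^ b.
Proof.
move=> b0 ba; elim: w x y => [|i w IH] x y x0 x1 y0 y1 /=.
  by rewrite subrr normr0 mulr_ge0 ?powR_ge0// ltW// hconst_gt0.
have h1 := roof_holder b0 ba (branch_ge0 i x0) (branch_le1 i x1)
  (branch_ge0 i y0) (branch_le1 i y1).
have h2 := IH _ _ (branch_ge0 i x0) (branch_le1 i x1)
  (branch_ge0 i y0) (branch_le1 i y1).
rewrite opprD addrACA (le_trans (ler_normD _ _))// (le_trans (lerD h1 h2))//.
rewrite branchB normrM (ger0_norm (_ : 0 <= 2^-1)) ?invr_ge0// half_powR//.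
have := hconst_fix b0; set h := hconst b; set z := _ `^ b; set k := 2 `^ b.
move=> hE; rewrite -{2}hE.
by apply: eq_ler; ring.
Qed.

Lemma slope_ge0 x : 0 <= slope x.
Proof. by rewrite mulr_ge0 ?powR_ge0// ltW. Qed.

Lemma slope_incr x y : y < 1 -> x <= y -> slope x <= slope y.
Proof.
have A0 := a_gt0; have A1 := a_lt1.
move=> y1 xy; rewrite /slope ler_pM2l//; apply: powR_npow_le; lra.
Qed.

Lemma slope_growth x y : 0 <= x -> x <= y -> y < 1 ->
  slope x + a * (1 - a) * (y - x) <= slope y.
Proof.
have A0 := a_gt0; have A1 := a_lt1.
move=> x0 xy y1; rewrite /slope.
have x1' : 0 < 1 - x by lra.
have y1' : 0 < 1 - y by lra.
have h := @powR_tangent_ge _ (a - 1) (1 - y) (1 - x) _ y1' x1'.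
have {h} := h (ltac:(lra)).
have : (1 : R) <= (1 - x) `^ (a - 1 - 1).
  rewrite -{1}(_ : 1 `^ (a - 1 - 1) = 1); last by rewrite powR1.
  by apply: powR_npow_le; lra.
set P := _ `^ (a - 1 - 1); set S := (1 - x) `^ _; set T := (1 - y) `^ _.
move=> P1 h; rewrite -mulrA -mulrDr ler_pM2l//; apply: le_trans h.
rewrite lerD2l; have -> : (a - 1) * P * (1 - y - (1 - x)) = P * ((1 - a) * (y - x)).
  by ring.
by rewrite ler_peMl// mulr_ge0//; lra.
Qed.

Lemma roof_taylor x y : 0 <= x -> x <= y -> y < 1 ->
  `|roof y - roof x + slope x * (y - x)| <= a * (1 - y) `^ (a - 2) * (y - x) ^+ 2.
Proof.
have A0 := a_gt0; have A1 := a_lt1.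
move=> x0 xy y1; rewrite !roofE ?(ltW y1)//; last lra.
have x1' : 0 < 1 - x by lra.
have y1' : 0 < 1 - y by lra.
have a0 := ltW a_gt0; have a1 := ltW a_lt1.
have h1 := powR_tangent_le a0 a1 y1' x1'.
have h2 := powR_tangent_le a0 a1 x1' y1'.
have h3 := @powR_tangent_ge _ (a - 1) (1 - x) (1 - y) ltac:(lra) x1' y1'.
rewrite (_ : a - 1 - 1 = a - 2) in h3; last by ring.
rewrite /slope.
have P0 : 0 <= (1 - y) `^ (a - 2) by exact: powR_ge0.
move: P0 h1 h2 h3.
move: ((1 - y) `^ (a - 2)) ((1 - x) `^ (a - 1)) ((1 - y) `^ (a - 1)).
move: ((1 - x) `^ a) ((1 - y) `^ a) => sx sy P qx qy P0 h1 h2 h3.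
have d0 : 0 <= y - x by lra.
rewrite ler0_norm; last lra.
have h4 : a * (y - x) * (qy - qx) <= a * (y - x) * ((1 - a) * P * (y - x)).
  by apply: ler_wpM2l; [exact: mulr_ge0|lra].
have h5 : a * (y - x) * ((1 - a) * P * (y - x)) <= a * P * (y - x) ^+ 2.
  rewrite (_ : _ * _ = a * P * (y - x) ^+ 2 * (1 - a)); last by ring.
  rewrite ler_piMr//; first by rewrite !mulr_ge0// sqr_ge0.
  lra.
apply: le_trans h5; apply: le_trans h4.
rewrite (_ : a * (y - x) * (qy - qx) =
  a * qy * (y - x) - a * qx * (y - x)); last by ring.
lra.
Qed.

Definition dconst : R := a * hconst a.

Lemma dconst_gt0 : 0 < dconst.
Proof. by rewrite mulr_gt0// hconst_gt0. Qed.

Lemma dconst_fix : (a + dconst) / 2 `^ a = dconst.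
Proof. by rewrite /dconst -{2}(hconst_fix a_gt0); ring. Qed.

Lemma branch_npowR e i x : e <= 0 -> x < 1 ->
  (1 - branch i x) `^ e <= (1 - x) `^ e / 2 `^ e.
Proof.
have A0 := a_gt0; have A1 := a_lt1.
move=> e0 x1; rewrite -half_powR; last lra.
apply: powR_npow_le => //; first lra.
by have [_] := natb_itv R i; rewrite /branch; lra.
Qed.

Lemma powR2B1 : 2 `^ (a - 1) = 2 `^ a / 2 :> R.
Proof. exact: powR_sub1. Qed.

Lemma powR2B2 : 2 `^ (a - 2) = 2 `^ a / 4 :> R.
Proof.
rewrite (_ : a - 2 = a - 1 - 1); last by ring.
by rewrite powR_sub1// powR2B1 -mulrA -invfM -natrM.
Qed.

Lemma powR2_neq0 b : 2 `^ b != 0 :> R.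
Proof. by rewrite gt_eqF// powR_gt0. Qed.

Lemma dbirkhoff_ge0 w x : 0 <= dbirkhoff slope w x.
Proof.
by elim: w x => [//|i w IH] x /=; rewrite divr_ge0// addr_ge0 ?slope_ge0.
Qed.

Lemma dbirkhoff_le w x : x < 1 ->
  dbirkhoff slope w x <= dconst * (1 - x) `^ (a - 1).
Proof.
have A0 := a_gt0; have A1 := a_lt1.
elim: w x => [|i w IH] x x1 /=.
  by rewrite mulr_ge0 ?powR_ge0// ltW// dconst_gt0.
have h1 := IH _ (branch_lt1 i x1).
have h2 : (1 - branch i x) `^ (a - 1) <= (1 - x) `^ (a - 1) * 2 / 2 `^ a.
  apply: le_trans (branch_npowR _ _ x1) _; first lra.
  by rewrite powR2B1 invf_div mulrA.
have h3 : slope (branch i x) + dbirkhoff slope w (branch i x) <=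
    (a + dconst) * (1 - branch i x) `^ (a - 1).
  by rewrite mulrDl lerD2l.
rewrite ler_pdivrMr// (le_trans h3)//.
apply: (@le_trans _ _ ((a + dconst) * ((1 - x) `^ (a - 1) * 2 / 2 `^ a))).
  by rewrite ler_wpM2l// addr_ge0 ?ltW// dconst_gt0.
rewrite -{2}dconst_fix; apply: eq_ler; ring.
Qed.

Lemma birkhoff_taylor w x y : 0 <= x -> x <= y -> y < 1 ->
  `|birkhoff roof w y - birkhoff roof w x + dbirkhoff slope w x * (y - x)|
  <= dconst * (1 - y) `^ (a - 2) * (y - x) ^+ 2.
Proof.
have A0 := a_gt0; have A1 := a_lt1.
elim: w x y => [|i w IH] x y x0 xy y1 /=.
  rewrite subrr mul0r addr0 normr0 mulr_ge0 ?sqr_ge0// mulr_ge0 ?powR_ge0//.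
  exact: ltW dconst_gt0.
have bxy : branch i x <= branch i y by rewrite /branch; lra.
have h1 := IH _ _ (branch_ge0 i x0) bxy (branch_lt1 i y1).
have h2 := roof_taylor (branch_ge0 i x0) bxy (branch_lt1 i y1).
rewrite branchB in h1 h2.
set X := branch i x in h1 h2 *; set Y := branch i y in h1 h2 *.
rewrite (_ : _ + _ = (roof Y - roof X + slope X * ((y - x) / 2)) +
  (birkhoff roof w Y - birkhoff roof w X +
   dbirkhoff slope w X * ((y - x) / 2))); last by field.
rewrite (le_trans (ler_normD _ _))// (le_trans (lerD h2 h1))//.
have h3 : (1 - Y) `^ (a - 2) <= (1 - y) `^ (a - 2) * 4 / 2 `^ a.
  apply: le_trans (branch_npowR _ _ y1) _; first lra.
  by rewrite powR2B2 invf_div mulrA.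
rewrite -mulrDl -mulrDl -mulrA.
apply: (@le_trans _ _ ((a + dconst) *
   (((1 - y) `^ (a - 2) * 4 / 2 `^ a) * ((y - x) / 2) ^+ 2))).
  rewrite ler_wpM2l ?addr_ge0 ?(ltW a_gt0) ?(ltW dconst_gt0)//.
  by rewrite ler_wpM2r// sqr_ge0.
rewrite -{2}dconst_fix; apply: eq_ler; field.
exact: powR2_neq0.
Qed.

Lemma dbirkhoff_nseq0_min w x y : 0 <= x -> x <= y -> y < 1 ->
  dbirkhoff slope (nseq (size w) false) x <= dbirkhoff slope w y.
Proof.
have A0 := a_gt0; have A1 := a_lt1.
elim: w x y => [//|i w IH] x y x0 xy y1 /=.
have bxy : branch false x <= branch i y.
  by have [? _] := natb_itv R i; rewrite /branch /=; lra.
rewrite ler_pM2r ?invr_gt0// lerD//.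
  by apply: slope_incr => //; exact: branch_lt1.
by apply: IH => //; [exact: branch_ge0|exact: branch_lt1].
Qed.

Lemma dbirkhoff_true w x : 0 <= x -> x < 1 ->
  dbirkhoff slope (nseq (size w).+1 false) x + a * (1 - a) / 4
  <= dbirkhoff slope (true :: w) x.
Proof.
have A0 := a_gt0; have A1 := a_lt1.
move=> x0 x1 /=.
have bxy : branch false x <= branch true x.
  rewrite /branch /=. lra.
have h1 := slope_growth (branch_ge0 false x0) bxy (branch_lt1 true x1).
have h2 := @dbirkhoff_nseq0_min w _ _ (branch_ge0 false x0) bxy (branch_lt1 true x1).
have h3 : branch true x - branch false x = 1 / 2 by rewrite /branch /=; lra.
rewrite h3 in h1; move: h1 h2; move: (a * (1 - a)) => c; lra.
Qed.

Lemma branch_nseq0_le m x : 0 <= x -> x < 1 -> (0 < m)%N ->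
  branches (nseq m false) x <= 1 / 2.
Proof.
have A0 := a_gt0; have A1 := a_lt1.
case: m => [//|m] x0 x1 _ /=.
have : branch false x <= 1 / 2 by rewrite /branch /=; lra.
have := branch_ge0 false x0; move: (branch false x) => z.
elim: m z => [//|m IH] z z0 z1 /=; apply: IH; first exact: branch_ge0.
by rewrite /branch /=; lra.
Qed.

Lemma dbirkhoff_zeros m w x : 0 <= x -> x < 1 -> (0 < m)%N ->
  dbirkhoff slope (nseq m false ++ w) x <=
  dbirkhoff slope (nseq (m + size w) false) x + 2 * dconst / 2 ^+ m.
Proof.
have A0 := a_gt0; have A1 := a_lt1.
move=> x0 x1 m0; rewrite nseqD !dbirkhoff_cat !size_nseq -addrA lerD2l.
have h0 : 0 <= dbirkhoff slope (nseq (size w) false) (branches (nseq m false) x).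
  exact: dbirkhoff_ge0.
rewrite -mulrDl ler_pM2r ?invr_gt0 ?exprn_gt0//.
rewrite (le_trans (dbirkhoff_le _ (branches_lt1 _ x1)))//.
apply: (@le_trans _ _ (2 * dconst)); last by rewrite lerDr.
rewrite mulrC ler_pM2r ?dconst_gt0//.
apply: (@le_trans _ _ ((1 / 2) `^ (a - 1))).
  apply: powR_npow_le; [lra|lra|].
  by have := branch_nseq0_le x0 x1 m0; lra.
rewrite half_powR// powR1 powR2B1 invf_div mul1r ler_pdivrMr ?powR_gt0//.
by rewrite ler_peMr// ltW// powR2_gt1.
Qed.

Definition gap : R := a * (1 - a) / 8.

Lemma gap_gt0 : 0 < gap.
Proof. by rewrite divr_gt0// mulr_gt0// subr_gt0. Qed.

Definition separating m : Prop := (0 < m)%N /\ 2 * dconst / 2 ^+ m <= gap.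

Lemma exp2_unbounded (c : R) : exists n, forall k, (n <= k)%N -> c <= 2 ^+ k.
Proof.
have [n hn] : exists n : nat, c <= n%:R.
  exists (Num.bound `|c|); apply: (le_trans (ler_norm _)).
  by apply/ltW/archi_boundP.
exists n => k nk; rewrite (le_trans hn)// -natrX ler_nat.
exact: (leq_trans nk (ltnW (ltn_expl _ _))).
Qed.

Lemma separating_ex : exists m, separating m.
Proof.
have [n hn] := exp2_unbounded (2 * dconst / gap).
exists n.+1; split => //.
rewrite ler_pdivrMr ?exprn_gt0// [gap * _]mulrC -ler_pdivrMr ?gap_gt0//.
by apply: hn.
Qed.

Lemma dbirkhoff_separation m u w x : separating m -> 0 <= x -> x < 1 ->
  size w = (m.-1 + size u)%N ->
  dbirkhoff slope (nseq m false ++ u) x + gap <= dbirkhoff slope (true :: w) x.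
Proof.
have A0 := a_gt0; have A1 := a_lt1.
move=> [m0 mgap] x0 x1 sw.
have h1 := dbirkhoff_zeros u x0 x1 m0.
have h2 := dbirkhoff_true w x0 x1.
rewrite sw -addSn prednK// in h2.
by move: mgap h1 h2; rewrite /gap; lra.
Qed.

(* Words starting with [m] zeros and words starting with [1 0 ... 0] cannot both
   have slope in the window, so each block of [m] letters loses a fixed
   proportion. *)
Lemma concentration m j n x t rho : separating m -> (m * j <= n)%N ->
  0 <= x -> x < 1 -> 0 <= rho -> rho * 2 ^+ (m * j) <= gap ->
  avg n (fun w => (t <= dbirkhoff slope w x <= t + rho)%R%:R : R)
  <= (1 - (2 ^+ m)^-1) ^+ j.
Proof.
have A0 := a_gt0; have A1 := a_lt1.
move=> sm; have [m0 _] := sm.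
have p2 : 0 < 2 ^+ m :> R by rewrite exprn_gt0.
elim: j n x t rho => [|j IH] n x t rho mn x0 x1 r0 rg.
  rewrite expr0 -[leRHS](avg_cst n); apply: ler_avg => w _.
  by case: (_ <= _ <= _).
have [k nE] : exists k, n = (m + k)%N.
  by exists (n - m)%N; rewrite subnKC// (leq_trans _ mn)// mulnS leq_addr.
rewrite nE avg_cat.
pose G p := avg k (fun u => (t <= dbirkhoff slope (p ++ u) x <= t + rho)%R%:R : R).
rewrite -[X in X <= _]/(avg m G).
have rg1 : rho * 2 ^+ m * 2 ^+ (m * j) <= gap.
  by rewrite -mulrA -exprD -mulnS.
have Gle p : size p = m -> G p <= (1 - (2 ^+ m)^-1) ^+ j.
  move=> pm; have := IH k (branches p x) ((t - dbirkhoff slope p x) * 2 ^+ m)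
    (rho * 2 ^+ m).
  rewrite nE mulnS leq_add2l in mn; move=> /(_ mn).
  rewrite branches_ge0// branches_lt1// => /(_ isT isT).
  rewrite mulr_ge0 ?(ltW p2)// => /(_ isT rg1); apply: le_trans.
  apply: ler_avg => u _; rewrite dbirkhoff_cat pm.
  rewrite -lerBlDl ler_pdivlMr// -[X in _ && X]lerBrDl ler_pdivrMr//.
  rewrite (_ : (t + rho - dbirkhoff slope p x) * 2 ^+ m =
    (t - dbirkhoff slope p x) * 2 ^+ m + rho * 2 ^+ m)//.
  by ring.
suff [p pm Gp] : exists2 p, size p = m & G p <= 0.
  have := avg_drop pm Gle Gp; rewrite subr0 => /le_trans; apply.
  by rewrite exprSr mulrBr mulr1.
have [Z|NZ] := pselect (exists2 u, size u = k &
    (t <= dbirkhoff slope (nseq m false ++ u) x <= t + rho)); last first.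
  exists (nseq m false); first by rewrite size_nseq.
  rewrite -[leRHS](avg_cst k); apply: ler_avg => u uk.
  by case h : (t <= _ <= _) => //; exfalso; apply: NZ; exists u.
have [u uk /andP[u1 u2]] := Z.
exists (true :: nseq m.-1 false); first by rewrite /= size_nseq prednK.
rewrite -[leRHS](avg_cst k); apply: ler_avg => v vk /=.
have := @dbirkhoff_separation m u (nseq m.-1 false ++ v) x sm x0 x1.
rewrite size_cat size_nseq uk vk => /(_ erefl) /= h.
case hv : (t <= _ <= _) => //; have /andP[_ v2] := hv.
have : rho * 2 <= gap.
  apply: le_trans rg; rewrite ler_wpM2l//.
  rewrite -{1}[2]expr1 ler_weXn2l ?ler1n//.
  by rewrite mulnS (leq_trans m0)// leq_addr.
have := gap_gt0; move: h v2 u1 => /=; lra.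
Qed.

End NonConcentration.

(** * Oscillatory sums *)

Section Cis.
Variable R : realType.
Local Notation normc := ComplexField.Normc.normc.
Implicit Types s t d : R.

Definition cis t : R[i] := (cos t +i* sin t)%C.

Lemma cisD s t : cis (s + t) = cis s * cis t.
Proof.
by apply/eqP; rewrite eq_complex /= sinD cosD addrC [sin s * _ + _]addrC !eqxx.
Qed.

Lemma cis0 : cis 0 = 1.
Proof. by rewrite /cis cos0 sin0. Qed.

Lemma cisX d n : cis (d * n%:R) = cis d ^+ n.
Proof.
elim: n => [|n IH]; first by rewrite mulr0 cis0.
by rewrite exprS -IH -cisD -{2}[d]mulr1 -mulrDr -[1 + _]/(1%:R + _) -natrD.
Qed.

Lemma normc_cis t : normc (cis t) = 1.
Proof. by rewrite /= cos2Dsin2 sqrtr1. Qed.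

Lemma normc_opp (z : R[i]) : normc (- z) = normc z.
Proof. by case: z => x y /=; rewrite !sqrrN. Qed.

Lemma normc_ciss1 d : normc (cis d - 1) = 2 * `|sin (d / 2)|.
Proof.
have dE : d = (d / 2) *+ 2 by rewrite -mulr_natr; field.
have -> : 2 * `|sin (d / 2)| = `|2 * sin (d / 2)| by rewrite normrM ger0_norm.
rewrite -sqrtr_sqr /=; congr Num.sqrt.
rewrite {1 2}dE cos_mulr2n sin_mulr2n.
have := cos2Dsin2 (d / 2); move: (cos _) (sin _) => c s cs.
rewrite oppr0 addr0 (_ : (c ^+ 2 *+ 2 - 1 - 1) = - (s ^+ 2) *+ 2); last first.
  by rewrite !mulr2n; lra.
rewrite (_ : _ + _ = 4 * s ^+ 2 * (c ^+ 2 + s ^+ 2)); last first.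
  by rewrite !mulr2n; ring.
by rewrite cs; ring.
Qed.

Lemma normc_cisp1 d : normc (cis d + 1) = 2 * `|cos (d / 2)|.
Proof.
have dE : d = (d / 2) *+ 2 by rewrite -mulr_natr; field.
have -> : 2 * `|cos (d / 2)| = `|2 * cos (d / 2)| by rewrite normrM ger0_norm.
rewrite -sqrtr_sqr /=; congr Num.sqrt.
rewrite {1 2}dE cos_mulr2n sin_mulr2n.
have := cos2Dsin2 (d / 2); move: (cos _) (sin _) => c s cs.
rewrite addr0 (_ : (c ^+ 2 *+ 2 - 1 + 1) = (c ^+ 2) *+ 2); last first.
  by rewrite !mulr2n; lra.
rewrite (_ : _ + _ = 4 * c ^+ 2 * (c ^+ 2 + s ^+ 2)); last first.
  by rewrite !mulr2n; ring.
by rewrite cs; ring.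
Qed.

Lemma sin_pos_mvt t : 0 < t -> exists2 c, 0 < c < t & sin t = cos c * t.
Proof.
move=> t0.
have h1 x : x \in `]0, t[%R -> is_derive x 1 (@sin R) (cos x).
  by move=> _; exact: is_derive_sin.
have h2 : {within `[0, t], continuous (@sin R)}.
  by apply: continuous_subspaceT => x; exact: continuous_sin.
have [c] := MVT t0 h1 h2; rewrite in_itv /= sin0 !subr0 => ct sE.
by exists c.
Qed.

Lemma abs_sin_le t : `|sin t| <= `|t|.
Proof.
wlog t0 : t / 0 <= t => [hw|].
  have [|t0] := leP 0 t; first exact: hw.
  by rewrite -[`|sin t|]normrN -sinN -[`|t|]normrN; apply: hw; rewrite oppr_ge0 ltW.
have [->|tn0] := eqVneq t 0; first by rewrite sin0.
have [|c _ ->] := @sin_pos_mvt t; first by rewrite lt_neqAle eq_sym tn0.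
by rewrite normrM ler_piMl// cos_max.
Qed.

Lemma cos_double t : cos t = 1 - 2 * sin (t / 2) ^+ 2.
Proof.
have tE : t = (t / 2) *+ 2 by rewrite -mulr_natr; field.
rewrite {1}tE cos_mulr2n; have := cos2Dsin2 (t / 2).
by move: (cos _) (sin _) => c s cs; rewrite mulr2n; lra.
Qed.

Lemma sqr_sin_le t : sin t ^+ 2 <= t ^+ 2.
Proof.
rewrite -(real_normK (num_real (sin t))) -(real_normK (num_real t)).
by rewrite ler_pXn2r ?nnegrE// abs_sin_le.
Qed.

Lemma cos_ge t : 1 - t ^+ 2 / 2 <= cos t.
Proof.
rewrite cos_double; have := sqr_sin_le (t / 2); rewrite exprMn; lra.
Qed.

Lemma abs_sin_ge t : `|t| <= 1 -> `|t| / 2 <= `|sin t|.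
Proof.
wlog t0 : t / 0 <= t => [hw|].
  have [|t0] := leP 0 t; first exact: hw.
  by rewrite -[`|sin t|]normrN -sinN -[`|t|]normrN; apply: hw; rewrite oppr_ge0 ltW.
rewrite (ger0_norm t0) => t1.
have [->|tn0] := eqVneq t 0; first by rewrite sin0 normr0 mul0r.
have [|c /andP[c0 ct] ->] := @sin_pos_mvt t; first by rewrite lt_neqAle eq_sym tn0.
have : 1 / 2 <= cos c.
  apply: (le_trans _ (cos_ge c)).
  have : c * c <= 1 * 1 by apply: ler_pM; lra.
  by rewrite expr2; lra.
move=> h; rewrite normrM (ger0_norm t0) mulrC ler_wpM2r//.
by rewrite (le_trans _ (ler_norm _))//; lra.
Qed.

Lemma normc_cisB s t : normc (cis s - cis t) <= `|s - t|.
Proof.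
have -> : cis s - cis t = cis t * (cis (s - t) - 1).
  by rewrite mulrBr -cisD mulr1; congr (cis _ - _); ring.
rewrite ComplexField.Normc.normcM normc_cis mul1r normc_ciss1.
rewrite (le_trans (ler_wpM2l _ (abs_sin_le _)))// normrM normfV.
by rewrite (ger0_norm (ler0n _ 2)); apply: eq_ler; field.
Qed.

Lemma normc_ciss1_ge d : `|d| <= 2 -> `|d| / 2 <= normc (cis d - 1).
Proof.
move=> d2; rewrite normc_ciss1.
have := @abs_sin_ge (d / 2); rewrite normrM normfV (ger0_norm (ler0n _ 2)).
by move=> /(_ ltac:(lra)); lra.
Qed.

Lemma normc_cisp1_le d : `|d| <= 2 -> normc (cis d + 1) <= 2 - d ^+ 2 / 16.
Proof.
move=> d2; rewrite normc_cisp1.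
have h1 : `|d / 2| <= 1 by rewrite normrM normfV (ger0_norm (ler0n _ 2)); lra.
have : (d / 2) ^+ 2 <= 1.
  by rewrite -(real_normK (num_real (d / 2))) -{2}[1](expr1n _ 2) ler_pXn2r ?nnegrE.
have := cos_ge (d / 2) => h2 h3.
rewrite ger0_norm; last by lra.
rewrite cos_double.
have h4 : `|d / 2 / 2| <= 1.
  by rewrite normrM normfV (ger0_norm (ler0n _ 2)); lra.
have := abs_sin_ge h4.
have n4 : 0 <= `|d / 2 / 2| by [].
move=> h5; have : (`|d / 2 / 2| / 2) ^+ 2 <= `|sin (d / 2 / 2)| ^+ 2.
  by rewrite ler_pXn2r ?nnegrE// divr_ge0.
rewrite exprMn !real_normK ?num_real//.
rewrite (_ : (d / 2 / 2) ^+ 2 = d ^+ 2 / 16); last by field.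
rewrite (_ : 2^-1 ^+ 2 = 4^-1); last by field.
lra.
Qed.

Lemma normc_geom d (n : nat) : d != 0 -> `|d| <= 2 ->
  normc (\sum_(0 <= s < n) cis (d * s%:R)) <= 4 / `|d|.
Proof.
move=> d0 d2; have d0' : 0 < `|d| by rewrite normr_gt0.
under eq_bigr do rewrite cisX.
have := subrX1 (cis d) n; rewrite -(big_mkord xpredT (fun i => cis d ^+ i)).
move=> /(congr1 (@ComplexField.Normc.normc R)); rewrite ComplexField.Normc.normcM -cisX => hE.
have h1 : normc (cis (d * n%:R) - 1) <= 2.
  rewrite (le_trans (ler_normcD _ _))// normc_opp normc_cis ComplexField.Normc.normc1.
  by [].
have := normc_ciss1_ge d2; rewrite hE in h1.
have := @normc_ge0 R (\sum_(0 <= i < n) cis d ^+ i).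
move: (normc (cis d - 1)) (normc (\sum_(0 <= _ < n) _)) h1 => u S h1 S0 h2.
rewrite ler_pdivlMr//; apply: (@le_trans _ _ (2 * (u * S))); last lra.
by rewrite mulrA mulrC ler_wpM2r//; lra.
Qed.

End Cis.

(** * The twisted transfer operator *)

Section DyadicPoints.
Variable R : realType.
Implicit Types x : R.

Definition dyadic r x (j : nat) : R := (j%:R + x) / 2 ^+ r.

Lemma big_nat_double (V : nmodType) n (f : nat -> V) :
  \sum_(0 <= i < n.*2) f i = \sum_(0 <= i < n) (f i.*2 + f i.*2.+1).
Proof.
elim: n => [|n IH]; first by rewrite !big_geq.
by rewrite doubleS !big_nat_recr//= IH addrA.
Qed.

Lemma avg_branches (V : numFieldType) r x (F : R -> V) :
  avg r (fun w => F (branches w x)) =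
  (\sum_(0 <= j < 2 ^ r) F (dyadic r x j)) / 2 ^+ r.
Proof.
elim: r x => [|r IH] x /=.
  by rewrite expn0 big_nat1 /dyadic !expr0 !divr1 add0r.
rewrite !IH -mulrDl -big_split exprSr invfM mulrA expnSr muln2.
rewrite big_nat_double; congr (_ / _ / _); apply: eq_bigr => j _ /=.
have d2 : j.*2%:R = 2 * j%:R :> R by rewrite -(natrM _ 2 j) mul2n.
rewrite /dyadic /branch /= !exprS; congr (F _ + F _).
  by rewrite d2; field.
by rewrite -(natr1 j.*2) d2; field.
Qed.

End DyadicPoints.

Section TransferOperator.
Variables (R : realType) (a : R).
Hypotheses (a_gt0 : 0 < a) (a_lt1 : a < 1).
Local Notation normc := (@ComplexField.Normc.normc R).
Local Notation roof := (roof a).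
Implicit Types (x y b kappa M D : R) (v : R -> R[i]).

Definition transfer kappa n v x : R[i] :=
  avg n (fun w => cis (kappa * birkhoff roof w x) * v (branches w x)).

Definition hoelder_class b M D v : Prop :=
  (forall x, 0 <= x <= 1 -> normc (v x) <= M) /\
  (forall x y, 0 <= x <= 1 -> 0 <= y <= 1 ->
     normc (v x - v y) <= D * `|x - y| `^ b).

Definition correlation kappa N r x : R :=
  avg N (fun w => avg N (fun w' =>
    normc (\sum_(0 <= j < 2 ^ r)
      cis (kappa * (birkhoff roof w (dyadic r x j) -
                    birkhoff roof w' (dyadic r x j)))) / 2 ^+ r)).

Lemma transferD kappa m n v x :
  transfer kappa (m + n) v x = transfer kappa m (transfer kappa n v) x.
Proof.
rewrite /transfer avg_cat; apply: eq_avg => p _.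
rewrite -avgMl; apply: eq_avg => w _.
by rewrite birkhoff_cat branches_cat mulrDr cisD mulrA.
Qed.

Lemma branches_itv w x : 0 <= x <= 1 -> 0 <= branches w x <= 1.
Proof. by move=> /andP[x0 x1]; rewrite branches_ge0// branches_le1. Qed.

Lemma transfer_sup kappa n b M D v x : hoelder_class b M D v ->
  0 <= x <= 1 -> normc (transfer kappa n v x) <= M.
Proof.
move=> [vM _] x01; rewrite (le_trans (le_normc_avg _ _))//.
rewrite -[leRHS](avg_cst n); apply: ler_avg => w _.
by rewrite ComplexField.Normc.normcM normc_cis mul1r vM// branches_itv.
Qed.

Lemma exp_half_powR b n (x : R) : 0 <= x -> (x / 2 ^+ n) `^ b = x `^ b / (2 `^ b) ^+ n.
Proof.
move=> x0; elim: n => [|n IH]; first by rewrite !expr0 !divr1.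
rewrite !exprSr !invfM mulrA half_powR ?IH ?divr_ge0 ?exprn_ge0//.
by rewrite mulrA.
Qed.

Lemma transfer_hoelder kappa n b M D v : 0 < b -> b <= a ->
  0 <= M -> 0 <= D -> hoelder_class b M D v ->
  hoelder_class b M (D / (2 `^ b) ^+ n + `|kappa| * hconst b * M)
    (transfer kappa n v).
Proof.
move=> b0 ba M0 D0 vMD; split=> [x x01|x y x01 y01].
  exact: transfer_sup vMD x01.
rewrite -avgB (le_trans (le_normc_avg _ _))// -[leRHS](avg_cst n).
apply: ler_avg => w wn; set c := cis _; set c' := cis _.
rewrite (_ : _ - _ = c * (v (branches w x) - v (branches w y)) +
  (c - c') * v (branches w y)); last by ring.
rewrite (le_trans (ler_normcD _ _))// !ComplexField.Normc.normcM normc_cis mul1r.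
rewrite mulrDl lerD//.
  case: vMD => _ vD; rewrite (le_trans (vD _ _ _ _)) ?branches_itv//.
  rewrite branchesB normrM normfV (ger0_norm (exprn_ge0 _ (ler0n _ 2))).
  by rewrite exp_half_powR// wn; apply: eq_ler; ring.
rewrite (_ : _ * M * _ = `|kappa| * (hconst b * `|x - y| `^ b) * M); last by ring.
apply: ler_pM; rewrite ?normc_ge0//; last first.
  by case: vMD => vM _; rewrite vM// branches_itv.
rewrite (le_trans (normc_cisB _ _))// -mulrBr normrM ler_wpM2l//.
by case/andP: x01 => ? ?; case/andP: y01 => ? ?; exact: birkhoff_holder.
Qed.

Lemma sqr_avg_le n (F : seq bool -> R) : avg n F ^+ 2 <= avg n (fun w => F w ^+ 2).
Proof.
elim: n F => [//|n IH] F /=.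
have h1 := IH (fun w => F (false :: w)); have h2 := IH (fun w => F (true :: w)).
move: (avg n _) (avg n _) (avg n _) (avg n _) h1 h2 => q' p' q p h1 h2.
have := sqr_ge0 (p - p'); move: h1 h2.
by rewrite exprMn !expr2 => h1 h2 h3; lra.
Qed.

Lemma mulC_conj (z : R[i]) : z * z^*%C = (normc z ^+ 2)%:C%C.
Proof.
case: z => p q; apply/eqP; rewrite eq_complex /=.
rewrite sqr_sqrtr ?addr_ge0 ?sqr_ge0//.
by apply/andP; split; apply/eqP; ring.
Qed.

Lemma conjC_avg n (F : seq bool -> R[i]) :
  (avg n F)^*%C = avg n (fun w => (F w)^*%C).
Proof.
elim: n F => [//|n IH] F /=.
rewrite -!IH; move: (avg n _) (avg n _) => p q.
rewrite rmorphM rmorphD fmorphV; congr (_ / _).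
by rewrite rmorph_nat.
Qed.

Lemma conjC_cis t : (cis t : R[i])^*%C = cis (- t).
Proof. by rewrite /cis cosN sinN. Qed.

Lemma conjCM (z z' : R[i]) : ((z * z')^*)%C = (z^*)%C * (z'^*)%C.
Proof. exact: rmorphM. Qed.

Lemma normc_conj (z : R[i]) : normc (z^*%C) = normc z.
Proof. by case: z => p q /=; rewrite sqrrN. Qed.

Lemma trig_sum_sqr N (r : nat) kappa (c : seq bool -> R[i]) (A : seq bool -> nat -> R)
    (M : R) : (forall w, size w = N -> normc (c w) <= M) ->
  \sum_(0 <= j < r) normc (avg N (fun w => cis (kappa * A w j) * c w)) ^+ 2 <=
  M ^+ 2 * avg N (fun w => avg N (fun w' =>
    normc (\sum_(0 <= j < r) cis (kappa * (A w j - A w' j))))).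
Proof.
move=> cM.
have -> : \sum_(0 <= j < r) normc (avg N (fun w => cis (kappa * A w j) * c w)) ^+ 2
  = normc (avg N (fun w => avg N (fun w' => c w * (c w')^*%C *
      \sum_(0 <= j < r) cis (kappa * (A w j - A w' j))))).
  transitivity (normc (\sum_(0 <= j < r)
      (normc (avg N (fun w => cis (kappa * A w j) * c w)) ^+ 2)%:C%C)).
    rewrite -rmorph_sum normcR ger0_norm// sumr_ge0// => j _; exact: sqr_ge0.
  congr (normc _); under eq_bigr do rewrite -mulC_conj conjC_avg -avgMr.
  rewrite -avg_sum; apply: eq_avg => w _.
  under eq_bigr do rewrite -avgMl.
  rewrite -avg_sum; apply: eq_avg => w' _.
  rewrite big_distrr /=; apply: eq_bigr => j _.
  rewrite conjCM conjC_cis mulrBr cisD.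
  by ring.
rewrite (le_trans (le_normc_avg _ _))// -avgMl; apply: ler_avg => w wN.
rewrite (le_trans (le_normc_avg _ _))// -avgMl; apply: ler_avg => w' wN'.
rewrite !ComplexField.Normc.normcM normc_conj ler_wpM2r ?normc_ge0// expr2.
by apply: ler_pM; rewrite ?normc_ge0 ?cM.
Qed.

Lemma dyadic_in01 r x j : (j < 2 ^ r)%N -> 0 <= x <= 1 -> 0 <= dyadic r x j <= 1.
Proof.
move=> jr /andP[x0 x1]; rewrite /dyadic divr_ge0 ?addr_ge0 ?exprn_ge0//=.
rewrite ler_pdivrMr ?exprn_gt0// mul1r -natrX.
have : j.+1%:R <= (2 ^ r)%:R :> R by rewrite ler_nat.
by rewrite -natr1; lra.
Qed.

Lemma normcB_le (z z' : R[i]) : normc z - normc z' <= normc (z - z').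
Proof.
have := ler_normcD (z - z') z'; rewrite subrK; lra.
Qed.

(* The [r] outer letters run over the points [dyadic r x j]; Cauchy-Schwarz over
   them and expanding the square produces [correlation], once [v] has been
   frozen along each of the [N] inner letters. *)
Lemma transfer_contraction kappa N r b M D v x : 0 < b ->
  0 <= M -> 0 <= D -> hoelder_class b M D v -> 0 <= x <= 1 ->
  normc (transfer kappa (r + N) v x) ^+ 2 <=
  correlation kappa N r x * M ^+ 2 + 2 * M * D / (2 `^ b) ^+ N.
Proof.
move=> b0 M0 D0 vMD x01; rewrite transferD.
set u := transfer kappa N v.
have h1 : normc (transfer kappa r u x) <= avg r (fun w => normc (u (branches w x))).
  rewrite (le_trans (le_normc_avg _ _))//; apply: ler_avg => w _.
  by rewrite ComplexField.Normc.normcM normc_cis mul1r.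
have h2 : normc (transfer kappa r u x) ^+ 2 <=
    avg r (fun w => normc (u (branches w x)) ^+ 2).
  by apply: le_trans (sqr_avg_le _ _); rewrite ler_pXn2r ?nnegrE ?(le_trans _ h1) ?normc_ge0.
apply: (le_trans h2); rewrite (avg_branches r x (fun y => normc (u y) ^+ 2)).
pose c w := v (branches w 0).
pose A w j := birkhoff roof w (dyadic r x j).
have zero01 : is_true ((0 : R) <= (0 : R) <= (1 : R)) by lra.
have cM w : size w = N -> normc (c w) <= M.
  by move=> _; case: vMD => vM _; apply: vM; exact: branches_itv.
have tsq := trig_sum_sqr (2 ^ r) kappa A cM.
have approx j : (j < 2 ^ r)%N -> normc (u (dyadic r x j)) ^+ 2 <=
   normc (avg N (fun w => cis (kappa * A w j) * c w)) ^+ 2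
   + 2 * M * D / (2 `^ b) ^+ N.
  move=> jr; have d01 := dyadic_in01 jr x01.
  have u1 : normc (u (dyadic r x j)) <= M by exact: transfer_sup vMD d01.
  have u2 : normc (avg N (fun w => cis (kappa * A w j) * c w)) <= M.
    rewrite (le_trans (le_normc_avg _ _))// -[leRHS](avg_cst N).
    apply: ler_avg => w wN.
    by rewrite ComplexField.Normc.normcM normc_cis mul1r cM.
  have u3 : normc (u (dyadic r x j)) - normc (avg N (fun w => cis (kappa * A w j) * c w))
      <= D / (2 `^ b) ^+ N.
    rewrite (le_trans (normcB_le _ _))// /u /transfer -avgB.
    rewrite (le_trans (le_normc_avg _ _))// -[leRHS](avg_cst N).
    apply: ler_avg => w wN; rewrite -mulrBr ComplexField.Normc.normcM normc_cis mul1r.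
    case: vMD => _ vD; rewrite (le_trans (vD _ _ _ _)) ?branches_itv//.
    rewrite branchesB normrM normfV (ger0_norm (exprn_ge0 _ (ler0n _ 2))).
    rewrite exp_half_powR// wN ler_wpM2l// ler_piMl ?invr_ge0 ?exprn_ge0 ?powR_ge0//.
    rewrite subr0; case/andP: d01 => d0 d1; rewrite ger0_norm//.
    rewrite -[leRHS](_ : 1 `^ b = 1); last by rewrite powR1.
    by apply: ge0_ler_powR; rewrite ?nnegrE// ltW.
  have E0 : 0 <= D / (2 `^ b) ^+ N by rewrite divr_ge0// exprn_ge0// powR_ge0.
  rewrite -!mulrA; move: (D / _) E0 u3 => e e0.
  have := @normc_ge0 R (avg N (fun w => cis (kappa * A w j) * c w)).
  have := @normc_ge0 R (u (dyadic r x j)).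
  move: (normc (u _)) (normc (avg _ _)) u1 u2 => p q p1 q1 p0 q0 pq.
  have : (p - q) * (p + q) <= e * (p + q) by rewrite ler_wpM2r ?addr_ge0.
  have : e * (p + q) <= e * (M + M) by rewrite ler_wpM2l ?lerD.
  by rewrite !expr2; lra.
have P0 : 0 < 2 ^+ r :> R by rewrite exprn_gt0.
rewrite ler_pdivrMr// mulrDl.
have -> : correlation kappa N r x * M ^+ 2 * 2 ^+ r =
  M ^+ 2 * avg N (fun w => avg N (fun w' =>
    normc (\sum_(0 <= j < 2 ^ r) cis (kappa * (A w j - A w' j))))).
  rewrite /correlation; under eq_avg do rewrite avgMr.
  by rewrite avgMr; field; rewrite gt_eqF.
apply: le_trans (lerD tsq (lexx _)).
rewrite -natrX mulr_natr -[X in _ *+ X]subn0 -sumr_const_nat -big_split /=.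
rewrite !big_seq; apply: ler_sum => j; rewrite mem_index_iota => /andP[_ jr].
exact: approx.
Qed.

End TransferOperator.

Section Correlation.
Variables (R : realType) (a : R).
Hypotheses (a_gt0 : 0 < a) (a_lt1 : a < 1).
Local Notation normc := (@ComplexField.Normc.normc R).
Local Notation roof := (roof a).
Local Notation slope := (slope a).
Local Notation dconst := (dconst a).
Local Notation gap := (gap a).
Local Notation correlation := (correlation a).
Implicit Types (x y kappa tau rho : R) (m n q r N : nat).

Lemma one_sub_npowR tau y (k : nat) (e : R) : 0 < tau -> tau <= 1 -> y <= 1 - tau ->
  - k%:R <= e -> e <= 0 -> (1 - y) `^ e <= (tau ^+ k)^-1.
Proof.
move=> t0 t1 yt ke e0.
have h : (1 - y) `^ e <= tau `^ e by apply: powR_npow_le => //; lra.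
apply: (le_trans h); rewrite -(powR_invn _ (ltW t0)).
by apply: ger_powR => //; rewrite t0.
Qed.

Lemma dbirkhoff_bound w x tau : 0 < tau -> tau <= 1 -> x <= 1 - tau ->
  dbirkhoff slope w x <= dconst / tau.
Proof.
move=> t0 t1 xt; have A0 := a_gt0; have A1 := a_lt1.
rewrite (le_trans (dbirkhoff_le a_gt0 a_lt1 _ _))//; first lra.
rewrite ler_pM2l ?dconst_gt0// -[tau]expr1.
by apply: one_sub_npowR => //; lra.
Qed.

Lemma birkhoff_taylor_bound w x y tau : 0 < tau -> tau <= 1 ->
  0 <= x -> x <= y -> y <= 1 - tau ->
  `|birkhoff roof w y - birkhoff roof w x + dbirkhoff slope w x * (y - x)|
  <= dconst / tau ^+ 2 * (y - x) ^+ 2.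
Proof.
move=> t0 t1 x0 xy yt; have A0 := a_gt0; have A1 := a_lt1.
rewrite (le_trans (birkhoff_taylor a_gt0 a_lt1 _ x0 xy _))//; first lra.
rewrite ler_wpM2r ?sqr_ge0// ler_pM2l ?dconst_gt0//.
by apply: one_sub_npowR => //; lra.
Qed.

Lemma normc_cis_sum_le n (f : nat -> R) :
  normc (\sum_(0 <= j < n) cis (f j)) <= n%:R.
Proof.
rewrite (le_trans (le_normc_sum _ _ _))//.
under eq_bigr do rewrite normc_cis.
by rewrite sumr_const_nat subn0.
Qed.

Lemma normc_cis_pair (s t d : R) : s - t = d -> `|d| <= 2 ->
  normc (cis s + cis t) <= 2 - d ^+ 2 / 16.
Proof.
move=> sd d2; rewrite -(subrK t s) sd cisD -{2}[cis t]mul1r -mulrDl.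
by rewrite ComplexField.Normc.normcM normc_cis mulr1 normc_cisp1_le.
Qed.

Lemma correlation_small_pair r kappa kappa0 x w w' h :
  h = 2^-1 ^+ r -> (1 < r)%N ->
  2 * (4 * dconst) * h <= gap / 2 -> 3 * (4 * dconst) * kappa0 * h <= 1 ->
  1 <= `|kappa| -> `|kappa| <= kappa0 -> 0 <= x <= 1 ->
  gap <= dbirkhoff slope w' (dyadic r x 0) - dbirkhoff slope w (dyadic r x 0) ->
  normc (\sum_(0 <= j < 2 ^ r)
      cis (kappa * (birkhoff roof w (dyadic r x j) -
                    birkhoff roof w' (dyadic r x j)))) / 2 ^+ r
  <= 1 - gap ^+ 2 * h ^+ 3 / 64.
Proof.
move=> hE r1 hgap hk k1 k0 /andP[x0 x1].
set X := dyadic r x 0; set Y := dyadic r x 1.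
have h0 : 0 < h by rewrite hE exprn_gt0.
have PE : 2 ^+ r = h^-1 by rewrite hE exprVn invrK.
have h4 : h <= 4^-1.
  rewrite hE; case: r r1 {hE PE X Y} => [//|[//|r]] _.
  rewrite !exprS mulrA (_ : 2^-1 / 2 = 4^-1); last by field.
  by rewrite ler_piMr// exprn_ile1//; lra.
have XE : X = x * h by rewrite /X /dyadic PE invrK add0r.
have YE : Y = (1 + x) * h by rewrite /Y /dyadic PE invrK.
have YX : Y - X = h by rewrite XE YE; ring.
have X0 : 0 <= X by rewrite XE mulr_ge0// ltW.
have Y2 : Y <= 1 - 1 / 2.
  rewrite YE; apply: (@le_trans _ _ (2 * 4^-1)); last by lra.
  by apply: ler_pM; lra.
have XY : X <= Y by lra.
have half1 : (1 : R) / 2 <= 1 by lra.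
have half0 : (0 : R) < 1 / 2 by lra.
have h2 v := birkhoff_taylor_bound v half0 half1 X0 XY Y2.
have Xh : X <= 1 - 1 / 2 by lra.
have h3 v := dbirkhoff_bound v half0 half1 Xh.
have := h3 w'; have := h2 w; have := h2 w'.
have := dbirkhoff_ge0 a_gt0 w X.
rewrite YX (_ : dconst / (1 / 2) ^+ 2 = 4 * dconst); last by field.
rewrite (_ : dconst / (1 / 2) = 2 * dconst); last by field.
have dc0 := dconst_gt0 a_gt0.
move: (dbirkhoff _ w X) (dbirkhoff _ w' X) => p p'.
move=> p0 /ler_normlP[e1 e2] /ler_normlP[e3 e4] p'K gpp.
pose D := (birkhoff roof w X - birkhoff roof w' X) -
          (birkhoff roof w Y - birkhoff roof w' Y).
have gap0 := gap_gt0 a_gt0 a_lt1.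
have hh : 2 * (4 * dconst) * h ^+ 2 <= gap / 2 * h.
  by rewrite expr2 [leLHS]mulrA ler_pM2r.
have ph : gap * h <= (p' - p) * h by rewrite ler_pM2r.
have ph' : (p' - p) * h <= 2 * dconst * h by rewrite ler_pM2r//; lra.
have D1 : D <= - (gap / 2 * h).
  rewrite /D; lra.
have D2 : - (3 * (4 * dconst) * h) <= D.
  have : h ^+ 2 <= h by rewrite expr2 ler_piMl//; lra.
  move=> /(ler_wpM2l (ltW dc0)); rewrite /D; lra.
have gh0 : 0 <= gap / 2 * h by apply: mulr_ge0; [lra|exact: ltW].
have D0 : D <= 0 by apply: (le_trans D1); rewrite oppr_le0.
have kD : `|kappa * D| <= 1.
  rewrite normrM (ler0_norm D0) (le_trans _ hk)//.
  rewrite [_ * kappa0]mulrC -mulrA; apply: ler_pM => //; lra.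
have kD2 : (gap / 2 * h) ^+ 2 <= (kappa * D) ^+ 2.
  rewrite -(real_normK (num_real (kappa * D))) ler_pXn2r ?nnegrE//.
  by rewrite normrM (ler0_norm D0) -[leLHS]mul1r; apply: ler_pM => //; lra.
have [n nE] : exists n, (2 ^ r = n.+2)%N.
  exists (2 ^ r - 2)%N; rewrite -[RHS](addn2 (2 ^ r - 2)) subnK//.
  by rewrite -{1}(expn1 2) leq_exp2l// ltnW.
have nR : 2 ^+ r = n%:R + 2 :> R by rewrite -natrX nE -addn2 natrD.
rewrite nE big_nat_recl// big_nat_recl// addrA -/X -/Y.
rewrite ler_pdivrMr ?exprn_gt0// (le_trans (ler_normcD _ _))//.
have q1 : normc (cis (kappa * (birkhoff roof w X - birkhoff roof w' X)) +
    cis (kappa * (birkhoff roof w Y - birkhoff roof w' Y))) <= 2 - (kappa * D) ^+ 2 / 16.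
  by apply: normc_cis_pair; [rewrite -mulrBr|lra].
rewrite (le_trans (lerD q1 (normc_cis_sum_le _ _)))//.
rewrite mulrBl mul1r {1}nR PE.
rewrite (_ : gap ^+ 2 * h ^+ 3 / 64 / h = (gap / 2 * h) ^+ 2 / 16); last first.
  by field; rewrite gt_eqF.
lra.
Qed.

(* Words starting with [m] zeros and words starting with [1] have slopes at
   least [gap] apart, so their phases at the first two dyadic points disagree. *)
Lemma correlation_small kappa0 : 1 <= kappa0 -> exists r N1 (A : R), A < 1 /\
  forall kappa N x, 1 <= `|kappa| -> `|kappa| <= kappa0 -> (N1 <= N)%N ->
  0 <= x <= 1 -> correlation kappa N r x <= A.
Proof.
move=> k1.
have gap0 := gap_gt0 a_gt0 a_lt1; have dc0 := dconst_gt0 a_gt0.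
have [m sm] := separating_ex a_gt0 a_lt1.
have [r1 hr1] := exp2_unbounded (2 * (4 * dconst) / (gap / 2)).
have [r2 hr2] := exp2_unbounded (3 * (4 * dconst) * kappa0).
pose r := (r1 + r2 + 2)%N; pose h : R := 2^-1 ^+ r.
have P0 : 0 < 2 ^+ r :> R by rewrite exprn_gt0.
have h0 : 0 < h by rewrite exprn_gt0.
have hE : h = (2 ^+ r)^-1 by rewrite /h exprVn.
have gap20 : 0 < gap / 2 by lra.
have g1 : 2 * (4 * dconst) * h <= gap / 2.
  have := hr1 r (leq_trans (leq_addr _ _) (leq_addr _ _)).
  rewrite (ler_pdivrMr _ _ gap20) hE => h1.
  by rewrite ler_pdivrMr// [leRHS]mulrC.
have g2 : 3 * (4 * dconst) * kappa0 * h <= 1.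
  have := hr2 r (leq_trans (leq_addl _ _) (leq_addr _ _)).
  by rewrite hE ler_pdivrMr// mul1r.
pose c := gap ^+ 2 * h ^+ 3 / 64.
have c0 : 0 < c by rewrite divr_gt0// mulr_gt0// exprn_gt0.
exists r, m, (1 - c / 2 / 2 ^+ m); split.
  by rewrite gtrBl divr_gt0 ?exprn_gt0// divr_gt0.
move=> kappa N x ka ka0 mN x01.
have [n nE] : exists n, N = (m + n)%N by exists (N - m)%N; rewrite subnKC.
have [m0 _] := sm.
have F1 w w' : normc (\sum_(0 <= j < 2 ^ r)
      cis (kappa * (birkhoff roof w (dyadic r x j) -
                    birkhoff roof w' (dyadic r x j)))) / 2 ^+ r <= 1.
  by rewrite ler_pdivrMr// mul1r -natrX normc_cis_sum_le.
have X01 : 0 <= dyadic r x 0 < 1.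
  case/andP: x01 => x0 x1; rewrite /dyadic add0r divr_ge0 ?(ltW P0)//=.
  rewrite ltr_pdivrMr// mul1r (le_lt_trans x1)//.
  by rewrite exprn_egt1// ?ltr1n// /r addn2.
rewrite /correlation {1}nE avg_cat.
have nm : size (nseq m false) = m by rewrite size_nseq.
pose F p := avg n (fun u => avg N (fun w' =>
    normc (\sum_(0 <= j < 2 ^ r)
      cis (kappa * (birkhoff roof (p ++ u) (dyadic r x j) -
                    birkhoff roof w' (dyadic r x j)))) / 2 ^+ r)) : R.
have := @avg_drop _ m F (nseq m false) 1 (1 - c / 2) nm.
rewrite (_ : 1 - (1 - c / 2) = c / 2); last by ring.
apply.
  move=> p _; rewrite /F -[leRHS](avg_cst n); apply: ler_avg => u _.
  by rewrite -[leRHS](avg_cst N); apply: ler_avg => w' _.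
rewrite /F -[leRHS](avg_cst n); apply: ler_avg => u un.
have N1 : N = N.-1.+1 by rewrite prednK// (leq_trans m0).
rewrite N1 /=.
have q1 : avg N.-1 (fun w' : seq bool => normc (\sum_(0 <= j < 2 ^ r)
      cis (kappa * (birkhoff roof (nseq m false ++ u) (dyadic r x j) -
                    birkhoff roof (false :: w') (dyadic r x j)))) / 2 ^+ r) <= 1.
  by rewrite -[leRHS](avg_cst N.-1); apply: ler_avg.
have q2 : avg N.-1 (fun w' : seq bool => normc (\sum_(0 <= j < 2 ^ r)
      cis (kappa * (birkhoff roof (nseq m false ++ u) (dyadic r x j) -
                    birkhoff roof (true :: w') (dyadic r x j)))) / 2 ^+ r) <= 1 - c.
  rewrite -[leRHS](avg_cst N.-1); apply: ler_avg => w' w'N.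
  apply: (@correlation_small_pair r kappa kappa0) => //.
    by rewrite /r addn2.
  rewrite lerBrDl addrC; case/andP: X01 => X0 X1.
  have := @dbirkhoff_separation _ _ a_gt0 a_lt1 m u w' _ sm X0 X1.
  rewrite addrC; apply.
  by rewrite w'N un nE; case: (m) m0.
lra.
Qed.

End Correlation.

Section LargeFrequencies.
Variables (R : realType) (a : R).
Hypotheses (a_gt0 : 0 < a) (a_lt1 : a < 1).
Local Notation normc := (@ComplexField.Normc.normc R).
Local Notation roof := (roof a).
Local Notation slope := (slope a).
Local Notation dconst := (dconst a).
Local Notation gap := (gap a).
Local Notation correlation := (correlation a).
Implicit Types (x y X kappa tau rho P : R) (m n q r N B : nat).

Lemma big_nat_blocks (V : nmodType) n B (f : nat -> V) :
  \sum_(0 <= j < n * B) f j =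
  \sum_(0 <= J < n) \sum_(0 <= s < B) f (J * B + s)%N.
Proof.
elim: n => [|n IH]; first by rewrite !big_geq.
rewrite mulSn addnC (big_cat_nat (leq0n _) (leq_addr B (n * B)))/=.
rewrite big_nat_recr//= -IH; congr (_ + _).
rewrite -{1}[(n * B)%N]add0n big_addn addKn.
by apply: eq_bigr => s _; rewrite addnC.
Qed.

Lemma block_bound X tau rho kappa P B w w' : 0 <= X -> 0 < tau -> tau <= 1 ->
  0 < P -> 0 < rho -> kappa != 0 ->
  (forall s, (s < B)%N -> X + s%:R / P <= 1 - tau) ->
  X <= 1 - tau -> `|kappa| * (dconst / tau) / P <= 2 ->
  normc (\sum_(0 <= s < B) cis (kappa *
    (birkhoff roof w (X + s%:R / P) - birkhoff roof w' (X + s%:R / P)))) <=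
  B%:R * (dbirkhoff slope w X - rho <= dbirkhoff slope w' X
          <= dbirkhoff slope w X - rho + 2 * rho)%R%:R
  + 4 * P / (`|kappa| * rho)
  + B%:R * (2 * `|kappa| * (dconst / tau ^+ 2) * (B%:R / P) ^+ 2).
Proof.
move=> X0 t0 t1 P0 r0 k0 XB Xt kP.
have dc0 := dconst_gt0 a_gt0.
have k0' : 0 < `|kappa| by rewrite normr_gt0.
set p := dbirkhoff slope w X; set p' := dbirkhoff slope w' X.
set E := B%:R * (2 * _ * _ * _).
pose base := kappa * (birkhoff roof w X - birkhoff roof w' X).
pose d := kappa * (p' - p) / P.
pose lin (s : nat) : R := base + d * s%:R.
have E0 : 0 <= E.
  rewrite mulr_ge0// mulr_ge0 ?sqr_ge0//.
  apply: mulr_ge0; first by rewrite mulr_ge0.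
  by rewrite divr_ge0 ?exprn_ge0// ltW.
have approx : normc (\sum_(0 <= s < B) cis (kappa *
    (birkhoff roof w (X + s%:R / P) - birkhoff roof w' (X + s%:R / P)))) <=
    normc (\sum_(0 <= s < B) cis (lin s)) + E.
  rewrite -lerBlDl (le_trans (normcB_le _ _))// -sumrB.
  rewrite (le_trans (le_normc_sum _ _ _))//.
  rewrite /E mulr_natl -[X in _ *+ X]subn0 -sumr_const_nat.
  rewrite !big_seq; apply: ler_sum => s; rewrite mem_index_iota => /andP[_ sB].
  rewrite (le_trans (normc_cisB _ _))//.
  have sP0 : 0 <= s%:R / P by rewrite divr_ge0// ltW.
  have XY : X <= X + s%:R / P by rewrite lerDl.
  have h u := birkhoff_taylor_bound a_gt0 a_lt1 u t0 t1 X0 XY (XB _ sB).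
  have h1 := h w; have h2 := h w'.
  rewrite -/p -/p' (addrC X) addrK in h1 h2.
  rewrite [s%:R / P + X]addrC in h1 h2.
  set b1 := birkhoff _ w (X + _) in h1 *; set b2 := birkhoff _ w' (X + _) in h2 *.
  rewrite (_ : _ - lin s = kappa *
     ((b1 - birkhoff roof w X + p * (s%:R / P)) -
      (b2 - birkhoff roof w' X + p' * (s%:R / P)))); last first.
    by rewrite /lin /base /d; ring.
  rewrite normrM.
  have h3 : (s%:R / P) ^+ 2 <= (B%:R / P) ^+ 2.
    rewrite ler_pXn2r ?nnegrE ?divr_ge0 ?ler0n ?(ltW P0)//.
    by rewrite ler_pM2r ?invr_gt0// ler_nat ltnW.
  have h4 : dconst / tau ^+ 2 * (s%:R / P) ^+ 2 <= dconst / tau ^+ 2 * (B%:R / P) ^+ 2.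
    by rewrite ler_wpM2l// divr_ge0 ?exprn_ge0// ltW.
  rewrite (_ : 2 * _ * _ * _ = `|kappa| *
     (dconst / tau ^+ 2 * (B%:R / P) ^+ 2 + dconst / tau ^+ 2 * (B%:R / P) ^+ 2));
    last by ring.
  rewrite ler_pM2l// (le_trans (ler_normB _ _))//.
  by apply: lerD; [exact: (le_trans h1)|exact: (le_trans h2)].
apply: (le_trans approx); rewrite lerD2r.
have G0 : 0 <= 4 * P / (`|kappa| * rho) by rewrite divr_ge0 ?mulr_ge0 ?ltW.
have [near|far] := boolP (p - rho <= p' <= p - rho + 2 * rho).
  rewrite mulr1 (le_trans (normc_cis_sum_le _ _))//; lra.
rewrite mulr0 add0r.
have pfar : rho <= `|p' - p|.
  rewrite leNgt; apply: contra far => /ltr_normlP[]; move=> h1 h2.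
  by apply/andP; split; lra.
have p0 := dbirkhoff_ge0 a_gt0 w X; have p0' := dbirkhoff_ge0 a_gt0 w' X.
have pK := dbirkhoff_bound a_gt0 a_lt1 w t0 t1 Xt.
have pK' := dbirkhoff_bound a_gt0 a_lt1 w' t0 t1 Xt.
rewrite -/p -/p' in p0 p0' pK pK'.
have ppK : `|p' - p| <= dconst / tau by rewrite ler_norml; apply/andP; split; lra.
have nd : `|d| = `|kappa| * `|p' - p| / P.
  by rewrite /d !normrM normfV (gtr0_norm P0).
have d2 : `|d| <= 2.
  rewrite nd (le_trans _ kP)// ler_pM2r ?invr_gt0// ler_pM2l//.
have dlow : `|kappa| * rho / P <= `|d|.
  by rewrite nd ler_pM2r ?invr_gt0// ler_pM2l.
have low0 : 0 < `|kappa| * rho / P by rewrite divr_gt0// mulr_gt0.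
have d0 : d != 0 by rewrite -normr_gt0 (lt_le_trans low0).
have -> : \sum_(0 <= s < B) cis (lin s) =
    cis base * \sum_(0 <= s < B) cis (d * s%:R).
  by rewrite big_distrr /=; apply: eq_bigr => s _; rewrite cisD.
rewrite ComplexField.Normc.normcM normc_cis mul1r (le_trans (normc_geom _ d0 d2))//.
rewrite (_ : 4 * P / (`|kappa| * rho) = 4 / (`|kappa| * rho / P)); last first.
  by field; rewrite !gt_eqF//= mulr_gt0.
by rewrite ler_pM2l// lef_pV2 ?posrE// (lt_le_trans low0).
Qed.

Lemma block_avg_bound m j N X tau rho kappa P B : separating a m ->
  (m * j <= N)%N -> 2 * rho * 2 ^+ (m * j) <= gap ->
  0 <= X -> 0 < tau -> tau <= 1 ->
  0 < P -> 0 < rho -> kappa != 0 ->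
  (forall s, (s < B)%N -> X + s%:R / P <= 1 - tau) ->
  X <= 1 - tau -> `|kappa| * (dconst / tau) / P <= 2 ->
  avg N (fun w => avg N (fun w' =>
    normc (\sum_(0 <= s < B) cis (kappa *
    (birkhoff roof w (X + s%:R / P) - birkhoff roof w' (X + s%:R / P)))))) <=
  B%:R * (1 - (2 ^+ m)^-1) ^+ j
  + 4 * P / (`|kappa| * rho)
  + B%:R * (2 * `|kappa| * (dconst / tau ^+ 2) * (B%:R / P) ^+ 2).
Proof.
move=> sm mN rg X0 t0 t1 P0 r0 k0 XB Xt kP.
rewrite -[leRHS](avg_cst N); apply: ler_avg => w _.
apply: (le_trans (ler_avg (fun w' _ =>
  block_bound w w' X0 t0 t1 P0 r0 k0 XB Xt kP))).
rewrite avgD avg_cst lerD2r avgD avg_cst lerD2r avgMl ler_wpM2l//.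
apply: concentration => //; last by rewrite mulr_ge0// ltW.
by move: t0 Xt; lra.
Qed.

Lemma bernoulli_ineq (y : R) n : 0 <= y -> y <= 1 -> 1 - n%:R * y <= (1 - y) ^+ n.
Proof.
move=> y0 y1; elim: n => [|n IH]; first by rewrite expr0; lra.
rewrite exprS -natr1.
have : (1 - y) * (1 - n%:R * y) <= (1 - y) * (1 - y) ^+ n by apply: ler_wpM2l; lra.
have : 0 <= n%:R * y * y by rewrite !mulr_ge0.
lra.
Qed.

Lemma root_below_one (n : nat) (A : R) : (0 < n)%N -> 0 <= A -> A < 1 ->
  exists2 t : R, 0 < t < 1 & A <= t ^+ n.
Proof.
move=> n0 A0 A1; have n0' : 0 < n%:R :> R by rewrite ltr0n.
have n1 : 1 <= n%:R :> R by rewrite ler1n.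
pose A' := (1 + A) / 2.
have h0 : 0 < (1 - A') / n%:R by rewrite divr_gt0// /A'; lra.
have h1 : (1 - A') / n%:R < 1.
  by rewrite ltr_pdivrMr// mul1r /A'; lra.
exists (1 - (1 - A') / n%:R); first by apply/andP; split; lra.
have := @bernoulli_ineq ((1 - A') / n%:R) n (ltW h0) (ltW h1).
rewrite mulrCA divff ?gt_eqF// mulr1; apply: le_trans.
by rewrite /A'; lra.
Qed.

Lemma correlation_blocks N e r n kappa x (G : R) : (e <= r)%N -> (n <= 2 ^ e)%N ->
  (forall J, (J < n)%N -> avg N (fun w => avg N (fun w' =>
    normc (\sum_(0 <= s < 2 ^ (r - e)) cis (kappa *
    (birkhoff roof w (dyadic r x (J * 2 ^ (r - e)) + s%:R / 2 ^+ r) -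
     birkhoff roof w' (dyadic r x (J * 2 ^ (r - e)) + s%:R / 2 ^+ r)))))) <=
    (2 ^ (r - e))%:R * G) -> 0 <= G ->
  correlation kappa N r x <= G + (2 ^ e - n)%:R / 2 ^+ e.
Proof.
move=> er ne nG G0.
have Pe : (2 ^ r = 2 ^ e * 2 ^ (r - e))%N by rewrite -expnD subnKC.
set B := (2 ^ (r - e))%N.
have P0 : 0 < 2 ^+ r :> R by rewrite exprn_gt0.
have PR : 2 ^+ r = 2 ^+ e * B%:R :> R by rewrite -natrX Pe natrM natrX.
pose S (J : nat) w w' := normc (\sum_(0 <= s < B) cis (kappa *
    (birkhoff roof w (dyadic r x (J * B) + s%:R / 2 ^+ r) -
     birkhoff roof w' (dyadic r x (J * B) + s%:R / 2 ^+ r)))).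
have h1 : correlation kappa N r x <=
    (\sum_(0 <= J < 2 ^ e) avg N (fun w => avg N (S J w))) / 2 ^+ r.
  rewrite -avg_sum -avgMr; apply: ler_avg => w _.
  rewrite -avg_sum -avgMr; apply: ler_avg => w' _.
  rewrite ler_pM2r ?invr_gt0// Pe big_nat_blocks (le_trans (le_normc_sum _ _ _))//.
  apply: ler_sum => J _; apply: eq_ler; congr (normc _).
  apply: eq_bigr => s _; congr (cis (_ * (birkhoff _ _ _ - birkhoff _ _ _)));
  by rewrite /dyadic natrD; ring.
apply: (le_trans h1); rewrite ler_pdivrMr//.
rewrite (big_cat_nat (leq0n n) ne)/=.
have h2 : \sum_(0 <= J < n) avg N (fun w => avg N (S J w)) <= 2 ^+ e * (B%:R * G).
  apply: (@le_trans _ _ (\sum_(0 <= J < n) B%:R * G)).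
    rewrite !big_seq; apply: ler_sum => J; rewrite mem_index_iota => /andP[_ Jn].
    exact: nG.
  rewrite sumr_const_nat subn0 -[leLHS]mulr_natl ler_wpM2r//.
    by rewrite mulr_ge0.
  by rewrite -natrX ler_nat.
have h3 : \sum_(n <= J < 2 ^ e) avg N (fun w => avg N (S J w)) <=
    (2 ^ e - n)%:R * B%:R.
  apply: (@le_trans _ _ (\sum_(n <= J < 2 ^ e) B%:R)).
    apply: ler_sum => J _; rewrite -[leRHS](avg_cst N); apply: ler_avg => w _.
    rewrite -[leRHS](avg_cst N); apply: ler_avg => w' _.
    exact: normc_cis_sum_le.
  by rewrite sumr_const_nat mulr_natl.
apply: (le_trans (lerD h2 h3)); rewrite PR; apply: eq_ler; field.
by rewrite gt_eqF// exprn_gt0.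
Qed.

Fact times6 (q : nat) : (6 * q = q + q + q + q + q + q)%N.
Proof. lia. Qed.

Fact times8 (q : nat) : (8 * q = q + q + q + q + q + q + q + q)%N.
Proof. lia. Qed.

Fact exponent_budget (c q r : nat) :
  ((9 + c) * q.+1 <= r)%N -> (8 * q.+1 + (c + q) <= r)%N.
Proof. by apply: leq_trans; rewrite mulnDl [(c * _)%N]mulnS; lia. Qed.

(* The dyadic points are cut into blocks of length [2 ^- (6 q)], discarding the
   proportion [2 ^- q] nearest to the singularity [1].  On a block the phase is
   linear up to a negligible error: either the two slopes are within [2 ^- q],
   which [concentration] makes rare, or the geometric sum is small. *)
Lemma correlation_large : exists (C eta : R) (c0 : nat), [/\ 0 < C, 0 < eta, eta < 1 &
  forall q r N kappa x, (c0 * q.+1 <= r)%N -> (q <= N)%N ->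
  2 ^+ (8 * q) <= `|kappa| -> `|kappa| <= 2 ^+ (8 * q.+1) -> 0 <= x <= 1 ->
  correlation kappa N r x <= C * eta ^+ q].
Proof.
have gap0 := gap_gt0 a_gt0 a_lt1; have dc0 := dconst_gt0 a_gt0.
have [m sm] := separating_ex a_gt0 a_lt1; have [m0 _] := sm.
have [c1 hc1] := exp2_unbounded dconst.
have m0' : 0 < m%:R :> R by rewrite ltr0n.
have m1 : 1 <= m%:R :> R by rewrite ler1n.
pose y : R := (2 ^+ m)^-1 / m%:R.
have y0 : 0 < y by rewrite divr_gt0// invr_gt0 exprn_gt0.
have y2 : y <= 1 / 2.
  rewrite /y ler_pdivrMr//; apply: (@le_trans _ _ (2 ^+ 1)^-1).
    by rewrite lef_pV2 ?posrE ?exprn_gt0// ler_weXn2l ?ler1n.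
  by rewrite expr1 mul1r -{1}[2^-1]mulr1 ler_pM2l// invr_gt0.
pose eta := 1 - y.
have eta0 : 0 < eta by rewrite /eta; lra.
have eta1 : eta < 1 by rewrite /eta; lra.
have etam : 1 - (2 ^+ m)^-1 <= eta ^+ m.
  have := @bernoulli_ineq y m (ltW y0) ltac:(lra).
  by rewrite /y [m%:R * _]mulrCA divff ?gt_eqF// mulr1.
have em0 : 0 < eta ^+ m by rewrite exprn_gt0.
exists (1 + 8 / gap + 512 * dconst + (eta ^+ m)^-1), eta, (9 + c1)%N; split; [|exact: eta0|exact: eta1|].
  have : 0 < 8 / gap by rewrite divr_gt0.
  have : 0 < (eta ^+ m)^-1 by rewrite invr_gt0.
  lra.
move=> q r N kappa x cr qN kq kq' x01.
have two_q n : 0 < 2 ^+ n :> R by rewrite exprn_gt0.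
have er : (6 * q <= r)%N.
  by apply: leq_trans cr; apply: leq_mul; last exact: leqnSn.
have halfeta : (2 ^+ q)^-1 <= eta ^+ q.
  by rewrite -exprVn lerXn2r ?nnegrE ?invr_ge0 ?(ltW eta0)// /eta; lra.
pose rho := gap / 2 / 2 ^+ q.
pose tau : R := (2 ^+ q)^-1.
have tau0 : 0 < tau by rewrite invr_gt0.
have tau1 : tau <= 1 by rewrite invf_le1// exprn_ege1// ler1n.
have rho0 : 0 < rho by rewrite divr_gt0// divr_gt0.
have k0 : 0 < `|kappa| by rewrite (lt_le_trans _ kq).
have kn0 : kappa != 0 by rewrite -normr_gt0.
pose B := (2 ^ (r - 6 * q))%N.
have PR : 2 ^+ r = 2 ^+ (6 * q) * B%:R :> R by rewrite natrX -exprD subnKC.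
have B0 : 0 < B%:R :> R by rewrite natrX.
have c512 : 0 <= 512 * dconst * tau by apply: mulr_ge0; [lra|exact: ltW].
pose j := (q %/ m)%N.
have mjq : (m * j <= q)%N by rewrite mulnC leq_trunc_div.
pose G := (1 - (2 ^+ m)^-1) ^+ j + 8 / gap * tau + 512 * dconst * tau.
have om0 : 0 <= 1 - (2 ^+ m)^-1 :> R.
  by rewrite subr_ge0 invf_le1// exprn_ege1// ler1n.
have G0 : 0 <= G.
  apply: addr_ge0; last by apply: mulr_ge0; [lra|exact: ltW].
  apply: addr_ge0; first exact: exprn_ge0.
  by apply: mulr_ge0; [rewrite divr_ge0// ltW|exact: ltW].
have nle : (2 ^ (6 * q) - 2 ^ (5 * q) <= 2 ^ (6 * q))%N by rewrite leq_subr.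
have := @correlation_blocks N (6 * q) r (2 ^ (6 * q) - 2 ^ (5 * q)) kappa x G er nle.
rewrite subKn; last by rewrite leq_exp2l// leq_mul.
rewrite (_ : (2 ^ (5 * q))%:R / 2 ^+ (6 * q) = tau); last first.
  rewrite natrX (_ : (6 * q = 5 * q + q)%N); last by rewrite -mulSnr.
  by rewrite exprD /tau; field; rewrite !gt_eqF.
move=> H; apply: (le_trans (H _ G0)).
  move=> J Jn.
  have JX s : (s < B)%N -> dyadic r x (J * B) + s%:R / 2 ^+ r <= 1 - tau.
    move=> sB.
    have : (J.+1 + 2 ^ (5 * q) <= 2 ^ (6 * q))%N by rewrite addnC addnS -ltn_subRL.
    rewrite -(ler_nat R) natrD -natr1 !natrX.
    have : s.+1%:R <= B%:R :> R by rewrite ler_nat.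
    rewrite -natr1 => hs hJ.
    rewrite /dyadic -mulrDl ler_pdivrMr// natrM PR.
    rewrite (_ : (1 - tau) * (2 ^+ (6 * q) * B%:R) =
       (2 ^+ (6 * q) - 2 ^+ (5 * q)) * B%:R); last first.
      rewrite (_ : (6 * q = 5 * q + q)%N); last by rewrite -mulSnr.
      by rewrite exprD /tau; field; rewrite !gt_eqF.
    apply: (@le_trans _ _ ((J%:R + 1) * B%:R)).
      by case/andP: x01 => _ x1; rewrite mulrDl mul1r -addrA lerD2l; lra.
    by rewrite ler_pM2r//; lra.
  have B0n : (0 < B)%N by rewrite expn_gt0.
  have X0 : 0 <= dyadic r x (J * B).
    by case/andP: x01 => x0 _; rewrite /dyadic divr_ge0 ?addr_ge0 ?(ltW (two_q _)).
  have Xt : dyadic r x (J * B) <= 1 - tau.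
    by have := JX _ B0n; rewrite mul0r addr0.
  have kP : `|kappa| * (dconst / tau) / 2 ^+ r <= 2.
    rewrite ler_pdivrMr// /tau invrK.
    apply: (@le_trans _ _ (2 ^+ (8 * q.+1) * (2 ^+ c1 * 2 ^+ q))).
      apply: ler_pM => //; first by rewrite mulr_ge0// ltW.
      by rewrite ler_pM2r// hc1.
    have rle : (8 * q.+1 + (c1 + q) <= r)%N.
      exact: exponent_budget cr.
    have -> : 2 ^+ (8 * q.+1) * (2 ^+ c1 * 2 ^+ q) = 2 ^+ (8 * q.+1 + (c1 + q)) :> R.
      by rewrite [in RHS]exprD [2 ^+ (c1 + q)]exprD.
    apply: (@le_trans _ _ (2 ^+ r)).
      by apply: ler_weXn2l => //; rewrite ler1n.
    by rewrite ler_peMl ?(ltW (two_q r))// ler1n.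
  have rg : 2 * rho * 2 ^+ (m * j) <= gap.
    apply: (@le_trans _ _ (2 * rho * 2 ^+ q)).
      apply: ler_wpM2l; first by rewrite mulr_ge0// ltW.
      by apply: ler_weXn2l => //; rewrite ler1n.
    by rewrite /rho; apply: eq_ler; field; rewrite gt_eqF.
  apply: (le_trans (block_avg_bound sm (leq_trans mjq qN) rg X0 tau0 tau1
    (two_q r) rho0 kn0 JX Xt kP)).
  rewrite /G !mulrDr -!addrA lerD2l -/B; apply: lerD.
    rewrite PR (_ : B%:R * (8 / gap * tau) =
      4 * (2 ^+ (6 * q) * B%:R) / (2 ^+ (8 * q) * rho)); last first.
      rewrite /rho /tau (_ : (8 * q = 6 * q + q + q)%N); last by rewrite -!mulSnr.
      by rewrite !exprD; field; rewrite !gt_eqF.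
    rewrite ler_pM2l; last by rewrite !mulr_gt0.
    have kr0 : 0 < `|kappa| * rho by exact: mulr_gt0.
    have kr1 : 0 < 2 ^+ (8 * q) * rho by exact: mulr_gt0.
    rewrite lef_pV2 ?posrE//; exact: ler_wpM2r (ltW rho0) _ _ kq.
  rewrite ler_pM2l// PR.
  rewrite (_ : B%:R / (2 ^+ (6 * q) * B%:R) = (2 ^+ (6 * q))^-1); last first.
    by field; rewrite !gt_eqF.
  apply: (@le_trans _ _ (2 * 2 ^+ (8 * q.+1) * (dconst / tau ^+ 2) *
      (2 ^+ (6 * q))^-1 ^+ 2)).
    rewrite ler_pM2r ?exprn_gt0 ?invr_gt0// ler_pM2r; last first.
      by rewrite divr_gt0// exprn_gt0.
    by rewrite ler_pM2l.
  apply: (@le_trans _ _ (512 * dconst * tau * tau)).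
    rewrite /tau mulnS times8 times6.
    rewrite !exprD (_ : 2 ^+ 8 = 256); last by rewrite -natrX.
    by apply: eq_ler; field; rewrite !gt_eqF.
  exact: ler_piMr c512 tau1.
have hj : (1 - (2 ^+ m)^-1) ^+ j <= (eta ^+ m)^-1 * eta ^+ q.
  apply: (@le_trans _ _ ((eta ^+ m) ^+ j)).
    by rewrite lerXn2r ?nnegrE// ltW.
  rewrite -exprM mulrC ler_pdivlMr// -exprD.
  apply: ler_wiXn2l; [exact: ltW|exact: ltW|].
  by rewrite -mulnSr mulnC ltnW// ltn_ceil.
have g80 : 0 <= 8 / gap by rewrite divr_ge0// ltW.
have d0 : 0 <= 512 * dconst by lra.
rewrite /G; move: (8 / gap) (512 * dconst) g80 d0 => u v u0 v0.
have e1 : tau <= eta ^+ q by exact: halfeta.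
have h1 := ler_wpM2l u0 e1; have h2 := ler_wpM2l v0 e1.
have : 0 <= eta ^+ q by rewrite exprn_ge0// ltW.
by move: hj h1 h2 e1; move: ((1 - _) ^+ j) (eta ^+ q) ((eta ^+ m)^-1) => *; lra.
Qed.

End LargeFrequencies.

Section FourierDecay.
Variables (R : realType) (a : R).
Hypotheses (a_gt0 : 0 < a) (a_lt1 : a < 1).
Local Notation normc := (@ComplexField.Normc.normc R).
Local Notation correlation := (correlation a).
Local Notation transfer := (transfer a).
Implicit Types (x kappa M D W b : R) (m n q r N : nat) (v : R -> R[i]).

Lemma geometric_small (t e : R) : 0 <= t -> t < 1 -> 0 < e ->
  exists n, forall k, (n <= k)%N -> t ^+ k <= e.
Proof.
move=> t0 t1 e0; pose y := 1 - t.
have y0 : 0 < y by rewrite /y; lra.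
have [n hn] : exists n : nat, e^-1 / y <= n%:R.
  by exists (Num.bound (e^-1 / y)); apply/ltW/archi_boundP; rewrite divr_ge0 ?invr_ge0 ?ltW.
exists n => k nk.
have h j : t ^+ j * (1 + j%:R * y) <= 1.
  elim: j => [|j IH]; first by rewrite expr0 mul0r addr0 mulr1.
  rewrite exprS -mulrA mulrCA (le_trans _ IH)// ler_wpM2l ?exprn_ge0//.
  rewrite -natr1; have : 0 <= j%:R * y * y by rewrite !mulr_ge0// ltW.
  have : 0 <= y * y by rewrite mulr_ge0// ltW.
  by rewrite (_ : t = 1 - y); [lra|rewrite /y; ring].
have kb : e^-1 <= 1 + k%:R * y.
  have : n%:R * y <= k%:R * y by rewrite ler_pM2r// ler_nat.
  have : e^-1 / y * y <= n%:R * y by rewrite ler_pM2r.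
  rewrite divfK ?gt_eqF//; lra.
have p0 : 0 < e^-1 by rewrite invr_gt0.
rewrite -[leRHS]invrK -[leRHS]mul1r ler_pdivlMr//.
by apply: le_trans (h k); rewrite ler_wpM2l ?exprn_ge0.
Qed.

Fact le_add4 (x y z : nat) : [/\ (x <= x + y + z + 1)%N, (y <= x + y + z + 1)%N,
  (z <= x + y + z + 1)%N & (0 < x + y + z + 1)%N].
Proof. by split; lia. Qed.

Lemma correlation_decay : exists (t : R) (c : nat), [/\ 0 < t, t < 1 &
  forall q, exists2 r, (r <= c * q.+1)%N & forall N kappa x, (c * q.+1 <= N)%N ->
  2 ^+ (8 * q) <= `|kappa| -> `|kappa| <= 2 ^+ (8 * q.+1) -> 0 <= x <= 1 ->
  correlation kappa N r x <= t ^+ q.+1].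
Proof.
have [C [eta [c0 [C0 e0 e1 large]]]] := correlation_large a_gt0 a_lt1.
pose t1 := (1 + eta) / 2.
have t10 : 0 < t1 by rewrite /t1; lra.
have t11 : t1 < 1 by rewrite /t1; lra.
have [q0 hq0] : exists n, forall k, (n <= k)%N -> (eta / t1) ^+ k <= t1 / C.
  apply: geometric_small; first by rewrite divr_ge0 ?ltW.
    by rewrite ltr_pdivrMr// mul1r /t1; lra.
  exact: divr_gt0.
have k01 : 1 <= 2 ^+ (8 * q0) :> R by rewrite exprn_ege1// ler1n.
have [r1 [N1 [A [A1 small]]]] := correlation_small a_gt0 a_lt1 k01.
have [t2 /andP[t20 t21] At2] : exists2 t : R, 0 < t < 1 & Num.max A 0 <= t ^+ q0.+1.
  by apply: root_below_one => //; rewrite ?le_max ?lexx ?orbT// gt_max A1 ltr01.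
have tpos : 0 < Num.max t1 t2 by rewrite lt_max t10.
have [] := le_add4 c0 r1 N1; set c := (c0 + r1 + N1 + 1)%N => c0c r1c N1c cpos.
exists (Num.max t1 t2), c; split; [exact: tpos|by rewrite gt_max t11|].
move=> q; have [qq|qq] := leqP q0 q.
  exists (c0 * q.+1)%N; first by rewrite leq_mul2r c0c orbT.
  move=> N kappa x cN kq kq' x01.
  have qN : (q <= N)%N by apply: leq_trans cN; rewrite ltnW// leq_pmull.
  apply: (le_trans (large q (c0 * q.+1)%N N kappa x (leqnn _) qN kq kq' x01)).
  have := hq0 q qq; rewrite expr_div_n ler_pdivrMr ?exprn_gt0// => h.
  apply: (@le_trans _ _ (t1 ^+ q.+1)); last first.
    by rewrite lerXn2r ?nnegrE ?(ltW t10) ?(ltW tpos)// le_max lexx.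
  apply: (le_trans (ler_wpM2l (ltW C0) h)).
  by rewrite exprS; apply: eq_ler; field; rewrite gt_eqF.
exists r1; first by rewrite (leq_trans r1c)// leq_pmulr.
move=> N kappa x cN kq kq' x01.
have kap1 : 1 <= `|kappa| by rewrite (le_trans _ kq)// exprn_ege1// ler1n.
have kap2 : `|kappa| <= 2 ^+ (8 * q0).
  apply: (le_trans kq'); apply: ler_weXn2l; first by rewrite ler1n.
  by rewrite leq_mul2l.
have NN : (N1 <= N)%N by apply: leq_trans cN; rewrite (leq_trans N1c)// leq_pmulr.
apply: (le_trans (small kappa N x kap1 kap2 NN x01)).
apply: (@le_trans _ _ (Num.max A 0)); first by rewrite le_max lexx.
apply: (le_trans At2); apply: (@le_trans _ _ (t2 ^+ q.+1)).
  by apply: ler_wiXn2l; [exact: ltW|exact: ltW|exact: ltnW].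
by rewrite lerXn2r ?nnegrE ?(ltW t20) ?(ltW tpos)// le_max lexx orbT.
Qed.

Lemma hoelder_class_le b M M' D D' v : M <= M' -> D <= D' ->
  hoelder_class b M D v -> hoelder_class b M' D' v.
Proof.
move=> MM DD [vM vD]; split=> [x x01|x y x01 y01].
  by rewrite (le_trans (vM x x01)).
by rewrite (le_trans (vD x y x01 y01))// ler_wpM2r// powR_ge0.
Qed.

(* The ratio [Lam] of Hoelder constant to sup norm is preserved, so the estimate
   can be iterated. *)
Lemma block_contraction b (E s Lam t : R) kappa N r v W : 0 < b -> b <= a ->
  E = 2 `^ b -> 0 <= s -> 0 < Lam -> 0 <= W -> 0 <= t ->
  (forall x, 0 <= x <= 1 -> correlation kappa N r x <= t) ->
  t + 2 * Lam / E ^+ N <= s ^+ 2 ->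
  (E ^+ N)^-1 + hconst b * `|kappa| / Lam <= s ->
  hoelder_class b W (Lam * W) v ->
  hoelder_class b (s * W) (Lam * (s * W)) (transfer kappa (r + N) v).
Proof.
move=> b0 ba EE s0 L0 W0 t0 corr h1 h2 vW.
have LW0 : 0 <= Lam * W by rewrite mulr_ge0// ltW.
have E1 : 1 < E by rewrite EE powR2_gt1.
have E0 : 0 < E by rewrite (lt_trans ltr01).
split=> [x x01|].
  have := transfer_contraction a kappa N r b0 W0 LW0 vW x01.
  rewrite -EE => h.
  have : normc (transfer kappa (r + N) v x) ^+ 2 <= (s * W) ^+ 2.
    apply: (le_trans h); rewrite exprMn.
    apply: (@le_trans _ _ ((t + 2 * Lam / E ^+ N) * W ^+ 2)); last first.
      by rewrite ler_wpM2r// sqr_ge0.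
    rewrite [leRHS]mulrDl; apply: lerD; first by rewrite ler_wpM2r ?sqr_ge0 ?corr.
    by apply: eq_ler; ring.
  by rewrite ler_pXn2r ?nnegrE ?normc_ge0// mulr_ge0.
have [_] := transfer_hoelder a_lt1 kappa (r + N) b0 ba W0 LW0 vW.
rewrite -EE => h x y x01 y01; apply: (le_trans (h x y x01 y01)).
rewrite ler_wpM2r ?powR_ge0//.
apply: (@le_trans _ _ (Lam * W * ((E ^+ N)^-1 + hconst b * `|kappa| / Lam))).
  rewrite mulrDr lerD//; last by apply: eq_ler; field; rewrite gt_eqF.
  rewrite ler_wpM2l// lef_pV2 ?posrE ?exprn_gt0// ler_eXn2l//.
  exact: leq_addl.
by rewrite mulrA [leRHS](_ : _ = Lam * W * s); [rewrite ler_wpM2l|ring].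
Qed.

Lemma fourier_decay b : 0 < b -> b <= a -> exists (theta : R) (c : nat),
  [/\ 0 < theta, theta < 1 & forall q kappa v W n x,
  2 ^+ (8 * q) <= `|kappa| -> `|kappa| <= 2 ^+ (8 * q.+1) -> 0 <= W ->
  hoelder_class b W W v -> 0 <= x <= 1 ->
  normc (transfer kappa n v x) <= W * (theta ^+ n / theta ^+ (c * q.+1))].
Proof.
move=> b0 ba; have [t [c [t0 t1 corr]]] := correlation_decay.
pose E : R := 2 `^ b.
have E1 : 1 < E by exact: powR2_gt1.
have E0 : 0 < E by rewrite (lt_trans ltr01).
pose s := Num.sqrt ((1 + t) / 2).
have s2 : s ^+ 2 = (1 + t) / 2 by rewrite sqr_sqrtr//; lra.
have s0 : 0 < s by rewrite sqrtr_gt0; lra.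
have s1 : s < 1.
  by rewrite -[ltRHS]sqrtr1 ltr_sqrt//; lra.
have hc0 := hconst_gt0 b0.
pose lam := 2 * (1 + hconst b) * 256 / s.
have lam1 : 1 <= lam.
  by rewrite /lam ler_pdivlMr// mul1r; lra.
have lam0 : 0 < lam by lra.
pose del := (1 - t) / 2.
have del0 : 0 < del by rewrite /del; lra.
have [n1 hn1] : exists n, forall k, (n <= k)%N ->
    E^-1 ^+ k <= Num.min (s / 2) (del / (2 * lam)).
  apply: geometric_small; first by rewrite invr_ge0 ltW.
    by rewrite invf_lt1.
  by rewrite lt_min; apply/andP; split; apply: divr_gt0 => //; lra.
have [] := le_add4 n1 c 0; set n0 := (n1 + c + 0 + 1)%N => n1n0 cn0 _ n0pos.
have := hn1 n0 n1n0.
rewrite le_min => /andP[En1 En2].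
have nn0 : (0 < 2 * n0)%N by rewrite muln_gt0.
have [theta /andP[th0 th1] sth] := root_below_one nn0 (ltW s0) s1.
exists theta, (2 * n0)%N; split => // q kappa v W n x kq kq' W0 vW x01.
have [r rc corrq] := corr q.
pose L := (2 * n0 * q.+1)%N.
pose N := (L - r)%N.
have rn0 : (r <= n0 * q.+1)%N.
  by apply: (leq_trans rc); rewrite leq_mul2r cn0 orbT.
have Nn0 : (n0 * q.+1 <= N)%N.
  by rewrite /N /L leq_subRL; rewrite -mulnA mul2n -addnn ?leq_add2r// (leq_trans rn0)// leq_addr.
have LE : L = (r + N)%N.
  by rewrite /N subnKC// (leq_trans rn0)// /L -mulnA mul2n -addnn leq_addr.
have EN : (E ^+ N)^-1 <= (E^-1 ^+ n0) ^+ q.+1.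
  rewrite -exprM -exprVn; apply: ler_wiXn2l => //; first by rewrite invr_ge0 ltW.
  by rewrite invf_le1// ltW.
pose Lam := lam ^+ q.+1; pose sq := s ^+ q.+1.
have Lam1 : 1 <= Lam by rewrite exprn_ege1.
have Lam0 : 0 < Lam by lra.
have sq0 : 0 <= sq by rewrite exprn_ge0// ltW.
have En0 : 0 <= E^-1 ^+ n0 by rewrite exprn_ge0// invr_ge0 ltW.
have half_q (z : R) : 0 <= z -> (z / 2) ^+ q.+1 <= z ^+ q.+1 / 2.
  move=> z0; rewrite expr_div_n ler_wpM2l ?exprn_ge0//.
  by rewrite lef_pV2 ?posrE ?exprn_gt0// -{1}[2]expr1 ler_weXn2l ?ler1n.
have lam20 : 0 < 2 * lam by lra.
have dl0 : 0 < del / (2 * lam) by exact: divr_gt0.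
have dl1 : 0 < del / lam by exact: divr_gt0.
have cond1 : t ^+ q.+1 + 2 * Lam / E ^+ N <= sq ^+ 2.
  have h1 : 2 * Lam / E ^+ N <= del ^+ q.+1.
    apply: (@le_trans _ _ (2 * Lam * (del / (2 * lam)) ^+ q.+1)).
      rewrite ler_pM2l ?mulr_gt0// (le_trans EN)//.
      by apply: lerXn2r; rewrite ?nnegrE ?(ltW dl0).
    rewrite (_ : del / (2 * lam) = del / lam / 2); last by field; rewrite gt_eqF.
    apply: (@le_trans _ _ (2 * Lam * ((del / lam) ^+ q.+1 / 2))).
      by rewrite ler_pM2l ?mulr_gt0// half_q// ltW.
    rewrite expr_div_n /Lam; apply: eq_ler; field.
    by rewrite gt_eqF.
  have h2 : t ^+ q.+1 + del ^+ q.+1 <= (t + del) ^+ q.+1.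
    have td0 : 0 <= t + del by rewrite addr_ge0// ltW.
    have a1 : t ^+ q <= (t + del) ^+ q.
      by rewrite lerXn2r ?nnegrE ?(ltW t0)// lerDl ltW.
    have a2 : del ^+ q <= (t + del) ^+ q.
      by rewrite lerXn2r ?nnegrE ?(ltW del0)// lerDr ltW.
    rewrite (exprS t) (exprS del) (exprS (t + del)) [leRHS]mulrDl.
    by apply: lerD; apply: ler_wpM2l => //; exact: ltW.
  have -> : sq ^+ 2 = (t + del) ^+ q.+1.
    by rewrite /sq -exprM mulnC exprM s2; congr (_ ^+ _); rewrite /del; field.
  lra.
have cond2 : (E ^+ N)^-1 + hconst b * `|kappa| / Lam <= sq.
  have h1 : (E ^+ N)^-1 <= sq / 2.
    apply: (le_trans EN); apply: le_trans (half_q _ (ltW s0)).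
    by apply: lerXn2r; rewrite ?nnegrE// divr_ge0// ltW.
  have h2 : hconst b * `|kappa| / Lam <= sq / 2.
    apply: le_trans (half_q _ (ltW s0)).
    have -> : s / 2 = (1 + hconst b) * 256 / lam.
      by rewrite /lam; field; rewrite !gt_eqF//; lra.
    rewrite expr_div_n ler_pM2r ?invr_gt0// exprMn.
    have k256 : `|kappa| <= 256 ^+ q.+1.
      by rewrite (le_trans kq')// exprM (_ : 2 ^+ 8 = 256)// -natrX.
    apply: ler_pM => //; first exact: ltW.
    apply: (@le_trans _ _ (1 + hconst b)); first lra.
    by rewrite ler_eXnr//; lra.
  lra.
have tq0 : 0 <= t ^+ q.+1 by rewrite exprn_ge0// ltW.
have corrN y : 0 <= y <= 1 -> correlation kappa N r y <= t ^+ q.+1.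
  move=> y01; apply: corrq => //.
  by apply: leq_trans Nn0; rewrite leq_mul2r cn0 orbT.
have iter j : hoelder_class b (sq ^+ j * W) (Lam * (sq ^+ j * W))
    (transfer kappa (j * L) v).
  elim: j => [|j IH].
    rewrite mul0n expr0 mul1r.
    have -> : transfer kappa 0 v = v.
      by apply/funext => y; rewrite /transfer /= mulr0 cis0 mul1r.
    apply: hoelder_class_le vW => //.
    by rewrite ler_peMl.
  have -> : transfer kappa (j.+1 * L) v = transfer kappa L (transfer kappa (j * L) v).
    by apply/funext => y; rewrite mulSn transferD.
  rewrite exprS -mulrA.
  have sW0 : 0 <= sq ^+ j * W by rewrite mulr_ge0// exprn_ge0.
  have := block_contraction b0 ba (erefl E) sq0 Lam0 sW0 tq0 corrN cond1 cond2 IH.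
  by rewrite -LE.
pose j := (n %/ L)%N.
have nE : n = (n %% L + j * L)%N by rewrite addnC /j -divn_eq.
rewrite nE transferD (le_trans (transfer_sup _ _ _ (iter j) x01))//.
rewrite mulrC ler_wpM2l// -nE.
apply: (@le_trans _ _ (theta ^+ (j * L))).
  rewrite [(j * L)%N]mulnC /L -[(2 * n0 * q.+1 * j)%N]mulnA [leRHS]exprM /sq -exprM.
  by rewrite lerXn2r ?nnegrE ?exprn_ge0// ltW.
rewrite ler_pdivlMr ?exprn_gt0// -exprD.
apply: ler_wiXn2l; [exact: ltW|exact: ltW|].
rewrite -/L -mulSnr ltnW// /j ltn_ceil//.
by rewrite /L muln_gt0 nn0.
Qed.

End FourierDecay.

(** * The discrete Fejer kernel *)

Section Fejer.
Variable R : realType.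
Local Notation normc := (@ComplexField.Normc.normc R).
Local Notation tau := (2 * pi : R).
Implicit Types (s t d x : R) (K : nat).

Definition fejer K d : R := normc (\sum_(0 <= j < K) cis (d * j%:R)) ^+ 2 / K%:R.

Lemma fejer_ge0 K d : 0 <= fejer K d.
Proof. by rewrite divr_ge0// sqr_ge0. Qed.

Lemma fejer_decay K d : fejer K d * normc (cis d - 1) ^+ 2 <= 4 / K%:R.
Proof.
rewrite /fejer mulrAC ler_wpM2r ?invr_ge0// -exprMn -ComplexField.Normc.normcM.
under eq_bigr do rewrite cisX.
rewrite mulrC.
have -> : (cis d - 1) * \sum_(0 <= j < K) cis d ^+ j = cis d ^+ K - 1.
  by rewrite subrX1 big_mkord.
rewrite -cisX (_ : 4 = 2 ^+ 2); last by rewrite -natrX.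
apply: lerXn2r; rewrite ?nnegrE ?normc_ge0//.
by rewrite (le_trans (ler_normcD _ _))// normc_opp normc_cis ComplexField.Normc.normc1.
Qed.

Lemma fejerE K d :
  fejer K d = (\sum_(0 <= i < K) \sum_(0 <= j < K) cos (d * (i%:R - j%:R))) / K%:R.
Proof.
rewrite /fejer; congr (_ / _).
have h (z : R[i]) : normc z ^+ 2 = complex.Re (z * z^*%C) by rewrite mulC_conj.
rewrite h rmorph_sum big_distrl /= raddf_sum /=; apply: eq_bigr => i _.
rewrite big_distrr /= raddf_sum /=; apply: eq_bigr => j _.
by rewrite mulrBr cosB /= mulrN opprK.
Qed.

Lemma cis_2pi_nat (n : nat) : cis (tau * n%:R) = 1 :> R[i].
Proof.
rewrite cisX (_ : cis tau = 1) ?expr1n//.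
by rewrite /cis mulr_natl cos2pi sin2pi.
Qed.

Lemma cis_2pi_int (m : int) : cis (tau * m%:~R) = 1 :> R[i].
Proof.
case: m => n; first exact: cis_2pi_nat.
rewrite NegzE mulrNz mulrN.
have h := cisD (- (tau * n.+1%:R)) (tau * n.+1%:R).
by move: h; rewrite addNr cis0 cis_2pi_nat mulr1.
Qed.

Lemma cos_sum_eq0 K k s : (0 < k)%N -> (k < K)%N ->
  \sum_(0 <= t < K) cos (tau * (s - t%:R / K%:R) * k%:R) = 0 :> R.
Proof.
move=> k0 kK; have K0 : 0 < K%:R :> R by rewrite ltr0n (leq_trans _ kK).
pose d : R := tau * (k%:R / K%:R).
have S0 : \sum_(0 <= t < K) cis (d * t%:R) = 0.
  under eq_bigr do rewrite cisX.
  have := subrX1 (cis d) K; rewrite -(big_mkord xpredT (fun i => cis d ^+ i)).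
  rewrite -cisX (_ : d * K%:R = tau * k%:R); last by rewrite /d; field; rewrite gt_eqF.
  rewrite cis_2pi_nat subrr => /esym/eqP; rewrite mulf_eq0 => /orP[|/eqP//].
  move=> /eqP /(congr1 (@ComplexField.Normc.normc R)).
  rewrite normc_ciss1 ComplexField.Normc.normc0 => /eqP; rewrite mulf_eq0 normr_eq0.
  rewrite pnatr_eq0 /= gt_eqF// sin_gt0_pi//; apply/andP.
  have -> : d / 2 = pi * (k%:R / K%:R) by rewrite /d; field; rewrite gt_eqF.
  split; first by rewrite mulr_gt0 ?pi_gt0// divr_gt0// ltr0n.
  by rewrite gtr_pMr ?pi_gt0// ltr_pdivrMr// mul1r ltr_nat.
have := congr1 (fun z : R[i] => complex.Re (cis (tau * s * k%:R) * z^*%C)) S0.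
rewrite conjc0 mulr0 /= => h; rewrite -[RHS]h {h}.
rewrite rmorph_sum big_distrr raddf_sum; apply: eq_bigr => t _ /=.
rewrite mulrN opprK -cosB; congr cos; rewrite /d; field.
by rewrite gt_eqF.
Qed.

Lemma fejer_mean K s : (0 < K)%N ->
  (\sum_(0 <= t < K) fejer K (tau * (s - t%:R / K%:R))) / K%:R = 1.
Proof.
move=> K0; have K0' : 0 < K%:R :> R by rewrite ltr0n.
under eq_bigr do rewrite fejerE.
rewrite -big_distrl /= exchange_big /=.
rewrite [X in X / _ / _](_ : _ = \sum_(0 <= i < K) K%:R); last first.
  apply: eq_big_nat => i /andP[_ iK].
  rewrite exchange_big /= (bigD1_seq i) ?iota_uniq ?mem_index_iota//= [X in _ + X]big1_seq.
    rewrite addr0; under eq_bigr do rewrite subrr mulr0 cos0.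
    by rewrite sumr_const_nat subn0.
  move=> j; rewrite mem_index_iota => /andP[ji /andP[_ jK]].
  have [lt|lt|eq] := ltngtP i j; last by rewrite eq eqxx in ji.
    under eq_bigr => t _ do rewrite -cosN -mulrN opprB -natrB ?(ltnW lt)//.
    by apply: cos_sum_eq0; [rewrite subn_gt0|rewrite (leq_ltn_trans (leq_subr _ _))].
  under eq_bigr => t _ do rewrite -natrB ?(ltnW lt)//.
  by apply: cos_sum_eq0; [rewrite subn_gt0|rewrite (leq_ltn_trans (leq_subr _ _))].
rewrite sumr_const_nat subn0 -[X in X / _ / _]mulr_natr.
by field; rewrite gt_eqF.
Qed.

Lemma abs_sin_ge2 t : `|t| <= 2 -> `|t| / 4 <= `|sin t|.
Proof.
move=> t2; have tE : t = (t / 2) *+ 2 by rewrite -mulr_natr; field.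
have th : `|t / 2| = `|t| / 2 by rewrite normrM normfV (ger0_norm (ler0n _ 2)).
have h1 : `|t / 2| / 2 <= `|sin (t / 2)| by apply: abs_sin_ge; rewrite th; lra.
have h2 : 1 / 2 <= cos (t / 2).
  apply: le_trans (cos_ge _).
  have : `|t / 2| ^+ 2 <= 1 by rewrite -[leRHS](expr1n _ 2) lerXn2r ?nnegrE// th; lra.
  by rewrite real_normK ?num_real//; lra.
have -> : sin t = 2 * (cos (t / 2) * sin (t / 2)).
  by rewrite {1}tE sin_mulr2n mulr_natl.
rewrite normrM (ger0_norm (ler0n _ 2)) normrM.
have -> : `|cos (t / 2)| = cos (t / 2) by rewrite ger0_norm//; lra.
rewrite th in h1.
have : 1 / 2 * (`|t| / 2 / 2) <= cos (t / 2) * `|sin (t / 2)|.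
  by apply: ler_pM => //; lra.
lra.
Qed.

Lemma nearest_int t : exists m : int, `|t - m%:~R| <= 1 / 2.
Proof.
exists (Num.floor (t + 1 / 2)); have /andP[] := floor_itv (t + 1 / 2).
by rewrite intrD ler_norml => h1 h2; apply/andP; split; lra.
Qed.

Lemma fejer_approx K (f : R -> R) W alpha eta s : (0 < K)%N -> 0 <= W ->
  0 <= alpha -> 0 < eta -> (forall s, `|f s| <= W) ->
  (forall s t (m : int), `|f s - f t| <= W * `|s - t - m%:~R| `^ alpha) ->
  `|f s - (\sum_(0 <= t < K) f (t%:R / K%:R) *
      fejer K (tau * (s - t%:R / K%:R))) / K%:R|
  <= W * eta `^ alpha + 8 * W / (K%:R * eta ^+ 2).
Proof.
move=> K0 W0 al0 eta0 fW fH; have K0' : 0 < K%:R :> R by rewrite ltr0n.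
have fsE : f s = (\sum_(0 <= t < K) f s * fejer K (tau * (s - t%:R / K%:R))) / K%:R.
  by rewrite -big_distrr /= -mulrA fejer_mean// mulr1.
rewrite {1}fsE -mulrBl -sumrB.
rewrite normrM normfV (gtr0_norm K0') ler_pdivrMr//.
rewrite (le_trans (ler_norm_sum _ _ _))//.
rewrite (_ : _ * K%:R = \sum_(0 <= t < K)
    (W * eta `^ alpha * fejer K (tau * (s - t%:R / K%:R)) +
     8 * W / (K%:R * eta ^+ 2))); last first.
  rewrite big_split -big_distrr /= sumr_const_nat subn0 -[X in _ = _ + X]mulr_natr [LHS]mulrDl.
  congr (_ + _); congr (_ * _).
  by apply: (mulIf (invr_neq0 (lt0r_neq0 K0'))); rewrite fejer_mean// divff// gt_eqF.
apply: ler_sum => t _; rewrite -mulrBl normrM (ger0_norm (fejer_ge0 _ _)).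
set d := s - t%:R / K%:R.
have [m hm] := nearest_int d.
have F0 := fejer_ge0 K (tau * d).
have [near|far] := leP `|d - m%:~R| eta.
  rewrite -[leLHS]addr0; apply: lerD; last first.
    by rewrite divr_ge0 ?mulr_ge0 ?exprn_ge0// ltW.
  rewrite ler_wpM2r// (le_trans (fH _ _ m))// ler_wpM2l//.
  by apply: ge0_ler_powR; rewrite ?nnegrE// ltW.
rewrite -[leLHS]add0r; apply: lerD.
  by rewrite mulr_ge0// mulr_ge0// powR_ge0.
have h1 : `|f s - f (t%:R / K%:R)| <= 2 * W.
  by rewrite (le_trans (ler_normB _ _))//; have := fW s; have := fW (t%:R / K%:R); lra.
have h2 : eta <= normc (cis (tau * d) - 1).
  have -> : cis (tau * d) = cis (tau * (d - m%:~R)).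
    have -> : tau * d = tau * (d - m%:~R) + tau * m%:~R by ring.
    by rewrite cisD cis_2pi_int mulr1.
  rewrite normc_ciss1; move: hm far; set r := d - m%:~R => hm far.
  have -> : tau * r / 2 = pi * r by field.
  have pr : `|pi * r| = pi * `|r| by rewrite normrM ger0_norm// pi_ge0.
  have p2 : pi * `|r| <= 2.
    have := pihalf_lt2 R; have := pi_gt0 R => p0 p4.
    have : pi * `|r| <= pi * (1 / 2) by rewrite ler_wpM2l// ltW.
    lra.
  have := @abs_sin_ge2 (pi * r); rewrite pr => /(_ p2).
  have : 2 * `|r| <= pi * `|r| by rewrite ler_wpM2r// pi_ge2.
  move: (pi * `|r|) => z; lra.
have h3 : fejer K (tau * d) <= 4 / (K%:R * eta ^+ 2).
  rewrite invfM mulrA ler_pdivlMr ?exprn_gt0//.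
  apply: (le_trans _ (fejer_decay K (tau * d))).
  by rewrite ler_wpM2l// lerXn2r ?nnegrE ?normc_ge0// ltW.
apply: (le_trans (ler_pM (normr_ge0 _) F0 h1 h3)).
by apply: eq_ler; ring.
Qed.

End Fejer.

Section SkewTransfer.
Variables (R : realType) (a : R).
Hypotheses (a_gt0 : 0 < a) (a_lt1 : a < 1).
Local Notation normc := (@ComplexField.Normc.normc R).
Local Notation roof := (roof a).
Local Notation transfer := (transfer a).
Implicit Types (x s t W kappa alpha : R) (n K l : nat) (h : R -> R -> R).

Definition skew_transfer n h x s : R :=
  avg n (fun w => h (branches w x) (s - birkhoff roof w x)).

Definition hoelder_periodic alpha W h : Prop :=
  [/\ forall x s, 0 <= x <= 1 -> `|h x s| <= W,
      forall x y s, 0 <= x <= 1 -> 0 <= y <= 1 ->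
        `|h x s - h y s| <= W * `|x - y| `^ alpha &
      forall x s t (m : int), 0 <= x <= 1 ->
        `|h x s - h x t| <= W * `|s - t - m%:~R| `^ alpha].

Lemma abs_Re_le (z : R[i]) : `|complex.Re z| <= normc z.
Proof.
by case: z => p q /=; rewrite -sqrtr_sqr ler_wsqrtr// lerDl sqr_ge0.
Qed.

Lemma Re_avg n (F : seq bool -> R[i]) :
  complex.Re (avg n F) = avg n (fun w => complex.Re (F w)).
Proof.
elim: n F => [//|n IH] F /=; rewrite -!IH.
rewrite -[2 : R[i]]/(2%:R) -(rmorph_nat (real_complex R)) -fmorphV.
by case: (avg n _) (avg n _) => [p q] [p' q'] /=; rewrite mulr0 subr0.
Qed.

Lemma avg_cos_le n kappa theta (f : seq bool -> R) (g : seq bool -> R) :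
  `|avg n (fun w => f w * cos (theta + kappa * g w))| <=
  normc (avg n (fun w => cis (kappa * g w) * (f w)%:C%C)).
Proof.
rewrite -[leRHS]mul1r -(normc_cis theta) -ComplexField.Normc.normcM.
apply: le_trans (abs_Re_le _); rewrite -avgMl Re_avg.
apply: eq_ler; congr `|_|; apply: eq_avg => w _.
by rewrite cosD /=; ring.
Qed.

Definition dyadic_mean n h K x : R :=
  (\sum_(0 <= t < K) avg n (fun w => h (branches w x) (t%:R / K%:R))) / K%:R.

Lemma natr_dist_itv (i j K : nat) : (i < K)%N -> (j < K)%N -> j != i ->
  1 <= `|i%:R - j%:R| :> R /\ `|i%:R - j%:R| <= K%:R :> R.
Proof.
move=> iK jK; case: (ltngtP j i) => // lt _.
  rewrite -natrB ?(ltnW lt)// normr_nat ler1n subn_gt0 lt ler_nat.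
  by split=> //; rewrite (leq_trans (leq_subr _ _))// ltnW.
rewrite distrC -natrB ?(ltnW lt)// normr_nat ler1n subn_gt0 lt ler_nat.
by split=> //; rewrite (leq_trans (leq_subr _ _))// ltnW.
Qed.

Lemma fejer_transfer_bound n h K x s (B : R) : (0 < K)%N -> 0 <= B ->
  (forall kappa t, 1 <= `|kappa| -> `|kappa| <= 8 * K%:R ->
    normc (transfer kappa n (fun y => (h y t)%:C%C) x) <= B) ->
  `|avg n (fun w => (\sum_(0 <= t < K) h (branches w x) (t%:R / K%:R) *
       fejer K (2 * pi * (s - birkhoff roof w x - t%:R / K%:R))) / K%:R)
    - dyadic_mean n h K x| <= K%:R * B.
Proof.
move=> K0 B0 HB; have K0' : 0 < K%:R :> R by rewrite ltr0n.
have Kn0 : K%:R != 0 :> R by rewrite gt_eqF.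
pose c (t i j : nat) : R := avg n (fun w => h (branches w x) (t%:R / K%:R) *
  cos (2 * pi * (s - birkhoff roof w x - t%:R / K%:R) * (i%:R - j%:R))).
pose m (t : nat) : R := avg n (fun w => h (branches w x) (t%:R / K%:R)).
have -> : avg n (fun w => (\sum_(0 <= t < K) h (branches w x) (t%:R / K%:R) *
       fejer K (2 * pi * (s - birkhoff roof w x - t%:R / K%:R))) / K%:R) =
   (\sum_(0 <= t < K) \sum_(0 <= i < K) \sum_(0 <= j < K) c t i j) / K%:R / K%:R.
  rewrite avgMr; congr (_ / _); rewrite avg_sum big_distrl; apply: eq_bigr => t _.
  under eq_avg do rewrite fejerE mulrA.
  rewrite avgMr; congr (_ / _).
  under eq_avg do rewrite big_distrr /=.
  rewrite avg_sum; apply: eq_bigr => i _.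
  under eq_avg do rewrite big_distrr /=.
  by rewrite avg_sum.
have -> : dyadic_mean n h K x =
   (\sum_(0 <= t < K) \sum_(0 <= i < K) \sum_(0 <= j < K) (j == i)%:R * m t) / K%:R / K%:R.
  rewrite /dyadic_mean; congr (_ / _); rewrite big_distrl; apply: eq_bigr => t _ /=.
  rewrite -/(m t) (_ : \sum_(0 <= i < K) _ = \sum_(0 <= i < K) m t).
    by rewrite sumr_const_nat subn0 -[X in X / _]mulr_natr mulfK.
  apply: eq_big_nat => i /andP[_ iK].
  rewrite (bigD1_seq i) ?iota_uniq ?mem_index_iota//= eqxx mul1r.
  rewrite [X in _ + X]big1 ?addr0// => j ji.
  by rewrite (negbTE ji) mul0r.
rewrite -!mulrBl -sumrB -mulrA -invfM normrM normfV.
rewrite (gtr0_norm (mulr_gt0 K0' K0')) ler_pdivrMr ?mulr_gt0//.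
rewrite (_ : K%:R * B * (K%:R * K%:R) = \sum_(0 <= t < K) \sum_(0 <= i < K)
   \sum_(0 <= j < K) B); last first.
  rewrite !sumr_const_nat !subn0 -!mulrnA -[RHS]mulr_natl !natrM; ring.
rewrite (le_trans (ler_norm_sum _ _ _))//; apply: ler_sum => t _.
rewrite -sumrB (le_trans (ler_norm_sum _ _ _))// !big_seq.
apply: ler_sum => i; rewrite mem_index_iota => /andP[_ iK].
rewrite -sumrB (le_trans (ler_norm_sum _ _ _))// !big_seq.
apply: ler_sum => j; rewrite mem_index_iota => /andP[_ jK].
have [->|ji] := eqVneq j i.
  rewrite /c; under eq_avg do rewrite subrr mulr0 cos0 mulr1.
  by rewrite mul1r subrr normr0.
rewrite mul0r subr0 /c.
pose kappa : R := - (2 * pi * (i%:R - j%:R)).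
pose theta : R := 2 * pi * (i%:R - j%:R) * (s - t%:R / K%:R).
have E w : 2 * pi * (s - birkhoff roof w x - t%:R / K%:R) * (i%:R - j%:R) =
    theta + kappa * birkhoff roof w x by rewrite /theta /kappa; ring.
under eq_avg do rewrite E.
apply: (le_trans (avg_cos_le _ _ _ _ _)); apply: HB.
  rewrite normrN normrM (ger0_norm (mulr_ge0 _ (pi_ge0 _)))//.
  have [+ _] := natr_dist_itv iK jK ji.
  have := pi_ge2 R; move: (`|_|) pi => d p p2 d1.
  have : 2 * 1 <= p * d by apply: ler_pM.
  by rewrite -mulrA; lra.
rewrite normrN normrM (ger0_norm (mulr_ge0 _ (pi_ge0 _)))//.
apply: ler_pM; rewrite ?mulr_ge0 ?pi_ge0//.
  have := pihalf_lt2 R; lra.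
by have [] := natr_dist_itv iK jK ji.
Qed.

Lemma skew_transfer_approx alpha W n h K x s (B eta : R) : (0 < K)%N ->
  0 <= alpha -> 0 <= W -> 0 < eta -> hoelder_periodic alpha W h -> 0 <= x <= 1 ->
  0 <= B ->
  (forall kappa t, 1 <= `|kappa| -> `|kappa| <= 8 * K%:R ->
    normc (transfer kappa n (fun y => (h y t)%:C%C) x) <= B) ->
  `|skew_transfer n h x s - dyadic_mean n h K x| <=
    W * eta `^ alpha + 8 * W / (K%:R * eta ^+ 2) + K%:R * B.
Proof.
move=> K0 al0 W0 eta0 [h1 _ h3] x01 B0 HB.
have := fejer_transfer_bound s K0 B0 HB.
set S := avg n (fun w => _ / _) => hS.
rewrite -(subrKA S) (le_trans (ler_normD _ _))// lerD//.
rewrite /skew_transfer /S -avgB (le_trans (le_norm_avg _ _))//.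
rewrite -[leRHS](avg_cst n); apply: ler_avg => w _.
apply: fejer_approx => // [t|t t' m].
  by apply: h1; exact: branches_itv.
by apply: h3; exact: branches_itv.
Qed.

Lemma dyadic_mean_osc alpha W n h K x y : (0 < K)%N -> 0 <= alpha -> 0 <= W ->
  hoelder_periodic alpha W h -> 0 <= x <= 1 -> 0 <= y <= 1 ->
  `|dyadic_mean n h K x - dyadic_mean n h K y| <= W / (2 `^ alpha) ^+ n.
Proof.
move=> K0 al0 W0 [_ h2 _] x01 y01; have K0' : 0 < K%:R :> R by rewrite ltr0n.
rewrite /dyadic_mean -mulrBl -sumrB normrM normfV (gtr0_norm K0') ler_pdivrMr//.
rewrite (le_trans (ler_norm_sum _ _ _))//.
rewrite (_ : _ * K%:R = \sum_(0 <= t < K) W / (2 `^ alpha) ^+ n); last first.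
  by rewrite sumr_const_nat subn0 -[RHS]mulr_natr.
apply: ler_sum => t _.
rewrite -avgB (le_trans (le_norm_avg _ _))//.
rewrite -[leRHS](avg_cst n); apply: ler_avg => w wn.
rewrite (le_trans (h2 _ _ _ (branches_itv _ x01) (branches_itv _ y01)))//.
rewrite ler_wpM2l// branchesB normrM normfV (ger0_norm (exprn_ge0 _ (ler0n _ 2))).
rewrite exp_half_powR// wn ler_piMl ?invr_ge0 ?exprn_ge0 ?powR_ge0//.
rewrite -[leRHS](_ : 1 `^ alpha = 1); last by rewrite powR1.
apply: ge0_ler_powR; rewrite ?nnegrE//.
by case/andP: x01 => ? ?; case/andP: y01 => ? ?; rewrite ler_norml; apply/andP; split; lra.
Qed.

Lemma frequency_scale l kappa : 1 <= `|kappa| -> `|kappa| <= 2 ^+ (8 * l.+1) ->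
  exists q, [/\ (q <= l)%N, 2 ^+ (8 * q) <= `|kappa| & `|kappa| <= 2 ^+ (8 * q.+1)].
Proof.
move=> k1; elim: l => [|l IH] kl; first by exists 0%N; rewrite muln0 expr0.
have [|lt] := leP `|kappa| (2 ^+ (8 * l.+1)).
  by move=> /IH[q [ql q1 q2]]; exists q; rewrite leqW.
by exists l.+1; split; rewrite ?(ltW lt).
Qed.

Lemma hoelder_class_real alpha b W h t : 0 < b -> b <= alpha -> 0 <= W ->
  hoelder_periodic alpha W h -> hoelder_class b W W (fun y => (h y t)%:C%C).
Proof.
move=> b0 ba W0 [h1 h2 _]; split=> [x x01|x y x01 y01]; first by rewrite normcR h1.
rewrite -rmorphB normcR (le_trans (h2 _ _ _ x01 y01))// ler_wpM2l//.
have [->|xy] := eqVneq `|x - y| 0.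
  by rewrite !powR0// gt_eqF// (lt_le_trans b0).
apply: ger_powR => //; rewrite lt_neqAle eq_sym xy normr_ge0/=.
by case/andP: x01 => ? ?; case/andP: y01 => ? ?; rewrite ler_norml; apply/andP; split; lra.
Qed.

Lemma floor_power (z : R) p : (0 < p)%N -> 0 < z -> z < 1 ->
  exists2 u : R, 0 < u < 1 & forall n, z ^+ (n %/ p) <= z^-1 * u ^+ n.
Proof.
move=> p0 z0 z1; have [u /andP[u0 u1] zu] := root_below_one p0 (ltW z0) z1.
exists u => [|n]; first by rewrite u0.
rewrite mulrC ler_pdivlMr// -exprSr (@le_trans _ _ ((u ^+ p) ^+ (n %/ p).+1))//.
  by rewrite lerXn2r ?nnegrE ?exprn_ge0 ?(ltW z0) ?(ltW u0).
rewrite -exprM; apply: ler_wiXn2l; [exact: ltW|exact: ltW|].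
by rewrite mulnC ltnW// ltn_ceil.
Qed.

Lemma fejer_size_bound l : 8 * (16 ^ l)%:R <= 2 ^+ (8 * l.+1) :> R.
Proof.
have -> : (16 ^ l)%:R = 2 ^+ (4 * l) :> R by rewrite -natrX expnM.
have -> : 8 = 2 ^+ 3 :> R by rewrite -natrX.
rewrite -exprD; apply: ler_weXn2l; first by rewrite ler1n.
lia.
Qed.

(* With [l = n %/ p] and [K = 16 ^ l], the losses [K] and [theta ^- (c l)] are
   absorbed by [theta ^+ n] as soon as [p] is large. *)
Lemma skew_transfer_osc alpha : 0 < alpha -> exists theta C : R,
  [/\ 0 < theta, theta < 1, 0 < C & forall h W, 0 <= W ->
  hoelder_periodic alpha W h -> forall n x y s t, 0 <= x <= 1 -> 0 <= y <= 1 ->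
  `|skew_transfer n h x s - skew_transfer n h y t| <= C * theta ^+ n * W].
Proof.
move=> al0; pose b := Num.min a alpha.
have b0 : 0 < b by rewrite lt_min a_gt0.
have ba : b <= a by rewrite ge_min lexx.
have bal : b <= alpha by rewrite ge_min lexx orbT.
have [th [c [th0 th1 decay]]] := fourier_decay a_gt0 a_lt1 b0 ba.
pose th2 := Num.sqrt th.
have th20 : 0 < th2 by rewrite sqrtr_gt0.
have th21 : th2 < 1 by rewrite -[ltRHS]sqrtr1 ltr_sqrt.
have th2E : th2 ^+ 2 = th by rewrite sqr_sqrtr// ltW.
have [p0 hp] : exists n, forall k, (n <= k)%N -> th2 ^+ k <= th ^+ c / 16.
  by apply: geometric_small; rewrite ?ltW// divr_gt0// exprn_gt0.
pose p := p0.+1; have ppos : (0 < p)%N by [].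
have thp : th2 ^+ p <= th ^+ c / 16 by exact: hp.
pose E : R := (2 `^ alpha)^-1.
have E20 : 1 < 2 `^ alpha :> R by exact: powR2_gt1.
have E2p : 0 < 2 `^ alpha :> R by rewrite powR_gt0.
have E0 : 0 < E by rewrite invr_gt0.
have E1 : E < 1 by rewrite invf_lt1.
have [u1 /andP[u10 u11] hu1] := floor_power ppos E0 E1.
have q0 : 0 < 4^-1 :> R by rewrite invr_gt0.
have q1 : 4^-1 < 1 :> R by lra.
have [u2 /andP[u20 u21] hu2] := floor_power ppos q0 q1.
pose T := Num.max (Num.max u1 u2) (Num.max th2 E).
have T0 : 0 < T by rewrite !lt_max u10.
have T1 : T < 1 by rewrite !gt_max u11 u21 th21 E1.
have le_T (z : R) n : 0 <= z -> z <= T -> z ^+ n <= T ^+ n.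
  by move=> z0 zT; rewrite lerXn2r ?nnegrE// ltW.
have thc : 0 < th ^+ c by rewrite exprn_gt0.
exists T, (2 * (E^-1 + 32 + (th ^+ c)^-1) + 1); split => //.
  have : 0 < E^-1 by rewrite invr_gt0.
  have : 0 < (th ^+ c)^-1 by rewrite invr_gt0.
  lra.
move=> h W W0 hW n x y s t x01 y01.
pose l := (n %/ p)%N; pose K := (16 ^ l)%N.
have K0 : (0 < K)%N by rewrite expn_gt0.
pose B := W * (th ^+ n / th ^+ (c * l.+1)).
have B0 : 0 <= B by rewrite mulr_ge0// divr_ge0// exprn_ge0// ltW.
have HB x' (x'01 : 0 <= x' <= 1) kappa t' : 1 <= `|kappa| -> `|kappa| <= 8 * K%:R ->
    normc (transfer kappa n (fun y => (h y t')%:C%C) x') <= B.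
  move=> k1 k2; have k2' := le_trans k2 (fejer_size_bound l).
  have [q [ql kq kq']] := frequency_scale k1 k2'.
  have hc := hoelder_class_real t' b0 bal W0 hW.
  rewrite (le_trans (decay q kappa _ W n x' kq kq' W0 hc x'01))// ler_wpM2l//.
  rewrite ler_pM2l ?exprn_gt0// lef_pV2 ?posrE ?exprn_gt0//.
  by apply: ler_wiXn2l; [exact: ltW|exact: ltW|rewrite leq_mul2l ltnS ql orbT].
pose eta : R := 2^-1 ^+ l.
have eta0 : 0 < eta by rewrite exprn_gt0// invr_gt0.
pose e := W * eta `^ alpha + 8 * W / (K%:R * eta ^+ 2) + K%:R * B.
have ap z r (z01 : 0 <= z <= 1) :
    `|skew_transfer n h z r - dyadic_mean n h K z| <= e.
  exact: skew_transfer_approx K0 (ltW al0) W0 eta0 hW z01 B0 (HB z z01).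
have e1 : W * eta `^ alpha <= W * (E^-1 * T ^+ n).
  rewrite ler_wpM2l//.
  have -> : eta `^ alpha = E ^+ l.
    by rewrite /eta exprVn -[(2 ^+ l)^-1]mul1r exp_half_powR// powR1 mul1r /E exprVn.
  rewrite (le_trans (hu1 n))// ler_wpM2l ?invr_ge0 ?(ltW E0)//.
  by apply: le_T; [exact: ltW|rewrite /T !le_max lexx].
have e2 : 8 * W / (K%:R * eta ^+ 2) <= W * (32 * T ^+ n).
  have -> : 8 * W / (K%:R * eta ^+ 2) = W * (8 * 4^-1 ^+ l).
    rewrite /K /eta natrX (_ : 16 = 4 * 4); last by rewrite -natrM.
    rewrite exprMn -exprM mulnC exprM !exprVn (_ : 2 ^+ 2 = 4); last by rewrite -natrX.
    by field; rewrite gt_eqF// exprn_gt0.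
  rewrite ler_wpM2l// (_ : 32 = 8 * 4^-1^-1); last by rewrite invrK -natrM.
  rewrite -mulrA ler_wpM2l// (le_trans (hu2 n))// ler_wpM2l ?invr_ge0//.
  by apply: le_T; [exact: ltW|rewrite /T !le_max lexx orbT].
have e3 : K%:R * B <= W * ((th ^+ c)^-1 * T ^+ n).
  rewrite /B mulrCA ler_wpM2l// mulnS exprD exprM.
  rewrite mulrC ler_pdivlMl// mulrA.
  have lp : (p * l <= n)%N by rewrite mulnC leq_trunc_div.
  have -> : th ^+ n = th2 ^+ n * th2 ^+ n by rewrite -th2E -exprMn -expr2.
  have h1 : th2 ^+ n <= (th ^+ c / 16) ^+ l.
    apply: (@le_trans _ _ (th2 ^+ (p * l))).
      by apply: ler_wiXn2l; [exact: ltW|exact: ltW|].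
    by rewrite exprM lerXn2r ?nnegrE ?exprn_ge0 ?divr_ge0 ?(ltW th20) ?(ltW thc).
  have h2 : th2 ^+ n <= T ^+ n.
    by apply: le_T; [exact: ltW|rewrite /T !le_max lexx !orbT].
  have z0 : 0 <= th2 ^+ n by rewrite exprn_ge0// ltW.
  have h3 := ler_pM z0 z0 h2 h1.
  apply: (@le_trans _ _ ((T ^+ n * (th ^+ c / 16) ^+ l) * K%:R / (th ^+ c) ^+ l)).
    rewrite (_ : th ^+ c * (_ / (th ^+ c * (th ^+ c) ^+ l)) * K%:R =
      (th2 ^+ n * th2 ^+ n) * K%:R / (th ^+ c) ^+ l); last first.
      by field; rewrite !gt_eqF// exprn_gt0.
    by rewrite ler_pM2r ?invr_gt0 ?exprn_gt0// ler_pM2r// ltr0n.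
  rewrite expr_div_n /K natrX; apply: eq_ler; field.
  by rewrite !gt_eqF// exprn_gt0.
have e4 := dyadic_mean_osc n K0 (ltW al0) W0 hW x01 y01.
have e5 : W / (2 `^ alpha) ^+ n <= W * T ^+ n.
  rewrite ler_wpM2l// -exprVn.
  by apply: le_T; [exact: ltW|rewrite /T !le_max lexx !orbT].
have a1 := ap x s x01; have a2 := ap y t y01.
rewrite distrC in a2.
rewrite (_ : _ - _ = (skew_transfer n h x s - dyadic_mean n h K x) +
   ((dyadic_mean n h K x - dyadic_mean n h K y) +
    (dyadic_mean n h K y - skew_transfer n h y t))); last by ring.
rewrite (le_trans (ler_normD _ _))//.
rewrite (le_trans (lerD a1 (le_trans (ler_normD _ _) (lerD e4 a2))))//.
rewrite (_ : (_ + 1) * _ * _ = 2 * (W * (E^-1 * T ^+ n) + W * (32 * T ^+ n) +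
  W * ((th ^+ c)^-1 * T ^+ n)) + W * T ^+ n); last by ring.
move: e1 e2 e3 e5; rewrite /e; lra.
Qed.

End SkewTransfer.

(** * Invariance of the measures and duality *)

Section LebesgueInvariance.
Variable R : realType.
Local Notation mu := (@lebesgue_measure R).
Implicit Types (A P : set (measurableTypeR R)) (c d s t : R).

Lemma measurable_affine c d :
  measurable_fun [set: measurableTypeR R] (fun x : measurableTypeR R => c * x + d : measurableTypeR R).
Proof.
by apply: measurable_funD => //; apply: measurable_funM.
Qed.

Lemma lebesgue_affine c d A : 0 < c -> measurable A ->
  mu A = (c%:E * mu ((fun x : measurableTypeR R => (c * x + d)%R) @^-1` A))%E.
Proof.
move=> c0 mA.
pose m : {measure set (measurableTypeR R) -> \bar R} :=
  measure_function_pushforward__canonical__measure_function_Measure mu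
    (measurable_affine c d).
have cn : 0 <= c by exact: ltW.
pose m' : {measure set (measurableTypeR R) -> \bar R} := mscale (NngNum cn) m.
suff -> : mu A = m' A by [].
apply: lebesgue_measure_unique mA => /= _ [[a b]] _ <-.
rewrite /m' /mscale /m /= /pushforward.
have -> : (fun x => c * x + d) @^-1` `]a, b]%classic = `](a - d) / c, (b - d) / c]%classic.
  apply/seteqP; split=> x; rewrite /= !in_itv /= ltr_pdivrMr// ler_pdivlMr// [x * c]mulrC;
  by rewrite ltrBlDr lerBrDr.
rewrite !lebesgue_measure_itv /= !lte_fin ltr_pM2r ?invr_gt0// ltrD2r.
case: ifP => _; last by rewrite mule0.
rewrite -!EFinB -EFinM; congr (_%:E); field.
by rewrite gt_eqF.
Qed.

Lemma lebesgue_shift d A : measurable A -> mu ((fun x => x + d) @^-1` A) = mu A.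
Proof.
move=> mA; rewrite (@lebesgue_affine 1 d A)// mul1e.
by congr (mu _); apply/seteqP; split=> x /=; rewrite mul1r.
Qed.

Lemma lebesgue_itv_split A (x y z : R) (b : bool) : measurable A -> x <= y -> y <= z ->
  mu (A `&` [set` Interval (BLeft x) (BSide b z)]) =
  (mu (A `&` `[x, y[) + mu (A `&` [set` Interval (BLeft y) (BSide b z)]))%E.
Proof.
move=> mA xy yz; rewrite -measureU//; [|exact: measurableI|exact: measurableI|].
  rewrite -setIUr; congr (mu (_ `&` _)); rewrite -itv_bndbnd_setU//.
  by case: b; rewrite bnd_simp.
rewrite setIACA setIid (_ : `[x, y[ `&` _ = set0) ?setI0//.
apply/seteqP; split=> // t /= []; rewrite !in_itv /= => /andP[_ ty] /andP[yt _].
by move: (le_lt_trans yt ty); rewrite ltxx.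
Qed.

Lemma lebesgue_itv_bndo A (x y : R) : measurable A -> x <= y ->
  mu (A `&` `[x, y]) = mu (A `&` `[x, y[).
Proof.
move=> mA xy; rewrite (@lebesgue_itv_split A x y y false)//.
rewrite [X in (_ + X)%E](_ : _ = 0%E) ?adde0//.
apply/eqP; rewrite eq_le measure_ge0 andbT.
apply: (@le_trans _ _ (mu `[y, y])).
  by apply: le_measure; rewrite ?inE//; exact: measurableI.
by rewrite lebesgue_measure_itv /= ltxx.
Qed.

Lemma lebesgue01E A : lebesgue01 A = mu (A `&` `[0, 1]).
Proof. by []. Qed.

Lemma lebesgue01_branches A : measurable A ->
  lebesgue01 A = (2^-1%:E * (lebesgue01 (branch false @^-1` A) +
                             lebesgue01 (branch true @^-1` A)))%E.
Proof.
move=> mA.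
have half (b : bool) : lebesgue01 ((@branch R b) @^-1` A) =
    (2%:E * mu (A `&` `[(b%:R / 2)%R, ((b%:R + 1) / 2)%R]))%E.
  rewrite lebesgue01E (@lebesgue_affine 2^-1 (b%:R / 2) (A `&` _))//; last first.
    exact: measurableI.
  rewrite muleA -EFinM divff// mul1e; congr (mu _); rewrite preimage_setI.
  congr (_ `&` _).
    by apply/seteqP; split=> x; rewrite /branch /= [2^-1 * x]mulrC -mulrDl.
  apply/seteqP; split=> x; rewrite /= !in_itv /= => /andP[h1 h2]; apply/andP; split; lra.
rewrite !half /= -muleDr ?ge0_adde_def ?inE ?measure_ge0//.
rewrite muleA -EFinM mulVf// mul1e lebesgue01E.
rewrite (@lebesgue_itv_split A 0 (1 / 2) 1 false)//; last lra.
have h0 : (0 : R) <= 1 / 2 by lra.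
rewrite -(lebesgue_itv_bndo mA h0).
congr (mu (_ `&` _) + mu (_ `&` _))%E; apply/seteqP; split=> x; rewrite /= !in_itv /=;
  by move=> /andP[h1 h2]; apply/andP; split; lra.
Qed.

Lemma to_circle_int (x : R) (m : int) : to_circle (x + m%:~R) = to_circle x.
Proof.
by apply/eqP; rewrite to_circle_eq addrAC subrr add0r intr_int.
Qed.

Lemma lebesgue_circleE (A : set (circle R)) :
  lebesgue_circle A = mu ((@to_circle R) @^-1` A `&` `[0, 1]).
Proof. by []. Qed.

Lemma preimage_to_circle_measurable (A : set (circle R)) : measurable A ->
  measurable ((@to_circle R) @^-1` A : set (measurableTypeR R)).
Proof.
by move=> mA; rewrite -[X in measurable X]setTI; exact: measurable_to_circle.
Qed.

Lemma to_circle_lift (u : circle R) : exists2 x : R, 0 <= x < 1 & to_circle x = u.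
Proof.
pose y : R := repr u; exists (y - (Num.floor y)%:~R).
  by have /andP[h1 h2] := floor_itv y; rewrite intrD in h2; apply/andP; split; lra.
by rewrite -mulrNz to_circle_int /to_circle reprK.
Qed.

Lemma lebesgue_circle_translation (t : circle R) (A : set (circle R)) : measurable A ->
  lebesgue_circle ((fun u => u + t) @^-1` A) = lebesgue_circle A.
Proof.
move=> mA; have [d /andP[d0 d1] <-] := to_circle_lift t.
pose P := (@to_circle R) @^-1` A : set (measurableTypeR R).
have mP : measurable P by exact: preimage_to_circle_measurable.
rewrite !lebesgue_circleE -/P.
have -> : (@to_circle R) @^-1` ((fun u => u + to_circle d) @^-1` A) `&` `[0, 1] =
    (fun x => x + d) @^-1` (P `&` `[d, 1 + d]).
  apply/seteqP; split=> x; rewrite /= !in_itv /= /P /= to_circleD => -[h1 /andP[h2 h3]];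
  by split=> //; apply/andP; split; lra.
rewrite lebesgue_shift; last exact: measurableI.
rewrite (lebesgue_itv_bndo mP)//; last lra.
rewrite (lebesgue_itv_bndo mP)//.
rewrite (@lebesgue_itv_split P d 1 (1 + d) true)//; [|exact: ltW|by rewrite lerDl].
rewrite (@lebesgue_itv_split P 0 d 1 true)//; last exact: ltW.
rewrite addeC; congr (_ + _)%E.
rewrite -(@lebesgue_shift 1 (P `&` `[1, 1 + d[)); last exact: measurableI.
congr (mu _); apply/seteqP; split=> x; rewrite /= !in_itv /= /P /=;
  rewrite -[to_circle (x + 1)]/(to_circle (x + 1%:~R)) to_circle_int;
  by move=> [h1 /andP[h2 h3]]; split=> //; apply/andP; split; lra.
Qed.

End LebesgueInvariance.

Section CircleMetric.
Variable R : realType.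
Implicit Types (u v w : circle R) (s t : R).

Lemma to_circle_mdist_le s t : mdist (to_circle s) (to_circle t) <= `|s - t|.
Proof.
rewrite mdist_circleE /circle_dist; apply: ge_inf; last by exists s, t.
by exists 0 => _ [x [y [_ _ ->]]].
Qed.

Lemma to_circle_mdist_int s t (m : int) :
  mdist (to_circle s) (to_circle t) <= `|s - t - m%:~R|.
Proof.
rewrite -(to_circle_int t m) (le_trans (to_circle_mdist_le _ _))//.
by rewrite opprD addrA.
Qed.

Lemma mdist_translation_le u v w : mdist (u + w) (v + w) <= mdist u v.
Proof.
rewrite !mdist_circleE /circle_dist; apply: lb_le_inf.
  have [s _ su] := to_circle_lift u; have [t _ tv] := to_circle_lift v.
  by exists `|s - t|, s, t.
move=> _ [s [t [su tv ->]]]; have [r _ rw] := to_circle_lift w.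
apply: ge_inf; first by exists 0 => _ [x [y [_ _ ->]]].
exists (s + r), (t + r); split; rewrite ?to_circleD ?su ?tv ?rw//.
by congr `|_|; ring.
Qed.

Lemma to_circle0 : to_circle 0 = 0 :> circle R.
Proof. by apply: (addrI (to_circle 0)); rewrite -to_circleD !addr0. Qed.

Lemma to_circleN s : to_circle (- s) = - to_circle s.
Proof.
by apply: (addrI (to_circle s)); rewrite -to_circleD !subrr to_circle0.
Qed.

End CircleMetric.

Section PhaseMeasurability.
Variables (R : realType) (a : R).
Hypotheses (a_gt0 : 0 < a) (a_lt1 : a < 1).
Local Notation Omega := (measurableTypeR R * circle R)%type.
Implicit Types (z : Omega) (O : set Omega) (e : R).

(* Such a set is a countable union of boxes with rational centres, hence
   measurable for the product sigma-algebra. *)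
Definition box_open O : Prop := forall z, O z -> exists2 e : R, 0 < e &
  forall z', `|z'.1 - z.1| < e -> mdist z'.2 z.2 < e -> O z'.

Lemma mball_open (u : circle R) e : open [set v | mdist u v < e].
Proof.
rewrite openE => v /= uv; rewrite /interior /= -nbhs_ballE.
exists (e - mdist u v) => /=; first by rewrite subr_gt0.
move=> x; rewrite ballEmdist /= ltrBrDl; apply: le_lt_trans.
exact: metric_triangle.
Qed.

Lemma box_measurable (p q e : R) :
  measurable [set z : Omega | `|z.1 - p| < e /\ mdist (to_circle q) z.2 < e].
Proof.
rewrite [X in measurable X](_ : _ =
  [set x : measurableTypeR R | `|x - p| < e] `*` [set v | mdist (to_circle q) v < e])//.
apply: measurableX; last by apply: sub_sigma_algebra; exact: mball_open.
rewrite [X in measurable X](_ : _ = `]p - e, p + e[%classic)//.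
by apply/seteqP; split=> x /=; rewrite in_itv /= ltr_distl.
Qed.

Lemma box_open_measurable O : box_open O -> measurable O.
Proof.
move=> oO.
pose box (p q : rat) (n : nat) : set Omega :=
  [set z | `|z.1 - ratr p| < n.+1%:R^-1 /\ mdist (to_circle (ratr q)) z.2 < n.+1%:R^-1].
pose F p q n : set Omega := if pselect (box p q n `<=` O) then box p q n else set0.
have -> : O = \bigcup_p \bigcup_q \bigcup_n F p q n.
  apply/seteqP; split=> [z Oz|z [p _ [q _ [n _]]]]; last first.
    by rewrite /F; case: pselect => // s; exact: s.
  have [e e0 eO] := oO z Oz.
  have [n hn] : exists n : nat, n.+1%:R^-1 < e / 2.
    have e2 : 0 < e / 2 by rewrite divr_gt0.
    exists (Num.bound (e / 2)^-1).
    rewrite invf_plt ?posrE// (lt_trans (archi_boundP _)) ?invr_ge0 ?ltW//.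
    by rewrite ltr_nat.
  have [s _ sz] := to_circle_lift z.2.
  have n0 : 0 < n.+1%:R^-1 :> R by rewrite invr_gt0.
  have ltz (r : R) : r - n.+1%:R^-1 < r + n.+1%:R^-1.
    by rewrite ltrD2l (lt_trans _ n0)// oppr_lt0.
  have [p hp] := rat_in_itvoo (ltz z.1); have [q hq] := rat_in_itvoo (ltz s).
  have bz : box p q n z.
    rewrite /box /=; split.
      by rewrite distrC ltr_distl; move: hp; rewrite in_itv.
    rewrite -sz (le_lt_trans (to_circle_mdist_le _ _))// ltr_distl.
    by move: hq; rewrite in_itv.
  exists p => //; exists q => //; exists n => //; rewrite /F.
  case: pselect => // ns; exfalso; apply: ns => z' [h1 h2].
  case: bz => h3 h4; apply: eO.
    rewrite (le_lt_trans (ler_distD (ratr p) _ _))// [e]splitr ltrD//.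
      exact: lt_trans hn.
    by rewrite distrC (lt_trans h3).
  rewrite (le_lt_trans (metric_triangle _ (to_circle (ratr q)) _))// [e]splitr ltrD//.
    by rewrite metric_sym (lt_trans h2).
  exact: lt_trans hn.
apply: bigcupT_measurable_rat => p; apply: bigcupT_measurable_rat => q.
apply: bigcupT_measurable => n; rewrite /F.
by case: pselect => s; [exact: box_measurable|exact: measurable0].
Qed.

Lemma measurable_rays d (T : measurableType d) (f : T -> R) :
  (forall y, measurable [set x | y < f x]) -> measurable_fun setT f.
Proof.
move=> h; apply: (@measurability _ _ _ _ _ _ (@RGenOInfty.G R)).
  exact: RGenOInfty.measurableE.
move=> _ [_ [y ->] <-]; rewrite setTI.
rewrite [X in measurable X](_ : _ = [set x | y < f x])//.
by apply/seteqP; split=> x /=; rewrite in_itv /= andbT.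
Qed.

Lemma measurable_box_circle (f : Omega -> circle R) :
  (forall z e, 0 < e -> exists2 e' : R, 0 < e' & forall z', `|z'.1 - z.1| < e' ->
    mdist z'.2 z.2 < e' -> mdist (f z) (f z') < e) ->
  measurable_fun setT f.
Proof.
move=> fc; apply: (@measurability _ _ _ _ _ _ (@open (circle R))) => //.
move=> _ [V oV <-]; rewrite setTI; apply: box_open_measurable => z /= Vz.
have : nbhs (f z) V by exact: open_nbhs_nbhs.
rewrite -nbhs_ballE => -[e /= e0 eV].
have [e' e'0 h] := fc z e e0; exists e' => // z' h1 h2.
by apply: eV; rewrite ballEmdist /=; exact: h.
Qed.

Lemma roof_holder_global (x y : R) : `|roof a x - roof a y| <= `|x - y| `^ a.
Proof.
rewrite /roof.
have h (s t : R) : 0 <= s -> 0 <= t -> s `^ a - t `^ a <= `|s - t| `^ a.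
  move=> s0 t0; rewrite lerBlDl.
  apply: (@le_trans _ _ ((t + `|s - t|) `^ a)).
    apply: ge0_ler_powR; rewrite ?nnegrE ?(ltW a_gt0) ?addr_ge0//.
    by rewrite -lerBlDl ler_norm.
  by apply: powR_subadd => //; exact: ltW.
have h2 : `| `|x - 1| - `|y - 1| | `^ a <= `|x - y| `^ a.
  apply: ge0_ler_powR; rewrite ?nnegrE ?(ltW a_gt0)//.
  by rewrite (le_trans (ler_dist_dist _ _))//; apply: eq_ler; congr `|_|; ring.
rewrite ler_norml lerNl opprB; apply/andP; split.
  by rewrite (le_trans (h _ _ _ _))// distrC.
by rewrite (le_trans (h _ _ _ _)).
Qed.

Lemma roof_modulus (e : R) : 0 < e -> exists2 e' : R, 0 < e' &
  forall x y : R, `|x - y| < e' -> `|roof a x - roof a y| < e.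
Proof.
move=> e0; exists (e `^ a^-1); first exact: powR_gt0.
move=> x y xy; rewrite (le_lt_trans (roof_holder_global _ _))//.
have -> : e = (e `^ a^-1) `^ a by rewrite -powRrM mulVf ?gt_eqF// powRr1// ltW.
by apply: gt0_ltr_powR => //; rewrite nnegrE// ltW// powR_gt0.
Qed.

Lemma measurable_shear (f : R -> R) (L : R) : 0 < L ->
  (forall x y, `|f x - f y| <= L * `|x - y|) -> forall sg : bool,
  measurable_fun setT (fun z : Omega =>
    z.2 + to_circle ((-1) ^+ sg * roof a (f z.1))).
Proof.
move=> L0 fL sg; apply: measurable_box_circle => z e e0.
have e20 : 0 < e / 2 by rewrite divr_gt0.
have [e' e'0 he'] := roof_modulus e20.
exists (Num.min (e / 2) (e' / L)); first by rewrite lt_min e20 divr_gt0.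
move=> z'; rewrite !lt_min => /andP[_ h1] /andP[h2 _].
rewrite (le_lt_trans (metric_triangle _ (z'.2 + to_circle ((-1) ^+ sg * roof a (f z.1))) _))//.
rewrite [e]splitr; apply: ltrD.
  by rewrite (le_lt_trans (mdist_translation_le _ _ _))// metric_sym.
rewrite addrC [z'.2 + _]addrC (le_lt_trans (mdist_translation_le _ _ _))//.
rewrite (le_lt_trans (to_circle_mdist_le _ _))// -mulrBr normrM normrX normrN1.
rewrite expr1n mul1r; apply: he'.
by rewrite (le_lt_trans (fL _ _))// distrC mulrC -ltr_pdivlMr.
Qed.

Lemma measurable_floor : measurable_fun [set: measurableTypeR R]
  (fun x : measurableTypeR R => (Num.floor x)%:~R : measurableTypeR R).
Proof.
apply: measurable_rays => y.
rewrite [X in measurable X](_ : _ = `[(Num.floor y + 1)%:~R, +oo[%classic)//.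
apply/seteqP; split=> x /=; rewrite in_itv /= andbT => h.
  have /andP[h1 h2] := floor_itv x; apply: le_trans h1.
  rewrite ler_int lezD1; have /andP[h3 h4] := floor_itv y.
  by rewrite -(ltr_int R) (le_lt_trans h3).
have /andP[h3 h4] := floor_itv y; apply: (lt_le_trans h4); rewrite ler_int.
by rewrite floor_ge_int.
Qed.

Lemma measurable_doubling : measurable_fun [set: measurableTypeR R]
  (@doubling R : measurableTypeR R -> measurableTypeR R).
Proof.
rewrite /doubling; apply: measurable_funB; first exact: measurable_funM.
by apply: (measurableT_comp measurable_floor); exact: measurable_funM.
Qed.

Lemma measurable_skew_product :
  measurable_fun [set: Omega] (skew_product a : Omega -> Omega).
Proof.
apply: measurable_fun_pair; first exact: (measurableT_comp measurable_doubling).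
have := @measurable_shear id 1 ltr01 _ false.
rewrite expr0; under eq_fun do rewrite mul1r; apply.
by move=> x y; rewrite mul1r.
Qed.

Definition inverse_branch (b : bool) (z : Omega) : Omega :=
  (branch b z.1, z.2 - to_circle (roof a (branch b z.1))).

Lemma measurable_branch b : measurable_fun [set: measurableTypeR R]
  (branch b : measurableTypeR R -> measurableTypeR R).
Proof. by apply: measurable_funM => //; exact: measurable_funD. Qed.

Lemma measurable_inverse_branch b : measurable_fun setT (inverse_branch b).
Proof.
apply: measurable_fun_pair; first exact: (measurableT_comp (measurable_branch b)).
have := @measurable_shear (branch b) 1 ltr01 _ true.
rewrite expr1; under eq_fun do rewrite mulN1r to_circleN; apply.
move=> x y; rewrite branchB normrM normfV (ger0_norm (ler0n _ 2)) mul1r.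
by rewrite ler_piMr// invf_le1// ler1n.
Qed.

Lemma skew_product_inverse_branch b z : 0 <= z.1 < 1 ->
  skew_product a (inverse_branch b z) = z.
Proof.
case: z => x u /= /andP[x0 x1]; rewrite /skew_product /inverse_branch /=.
congr (_, _); last by rewrite /skewing -/(roof a _) subrK.
rewrite /doubling /branch (_ : 2 * ((x + b%:R) / 2) = x + b%:R); last by field.
have -> : Num.floor (x + b%:R) = b%:R.
  by apply: floor_def; rewrite intrD; case: b => /=; apply/andP; split; lra.
by case: b => /=; ring.
Qed.

End PhaseMeasurability.

Section BoundedIntegrals.
Variable R : realType.
Local Notation Omega := (measurableTypeR R * circle R)%type.
Local Notation nu := (@phase_measure R).
Implicit Types (f g h : Omega -> R) (z : Omega).

Definition tame f : Prop :=
  measurable_fun setT f /\ exists M, forall z, `|f z| <= M.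

Local Notation I f := (Rintegral nu setT f).

Lemma tame_integrable f : tame f -> nu.-integrable setT (EFin \o f).
Proof.
move=> [mf [M fM]]; have nuT : (nu setT < +oo)%E by rewrite phase_measure_setT ltry.
apply: (measurable_bounded_integrable measurableT nuT mf).
exists M; split; first exact: num_real.
by move=> x Mx z _; rewrite /= (le_trans (fM z))// ltW.
Qed.

Lemma tameD f g : tame f -> tame g -> tame (fun z => f z + g z).
Proof.
move=> [mf [M fM]] [mg [N gN]]; split; first exact: measurable_funD.
by exists (M + N) => z; rewrite (le_trans (ler_normD _ _))// lerD.
Qed.

Lemma tameM f g : tame f -> tame g -> tame (fun z => f z * g z).
Proof.
move=> [mf [M fM]] [mg [N gN]]; split; first exact: measurable_funM.
by exists (M * N) => z; rewrite normrM ler_pM.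
Qed.

Lemma tame_cst (c : R) : tame (fun=> c).
Proof. by split => //; exists `|c|. Qed.

Lemma tame_comp f (phi : Omega -> Omega) : measurable_fun setT phi -> tame f ->
  tame (fun z => f (phi z)).
Proof.
by move=> mphi [mf [M fM]]; split; [exact: (measurableT_comp mf)|exists M].
Qed.

Lemma tame_norm f : tame f -> tame (fun z => `|f z|).
Proof.
move=> [mf [M fM]]; split; first exact: measurableT_comp.
by exists M => z; rewrite normr_id.
Qed.

Lemma tame_IntD f g : tame f -> tame g -> I (fun z => f z + g z) = I f + I g.
Proof. by move=> tf tg; rewrite RintegralD//; exact: tame_integrable. Qed.

Lemma tame_IntZ c f : tame f -> I (fun z => c * f z) = c * I f.
Proof. by move=> tf; rewrite RintegralZl//; exact: tame_integrable. Qed.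

Lemma tame_Int_cst c : I (fun=> c) = c.
Proof.
rewrite Rintegral_cst// [X in fine X](_ : _ = 1%E) ?mulr1//.
exact: phase_measure_setT.
Qed.

Lemma phase_ae_lt1 : {ae nu, forall z : Omega, 0 <= z.1 < 1}.
Proof.
pose B : set Omega := `[0, 1[ `*` setT.
have mB : measurable B by exact: measurableX.
exists (~` B); split; first exact: measurableC.
  have B1 : nu B = 1%E.
    rewrite /phase_measure /B product_measure1E//.
    transitivity (lebesgue01 (`[0%R, 1%R[%classic : set R) * lebesgue_circle [set: circle R])%E => //.
    rewrite lebesgue_circle_setT mule1 lebesgue01E.
    rewrite (_ : _ `&` _ = `[0, 1[%classic); last first.
      apply/seteqP; split=> x /=; rewrite !in_itv /=; first by case.
      by move=> /andP[h1 h2]; split; apply/andP; split=> //; exact: ltW.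
    by rewrite lebesgue_measure_itv /= lte_fin ltr01 oppr0 adde0.
  rewrite (probability_setC nu mB) [X in (_ - X)%E](_ : _ = 1%E); last exact: B1.
  by rewrite subee.
by move=> z /= hz [h _]; apply: hz; move: h; rewrite /= in_itv.
Qed.

Lemma tame_Int_ae f g : tame f -> tame g ->
  (forall z, 0 <= z.1 < 1 -> f z = g z) -> I f = I g.
Proof.
move=> [mf _] [mg _] fg; rewrite /Rintegral; congr fine.
apply: ae_eq_integral => //; [exact/measurable_EFinP|exact/measurable_EFinP|].
case: phase_ae_lt1 => N [mN N0 subN]; exists N; split => //.
apply: subset_trans subN => z /= h k; apply: h => _; congr EFin; exact: fg.
Qed.

Lemma tame_Int_bound f B : tame f -> 0 <= B -> {ae nu, forall z, `|f z| <= B} ->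
  `|I f| <= B.
Proof.
move=> tf B0 fB; rewrite (le_trans (le_normr_Rintegral _ (tame_integrable tf)))//.
rewrite -[leRHS]tame_Int_cst /Rintegral; apply: fine_le.
- by apply: integrable_fin_num => //; exact: (tame_integrable (tame_norm tf)).
- by apply: integrable_fin_num => //; exact: (tame_integrable (tame_cst B)).
apply: ae_ge0_le_integral => //.
- by apply/measurable_EFinP; case: (tame_norm tf).
case: fB => N [mN N0 subN]; exists N; split => //.
by apply: subset_trans subN => z /= h k; apply: h => _; rewrite lee_fin.
Qed.

End BoundedIntegrals.

Section Duality.
Variables (R : realType) (a : R).
Hypotheses (a_gt0 : 0 < a) (a_lt1 : a < 1).
Local Notation Omega := (measurableTypeR R * circle R)%type.
Local Notation nu := (@phase_measure R).
Local Notation I f := (Rintegral nu setT f).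
Local Notation Z := (inverse_branch a).
Implicit Types (f g h : Omega -> R) (z : Omega).

Let mZ b : measurable_fun setT (Z b) := measurable_inverse_branch a_gt0 a_lt1 b.

Lemma phase_measure_rectangle b (A : set (measurableTypeR R)) (B : set (circle R)) :
  measurable A -> measurable B ->
  nu (Z b @^-1` (A `*` B)) = (lebesgue01 (branch b @^-1` A) * lebesgue_circle B)%E.
Proof.
move=> mA mB.
have mA' : measurable (branch b @^-1` A : set (measurableTypeR R)).
  by rewrite -[X in measurable X]setTI; exact: measurable_branch.
transitivity (\int[@lebesgue01 R]_x
    ((\1_(branch b @^-1` A : set (measurableTypeR R)) x)%:E * lebesgue_circle B))%E;
    last first.
  rewrite ge0_integralZr ?integral_indic ?setIT//.
  exact: measurableT_comp.
apply: eq_integral.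
move=> x _; rewrite indicE; have [xA|xA] /= := boolP (x \in _).
  rewrite mul1e -(@lebesgue_circle_translation R (- to_circle (roof a (branch b x))) B mB).
  congr (lebesgue_circle _); apply/seteqP; split=> u /=.
    by move=> /set_mem[].
  by move=> Bu; apply: mem_set; split => //; exact: set_mem xA.
rewrite mul0e [X in lebesgue_circle X](_ : _ = set0) ?measure0//.
apply/seteqP; split=> // u /set_mem[/= Ax _].
by move/negP: xA; apply; exact: mem_set.
Qed.

Lemma phase_measure_branches (X : set Omega) : measurable X ->
  nu X = (2^-1%:E * (nu (Z false @^-1` X) + nu (Z true @^-1` X)))%E.
Proof.
move=> mX.
pose m b : {measure set Omega -> \bar R} :=
  measure_function_pushforward__canonical__measure_function_Measure nu (mZ b).
have h0 : (0 : R) <= 2^-1 by rewrite invr_ge0.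
pose m' : {measure set Omega -> \bar R} :=
  mscale (NngNum h0) (measure_add (m false) (m true)).
have m'E Y : m' Y = (2^-1%:E * (nu (Z false @^-1` Y) + nu (Z true @^-1` Y)))%E.
  by rewrite -[LHS]/(2^-1%:E * measure_add (m false) (m true) Y)%E measure_addE.
rewrite -m'E; apply: product_measure_unique mX => A B mA mB.
rewrite [LHS]m'E !phase_measure_rectangle//.
by rewrite -ge0_muleDl ?measure_ge0// muleA -lebesgue01_branches.
Qed.

Lemma ge0_integral_branches (W : Omega -> \bar R) : measurable_fun setT W ->
  (forall z, 0 <= W z)%E ->
  (\int[nu]_z W z = 2^-1%:E * (\int[nu]_z W (Z false z) + \int[nu]_z W (Z true z)))%E.
Proof.
move=> mW W0.
pose m b : {measure set Omega -> \bar R} :=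
  measure_function_pushforward__canonical__measure_function_Measure nu (mZ b).
have h0 : (0 : R) <= 2^-1 by rewrite invr_ge0.
pose m' : {measure set Omega -> \bar R} :=
  mscale (NngNum h0) (measure_add (m false) (m true)).
transitivity (\int[m']_z W z)%E.
  apply: eq_measure_integral => X mX _; rewrite [LHS]phase_measure_branches//.
  by rewrite -[RHS]/(2^-1%:E * measure_add (m false) (m true) X)%E measure_addE.
have W0T z : [set: Omega] z -> (0 <= W z)%E by move=> _.
transitivity (2^-1%:E * \int[measure_add (m false) (m true)]_z W z)%E.
  exact: (ge0_integral_mscale _ measurableT (NngNum h0) mW W0T).
congr (_ * _)%E; transitivity (\int[m false]_z W z + \int[m true]_z W z)%E.
  exact: (ge0_integral_measure_add _ _ measurableT W0T mW).
have push b : (\int[m b]_z W z = \int[nu]_z W (Z b z))%E.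
  exact: (ge0_integral_pushforward (mZ b) nu measurableT mW (fun z _ => W0 z)).
exact: (f_equal2 adde (push false) (push true)).
Qed.

Lemma mean_shift (x y z c : R) : x + c = (y + c + (z + c)) / 2 -> x = (y + z) / 2.
Proof. by move=> h; lra. Qed.

Lemma fine_mean (x y z : \bar R) : (x = 2^-1%:E * (y + z))%E ->
  y \is a fin_num -> z \is a fin_num -> fine x = (fine y + fine z) / 2.
Proof.
move=> -> /fineK <- /fineK <-; rewrite -EFinD -EFinM /=.
by rewrite mulrC.
Qed.

Lemma tame_Int_branches f : tame f ->
  I f = (I (fun z => f (Z false z)) + I (fun z => f (Z true z))) / 2.
Proof.
move=> tf; have [mf [M fM]] := tf.
pose c := `|M| + 1.
have c0 z : 0 <= f z + c.
  have := fM z; have := ler_norm M; rewrite /c ler_norml => h /andP[h1 _]; lra.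
have tfc := tameD tf (tame_cst c).
have tb b := tame_comp (mZ b) tf.
have mfc : measurable_fun setT (fun z => (f z + c)%:E).
  by apply/measurable_EFinP; case: tfc.
have := ge0_integral_branches mfc (fun z => c0 z).
move=> hE.
have fin b : (\int[nu]_z (f (Z b z) + c)%:E)%E \is a fin_num.
  by apply: integrable_fin_num => //; exact: (tame_integrable (tameD (tb b) (tame_cst c))).
have Ic g : tame g -> fine (\int[nu]_z (g z + c)%:E)%E = I g + c.
  by move=> tg; rewrite -[RHS]/(I g + c) -{2}(tame_Int_cst c) -tame_IntD//; exact: tame_cst.
have E1 := etrans (esym (Ic f tf)) (fine_mean hE (fin false) (fin true)).
have E2 := etrans E1 (f_equal2 (fun p q => (p + q) / 2) (Ic _ (tb false)) (Ic _ (tb true))).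
exact: mean_shift E2.
Qed.

Definition phase_transfer n h z : R :=
  avg n (fun w => h (branches w z.1, z.2 - to_circle (birkhoff (roof a) w z.1))).

Lemma phase_transferS n h z : phase_transfer n.+1 h z =
  (phase_transfer n h (Z false z) + phase_transfer n h (Z true z)) / 2.
Proof.
rewrite /phase_transfer /=; congr ((_ + _) / 2); apply: eq_avg => w _;
by rewrite to_circleD opprD addrA.
Qed.

Lemma tame_transfer n h : tame h -> tame (phase_transfer n h).
Proof.
move=> th; elim: n => [|n IH].
  rewrite (_ : phase_transfer 0 h = h)//; apply/funext => -[x u].
  by rewrite /phase_transfer /= to_circle0 subr0.
rewrite (_ : phase_transfer n.+1 h = fun z => (phase_transfer n h (Z false z) +
  phase_transfer n h (Z true z)) * 2^-1); last first.
  by apply/funext => z; rewrite phase_transferS.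
apply: (tameM _ (tame_cst 2^-1)).
by apply: tameD; exact: tame_comp.
Qed.

Lemma duality1 g h : tame g -> tame h ->
  I (fun z => g (skew_product a z) * h z) = I (fun z => g z * ((h (Z false z) + h (Z true z)) / 2)).
Proof.
move=> tg th.
have tgF := tame_comp (measurable_skew_product a_gt0 a_lt1) tg.
have tb b := tame_comp (mZ b) th.
have tgb b := tame_comp (mZ b) tgF.
rewrite tame_Int_branches; last exact: tameM.
have E b : I (fun z => g (skew_product a (Z b z)) * h (Z b z)) =
    I (fun z => g z * h (Z b z)).
  apply: tame_Int_ae; [exact: tameM (tgb b) (tb b)|exact: tameM|].
  by move=> z z1; rewrite skew_product_inverse_branch.
rewrite !E -tame_IntD; [|exact: tameM|exact: tameM].
rewrite mulrC -tame_IntZ; last by apply: tameD; exact: tameM.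
by congr (Rintegral _ _ _); apply/funext => z; ring.
Qed.

Lemma duality n g h : tame g -> tame h ->
  I (fun z => g (iter n (skew_product a) z) * h z) = I (fun z => g z * phase_transfer n h z).
Proof.
move=> + th; elim: n g => [|n IH] g tg.
  congr (Rintegral _ _ _); apply/funext => -[x u]; congr (_ * _).
  by rewrite /phase_transfer /= to_circle0 subr0.
have tgF := tame_comp (measurable_skew_product a_gt0 a_lt1) tg.
transitivity (I (fun z => g (skew_product a z) * phase_transfer n h z)).
  by rewrite -IH.
rewrite duality1//; last exact: tame_transfer.
by congr (Rintegral _ _ _); apply/funext => z; rewrite phase_transferS.
Qed.

Lemma correlation_from_oscillation n g h (G e : R) : tame g -> tame h ->
  0 <= G -> 0 <= e -> {ae nu, forall z, `|g z| <= G} ->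
  (forall z z', 0 <= z.1 <= 1 -> 0 <= z'.1 <= 1 ->
     `|phase_transfer n h z - phase_transfer n h z'| <= e) ->
  `|I (fun z => g (iter n (skew_product a) z) * h z) - I g * I h| <= G * e.
Proof.
move=> tg th G0 e0 gG osc.
have tT := tame_transfer n th.
have ae01 (P : Omega -> Prop) : (forall z, 0 <= z.1 <= 1 -> P z) -> {ae nu, forall z, P z}.
  move=> HP; case: (phase_ae_lt1 R) => N [mN N0 subN]; exists N; split => //.
  apply: subset_trans subN => z /= nP /andP[z0 z1]; apply: nP.
  by apply: HP; rewrite z0 ltW.
have hT : I h = I (phase_transfer n h).
  have := duality n (tame_cst (1 : R)) th.
  have mul1 k : (fun z : Omega => 1 * k z) = k by apply/funext => z; rewrite mul1r.
  by rewrite /= !mul1.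
have tTN (c : R) : tame (fun z => phase_transfer n h z - c).
  exact: tameD tT (tame_cst (- c)).
have dev z : 0 <= z.1 <= 1 -> `|phase_transfer n h z - I h| <= e.
  move=> z01; rewrite distrC hT.
  have -> : I (phase_transfer n h) - phase_transfer n h z =
      I (fun z' => phase_transfer n h z' - phase_transfer n h z).
    by rewrite (tame_IntD tT (tame_cst (- phase_transfer n h z))) tame_Int_cst.
  apply: tame_Int_bound => //; apply: ae01 => z' z'01; exact: osc.
rewrite duality//.
have -> : I (fun z => g z * phase_transfer n h z) - I g * I h =
    I (fun z => g z * (phase_transfer n h z - I h)).
  rewrite (_ : (fun z => g z * (_ - _)) = (fun z => g z * phase_transfer n h z +
     (- I h) * g z)); last by apply/funext => z; ring.
  rewrite tame_IntD; [|exact: tameM|exact: tameM (tame_cst _) tg].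
  by rewrite tame_IntZ//; ring.
apply: tame_Int_bound; [exact: tameM|exact: mulr_ge0|].
case: gG => N [mN N0 subN]; case: (ae01 _ dev) => N' [mN' N'0 subN'].
exists (N `|` N'); split; [exact: measurableU| |].
  by rewrite measureU0.
move=> z /= nP; have [h1|h1] := pselect (`|g z| <= G); last by left; exact: subN.
right; apply: subN' => /= h2; apply: nP.
by rewrite normrM; exact: ler_pM.
Qed.

End Duality.

(** * From clamped observables to the theorem *)

Section Observables.
Variables (R : realType) (a : R).
Hypotheses (a_gt0 : 0 < a) (a_lt1 : a < 1).
Local Notation normc := (@ComplexField.Normc.normc R).
Local Notation Omega := (measurableTypeR R * circle R)%type.
Local Notation nu := (@phase_measure R).
Local Notation I f := (Rintegral nu setT f).
Implicit Types (x y M K W alpha : R) (f : R * circle R -> R)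
  (g h : R * circle R -> R[i]) (z w : R * circle R).

(* The hypotheses on observables only constrain their values on [phase_space];
   clamping yields functions with the same bounds everywhere. *)
Definition clamp x : R := Num.max 0 (Num.min x 1).

Definition clamped (T : Type) (f : R * circle R -> T) (z : Omega) : T :=
  f (clamp z.1, z.2).

Lemma clamp_itv x : 0 <= clamp x <= 1.
Proof. by rewrite /clamp le_max lexx ge_max ler01 ge_min lexx orbT. Qed.

Lemma clamp_id x : 0 <= x <= 1 -> clamp x = x.
Proof. by move=> /andP[x0 x1]; rewrite /clamp min_l// max_r. Qed.

Lemma clamp_cases x :
  [\/ x <= 0 /\ clamp x = 0, 1 <= x /\ clamp x = 1 | 0 <= x <= 1 /\ clamp x = x].
Proof.
have [x0|/ltW x0] := leP x 0.
  by constructor 1; rewrite /clamp max_l// ge_min x0.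
have [x1|/ltW x1] := leP x 1; first by constructor 3; rewrite clamp_id x0.
by constructor 2; rewrite /clamp min_r// max_r.
Qed.

Lemma clamp_lipschitz x y : `|clamp x - clamp y| <= `|x - y|.
Proof.
wlog xy : x y / x <= y => [hw|].
  have [|/ltW] := leP x y; first exact: hw.
  by rewrite distrC [`|x - y|]distrC; exact: hw.
rewrite distrC [`|x - y|]distrC (ger0_norm (_ : 0 <= y - x)) ?subr_ge0// ler_norml.
case: (clamp_cases x) (clamp_cases y) => [[x0 ->]|[x1 ->]|[/andP[x0 x1] ->]];
  case=> [[y0 ->]|[y1 ->]|[/andP[y0 y1] ->]]; apply/andP; split; lra.
Qed.

Lemma phase_spaceE z : phase_space z <-> 0 <= z.1 <= 1.
Proof.
by rewrite /phase_space /=; split; [case; rewrite in_itv|rewrite in_itv].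
Qed.

Lemma clamped_phase (T : Type) (f : R * circle R -> T) z : phase_space z ->
  clamped f z = f z.
Proof. by case: z => x u /phase_spaceE /= x01; rewrite /clamped /= clamp_id. Qed.

Lemma clamp_phase (z : Omega) : phase_space (clamp z.1, z.2).
Proof. by apply/phase_spaceE; exact: clamp_itv. Qed.

Lemma phase_dist_ge0 z w : 0 <= phase_dist z w.
Proof. by rewrite /phase_dist le_max normr_ge0. Qed.

Lemma tame_clamped f M K alpha : 0 < alpha ->
  (forall z, phase_space z -> `|f z| <= M) ->
  (forall z w, phase_space z -> phase_space w ->
     `|f z - f w| <= K * phase_dist z w `^ alpha) ->
  tame (clamped f).
Proof.
move=> al0 fM fK; split; last first.
  by exists M => z; apply: fM; exact: clamp_phase.
apply: measurable_rays => y; apply: box_open_measurable => z /= yz.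
pose d := clamped f z - y.
have d0 : 0 < d by rewrite subr_gt0.
pose K' := `|K| + 1; have K'0 : 0 < K' by rewrite ltr_wpDl.
have dK0 : 0 < d / K' by rewrite divr_gt0.
exists ((d / K') `^ alpha^-1); first by rewrite powR_gt0.
move=> z' h1 h2.
have pd : phase_dist (clamp z.1, z.2) (clamp z'.1, z'.2) < (d / K') `^ alpha^-1.
  rewrite /phase_dist /= gt_max; apply/andP; split; last by rewrite metric_sym.
  by rewrite (le_lt_trans (clamp_lipschitz _ _))// distrC.
have := fK _ _ (clamp_phase z) (clamp_phase z'); rewrite -/(clamped f z) -/(clamped f z').
move: pd (phase_dist_ge0 (clamp z.1, z.2) (clamp z'.1, z'.2)).
move: (phase_dist _ _) => r rd r0 hK.
have : r `^ alpha < d / K'.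
  have -> : d / K' = ((d / K') `^ alpha^-1) `^ alpha.
    by rewrite -powRrM mulVf ?gt_eqF// powRr1// ltW.
  by apply: gt0_ltr_powR => //; rewrite nnegrE// powR_ge0.
rewrite ltr_pdivlMr// mulrC => hd.
have hKK : K * r `^ alpha <= K' * r `^ alpha.
  by rewrite ler_wpM2r ?powR_ge0// /K' (le_trans (ler_norm _))// lerDl.
have := ler_norm (clamped f z - clamped f z').
by move: hK hKK hd; rewrite /d; move: (K * _) (K' * _) => p q; lra.
Qed.

Lemma Rintegral_phase_space f (F : Omega -> R) : tame F ->
  (forall z, phase_space z -> f z = F z) ->
  (\int[nu]_(z in phase_space) f z)%R = I F.
Proof.
move=> tF fF.
have mD : measurable (phase_space : set Omega) by exact: measurableX.
have -> : (\int[nu]_(z in phase_space) f z)%R = (\int[nu]_(z in phase_space) F z)%R.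
  by apply: eq_Rintegral => z /set_mem; exact: fF.
rewrite /Rintegral; congr fine.
have N0 : nu (~` (phase_space : set Omega)) = 0%E.
  case: (phase_ae_lt1 R) => N [mN N0 subN].
  apply: (subset_measure0 (measurableC mD) mN _ N0) => z nz.
  apply: subN => /= /andP[z0 z1]; apply: nz; apply/phase_spaceE.
  by rewrite z0 ltW.
have := negligible_integral (measurableC mD) measurableT (tame_integrable tF) N0.
by rewrite setTD setCK => ->.
Qed.

Lemma iter_phase_space n z : phase_space z -> phase_space (iter n (skew_product a) z).
Proof. by elim: n => [//|n IH] pz /=; apply/skew_product_phase_space/IH. Qed.

Lemma hoelder_periodic_clamped f W alpha : 0 < alpha -> 0 <= W ->
  (forall z, phase_space z -> `|f z| <= W) ->
  (forall z w, phase_space z -> phase_space w ->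
     `|f z - f w| <= W * phase_dist z w `^ alpha) ->
  hoelder_periodic alpha W (fun x s => clamped f (x, to_circle s)).
Proof.
move=> al0 W0 fW fH; split=> [x s _|x y s x01 y01|x s t m x01].
- by apply: fW; exact: clamp_phase.
- rewrite (le_trans (fH _ _ (clamp_phase _) (clamp_phase _)))//= ler_wpM2l//.
  rewrite /phase_dist /= mdistxx max_l//.
  by apply: ge0_ler_powR; rewrite ?nnegrE ?(ltW al0)// clamp_lipschitz.
rewrite (le_trans (fH _ _ (clamp_phase _) (clamp_phase _)))//= ler_wpM2l//.
rewrite /phase_dist /= subrr normr0 max_r ?mdist_ge0//.
by apply: ge0_ler_powR; rewrite ?nnegrE ?(ltW al0) ?mdist_ge0// to_circle_mdist_int.
Qed.

Lemma phase_transfer_lift n (F : Omega -> R) x s :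
  phase_transfer a n F (x, to_circle s) =
  skew_transfer a n (fun x s => F (x, to_circle s)) x s.
Proof.
rewrite /phase_transfer /skew_transfer; apply: eq_avg => w _ /=.
by rewrite to_circleD to_circleN.
Qed.

Lemma decay_real alpha : 0 < alpha -> exists theta C : R,
  [/\ 0 < theta, theta < 1, 0 < C & forall (F : Omega -> R) f G W n,
  tame F -> 0 <= G -> 0 <= W -> {ae nu, forall z, `|F z| <= G} ->
  (forall z, phase_space z -> `|f z| <= W) ->
  (forall z w, phase_space z -> phase_space w ->
     `|f z - f w| <= W * phase_dist z w `^ alpha) ->
  `|I (fun z => F (iter n (skew_product a) z) * clamped f z) - I F * I (clamped f)|
   <= G * (C * theta ^+ n * W)].
Proof.
move=> al0; have [th [C [th0 th1 C0 osc]]] := skew_transfer_osc a_gt0 a_lt1 al0.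
exists th, C; split => // F f G W n tF G0 W0 FG fW fH.
apply: correlation_from_oscillation => //.
- exact: tame_clamped al0 fW fH.
- by rewrite mulr_ge0// mulr_ge0 ?exprn_ge0// ltW.
move=> [x u] [y v] /= x01 y01.
have [s _ <-] := to_circle_lift u; have [t _ <-] := to_circle_lift v.
rewrite !phase_transfer_lift.
exact: osc (hoelder_periodic_clamped al0 W0 fW fH) _ _ _ _ _ x01 y01.
Qed.

End Observables.

Section Norms.
Variable R : realType.
Local Notation normc := (@ComplexField.Normc.normc R).
Implicit Types (alpha M K : R) (g h : R * circle R -> R[i]) (z w : R * circle R).

Lemma normc_le_abs (p q : R) : normc (p +i* q)%C <= `|p| + `|q|.
Proof.
rewrite /= -[leRHS]ger0_norm ?addr_ge0 ?normr_ge0// -[leRHS]sqrtr_sqr ler_wsqrtr// sqrrD !real_normK ?num_real//.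
have : 0 <= `|p| * `|q| by rewrite mulr_ge0.
lra.
Qed.

Lemma abs_Im_le (z : R[i]) : `|complex.Im z| <= normc z.
Proof.
by case: z => p q /=; rewrite -sqrtr_sqr ler_wsqrtr// lerDr sqr_ge0.
Qed.

Lemma phase_dist_gt0 z w : z <> w -> 0 < phase_dist z w.
Proof.
case: z w => [x u] [y v] zw; rewrite /phase_dist /= lt_max normr_gt0 subr_eq0.
rewrite mdist_gt0 -negb_and; apply/negP => /andP[/eqP xy /eqP uv].
by apply: zw; rewrite xy uv.
Qed.

Lemma hoelder_norm_bound alpha h : 0 < alpha ->
  bounded_observable h -> hoelder_observable alpha h ->
  exists W : R, [/\ 0 <= W, hoelder_norm alpha h = W%:E,
    forall z, phase_space z -> normc (h z) <= W &
    forall z w, phase_space z -> phase_space w ->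
      normc (h z - h w) <= W * phase_dist z w `^ alpha].
Proof.
move=> al0 [M hM] [K hK].
have p0 : phase_space ((0 : R), (0 : circle R)) by apply/phase_spaceE => /=; rewrite lexx ler01.
have p1 : phase_space ((1 : R), (0 : circle R)) by apply/phase_spaceE => /=; rewrite lexx ler01.
pose S := fine (sup_norm h); pose H := fine (hoelder_seminorm alpha h).
have ratio z w : phase_space z -> phase_space w -> z <> w ->
    normc (h z - h w) / phase_dist z w `^ alpha <= K.
  move=> pz pw zw; rewrite ler_pdivrMr; first exact: hK.
  by rewrite powR_gt0// phase_dist_gt0.
have supM : (sup_norm h <= M%:E)%E.
  by apply: ge_ereal_sup => _ [z pz <-]; rewrite lee_fin; exact: hM.
have sup_ge z : phase_space z -> ((normc (h z))%:E <= sup_norm h)%E.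
  by move=> pz; apply: ereal_sup_ubound; exists z.
have supE : sup_norm h = S%:E.
  rewrite /S fineK// fin_numElt (lt_le_trans _ (sup_ge _ p0)) ?ltNyr//=.
  by rewrite (le_lt_trans supM)// ltry.
have semiK : (hoelder_seminorm alpha h <= K%:E)%E.
  by apply: ge_ereal_sup => _ [z [w [pz pw zw ->]]]; rewrite lee_fin; exact: ratio.
have semi_ge z w : phase_space z -> phase_space w -> z <> w ->
    ((normc (h z - h w) / phase_dist z w `^ alpha)%:E <= hoelder_seminorm alpha h)%E.
  by move=> pz pw zw; apply: ereal_sup_ubound; exists z, w.
have p01 : ((0 : R), (0 : circle R)) <> ((1 : R), (0 : circle R)).
  by case=> /eqP; rewrite eq_sym oner_eq0.
have semiE : hoelder_seminorm alpha h = H%:E.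
  rewrite /H fineK// fin_numElt (lt_le_trans _ (semi_ge _ _ p0 p1 p01)) ?ltNyr//=.
  by rewrite (le_lt_trans semiK)// ltry.
have S0 : 0 <= S.
  by rewrite -lee_fin -supE (le_trans _ (sup_ge _ p0))// lee_fin normc_ge0.
have H0 : 0 <= H.
  rewrite -lee_fin -semiE (le_trans _ (semi_ge _ _ p0 p1 p01))// lee_fin.
  by rewrite divr_ge0 ?normc_ge0 ?powR_ge0.
exists (S + H); split; first exact: addr_ge0.
- by rewrite /hoelder_norm supE semiE EFinD.
- move=> z pz; apply: (@le_trans _ _ S); last by rewrite lerDl.
  by rewrite -lee_fin -supE; exact: sup_ge.
move=> z w pz pw; have [->|/eqP zw] := eqVneq z w.
  by rewrite subrr ComplexField.Normc.normc0 mulr_ge0 ?powR_ge0// addr_ge0.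
have r0 : 0 < phase_dist z w `^ alpha by rewrite powR_gt0// phase_dist_gt0.
rewrite -ler_pdivrMr// (@le_trans _ _ H)//; last by rewrite lerDr.
by rewrite -lee_fin -semiE; exact: semi_ge.
Qed.

Lemma Linfty_norm_bound g : bounded_observable g -> exists G : R,
  [/\ 0 <= G, Linfty_norm g = G%:E & {ae phase_measure, forall z, normc (g z) <= G}].
Proof.
move=> [M gM].
have nu0 : (0 < phase_measure [set: measurableTypeR R * circle R])%E.
  by rewrite phase_measure_setT lte_fin ltr01.
have LE : Linfty_norm g = ess_sup phase_measure (fun z => `|(normc (g z))%:E|%E).
  by rewrite /Linfty_norm unlock nu0.
have L0 : (0 <= Linfty_norm g)%E by exact: Lnorm_ge0.
have LM : (Linfty_norm g <= `|M|%:E)%E.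
  rewrite LE; apply/ess_supP.
  case: (phase_ae_lt1 R) => N [mN N0 subN]; exists N; split => //.
  apply: subset_trans subN => z /= h /andP[z0 z1]; apply: h.
  rewrite lee_fin ger0_norm ?normc_ge0// (le_trans (gM z _)) ?ler_norm//.
  by apply/phase_spaceE; rewrite z0 ltW.
have Lfin : Linfty_norm g \is a fin_num.
  by rewrite fin_numElt (lt_le_trans _ L0)//= (le_lt_trans LM)// ltry.
exists (fine (Linfty_norm g)); split; [exact: fine_ge0|by rewrite fineK|].
have := @ess_sup_ge _ _ _ phase_measure (fun z => `|(normc (g z))%:E|%E).
rewrite -LE => -[N [mN N0 subN]]; exists N; split => //.
apply: subset_trans subN => z /= h k; apply: h.
move: k; rewrite -(fineK Lfin) lee_fin ger0_norm// normc_ge0.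
exact.
Qed.

End Norms.

Lemma normc_bilinear_defect (R : realType) (e : R) (p11 p22 p12 p21 a1 a2 b1 b2 : R) :
  `|p11 - a1 * b1| <= e -> `|p22 - a2 * b2| <= e ->
  `|p12 - a1 * b2| <= e -> `|p21 - a2 * b1| <= e ->
  ComplexField.Normc.normc
    (((p11 - p22) +i* (p12 + p21))%C - (a1 +i* a2)%C * (b1 +i* b2)%C) <= 4 * e.
Proof.
move=> h1 h2 h3 h4.
have -> : ((p11 - p22) +i* (p12 + p21))%C - (a1 +i* a2)%C * (b1 +i* b2)%C =
  (((p11 - a1 * b1) - (p22 - a2 * b2)) +i* ((p12 - a1 * b2) + (p21 - a2 * b1)))%C.
  by apply/eqP; rewrite eq_complex /=; apply/andP; split; apply/eqP; ring.
rewrite (le_trans (normc_le_abs _ _))//.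
have := ler_normB (p11 - a1 * b1) (p22 - a2 * b2).
have := ler_normD (p12 - a1 * b2) (p21 - a2 * b1).
lra.
Qed.

Theorem theorem3 (R : realType) (a : R) (ha0 : 0 < a) (ha1 : a < 1) :
  forall U : set (R * circle R),
    phase_neighbourhood fibre_over_1 U ->
  forall alpha : R, 0 < alpha ->
  exists theta C : R, [/\ 0 < theta, theta < 1, 0 < C &
    forall g h : R * circle R -> R[i],
      bounded_observable g -> hoelder_observable alpha g ->
      supported_on (~` U) g ->
      bounded_observable h -> hoelder_observable alpha h ->
      supported_on (~` U) h ->
    forall n : nat,
      ((ComplexField.Normc.normc
         (phase_integral (fun z => g (iter n (skew_product a) z) * h z)
          - phase_integral g * phase_integral h))%:E
       <= (C * theta ^+ n)%:E * Linfty_norm g * hoelder_norm alpha h)%E].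
Proof.
move=> U _ alpha al0; have [th [C [th0 th1 C0 decay]]] := decay_real ha0 ha1 al0.
exists th, (4 * C); split => //; first exact: mulr_gt0.
move=> g h bg [Kg hg] _ bh hh _ n.
have [W [W0 WE hW hH]] := hoelder_norm_bound al0 bh hh.
have [G [G0 GE gG]] := Linfty_norm_bound bg.
have [Mg gM] := bg.
pose part (b : bool) : R[i] -> R := if b then @complex.Im R else @complex.Re R.
have partD b : {morph part b : z z' / z - z'}.
  by case: b => z z'; rewrite /part /= raddfB.
have part_le b z : `|part b z| <= ComplexField.Normc.normc z.
  by case: b; [exact: abs_Im_le|exact: abs_Re_le].
have tg b : tame (clamped (part b \o g)).
  apply: (tame_clamped (M := Mg) (K := Kg) al0) => [z pz|z w pz pw] /=.
    by rewrite (le_trans (part_le _ _))// gM.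
  by rewrite -partD (le_trans (part_le _ _))// hg.
have hW' b z : phase_space z -> `|(part b \o h) z| <= W.
  by move=> pz; rewrite (le_trans (part_le _ _))// hW.
have hH' b z w : phase_space z -> phase_space w ->
    `|(part b \o h) z - (part b \o h) w| <= W * phase_dist z w `^ alpha.
  by move=> pz pw; rewrite /= -partD (le_trans (part_le _ _))// hH.
have th' b : tame (clamped (part b \o h)) by exact: tame_clamped al0 (hW' b) (hH' b).
have gG' b : {ae phase_measure, forall z : measurableTypeR R * circle R,
    `|clamped (part b \o g) z| <= G}.
  case: gG => N [mN N0 subN]; case: (phase_ae_lt1 R) => N' [mN' N'0 subN'].
  exists (N `|` N'); split; [exact: measurableU|by rewrite measureU0|].
  move=> z /= nz; have [z01|z01] := pselect (is_true (0 <= z.1 < 1)); last by right; exact: subN'.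
  left; apply: subN => /= gz; apply: nz.
  rewrite clamped_phase; first exact: le_trans (part_le _ _) gz.
  by case/andP: z01 => z0 z1; apply/phase_spaceE; rewrite z0 ltW.
pose J (b c : bool) := Rintegral phase_measure setT
  (fun z : measurableTypeR R * circle R =>
     clamped (part b \o g) (iter n (skew_product a) z) * clamped (part c \o h) z).
pose Ig b := Rintegral phase_measure setT (clamped (part b \o g)).
pose Ih b := Rintegral phase_measure setT (clamped (part b \o h)).
have bound b c : `|J b c - Ig b * Ih c| <= G * (C * th ^+ n * W).
  exact: (decay _ _ G W n (tg b) G0 W0 (gG' b) (hW' c) (hH' c)).
have tJ b c : tame (fun z : measurableTypeR R * circle R =>
     clamped (part b \o g) (iter n (skew_product a) z) * clamped (part c \o h) z).
  apply: tameM (th' c); elim: (n) => [|k IH]; first exact: tg.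
  under eq_fun do rewrite iterSr.
  exact: (tame_comp (measurable_skew_product ha0 ha1) IH).
have onphase b (k : R * circle R -> R[i]) z : phase_space z ->
    part b (k z) = clamped (part b \o k) z by move=> pz; rewrite clamped_phase.
have -> : phase_integral g = (Ig false +i* Ig true)%C.
  rewrite /phase_integral; congr (_ +i* _)%C; apply: Rintegral_phase_space => // z pz.
    exact: (onphase false).
  exact: (onphase true).
have -> : phase_integral h = (Ih false +i* Ih true)%C.
  rewrite /phase_integral; congr (_ +i* _)%C; apply: Rintegral_phase_space => // z pz.
    exact: (onphase false).
  exact: (onphase true).
have -> : phase_integral (fun z => g (iter n (skew_product a) z) * h z) =
    ((J false false - J true true) +i* (J false true + J true false))%C.
  rewrite /phase_integral; congr (_ +i* _)%C.
    rewrite -[J true true]mul1r -mulNr -tame_IntZ// -tame_IntD//; last first.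
      exact: tameM (tame_cst _) (tJ true true).
    apply: Rintegral_phase_space => [|z pz].
      by apply: tameD => //; exact: tameM (tame_cst _) (tJ true true).
    rewrite !(clamped_phase _ pz) !(clamped_phase _ (iter_phase_space _ _ pz)) /=.
    by case: (g _) (h _) => [p q] [p' q'] /=; ring.
  rewrite -tame_IntD//; apply: Rintegral_phase_space => [|z pz]; first exact: tameD.
  rewrite !(clamped_phase _ pz) !(clamped_phase _ (iter_phase_space _ _ pz)) /=.
  by case: (g _) (h _) => [p q] [p' q'] /=; ring.
rewrite WE GE -!EFinM lee_fin.
rewrite (_ : 4 * C * th ^+ n * G * W = 4 * (G * (C * th ^+ n * W))); last by ring.
by apply: normc_bilinear_defect; exact: bound.
Qed.
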